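(* Let $\mathcal{C}$ be an additive category with an automorphism $\Sigma$, let $n\ge3$, and let $\mathscr{N}$ be a collection of $n$-$\Sigma$-sequences in $\mathcal{C}$ satisfying the axioms (N1), (N2) and (N3). Then $\mathscr{N}$ satisfies (N4) if and only if $\mathscr{N}$ satisfies (N4* ).
   Context: $\mathcal{C}$ is an additive category, $\Sigma$ an automorphism of $\mathcal{C}$, $n\ge3$. An $n$-$\Sigma$-sequence is a diagram $A_1\xrightarrow{\alpha_1}A_2\to\cdots\xrightarrow{\alpha_{n-1}}A_n\xrightarrow{\alpha_n}\Sigma A_1$; its left rotation is $A_2\xrightarrow{\alpha_2}\cdots\xrightarrow{\alpha_n}\Sigma A_1\xrightarrow{(-1)^n\Sigma\alpha_1}\Sigma A_2$. A morphism $(\varphi_1,\dots,\varphi_n)\colon A_\bullet\to B_\bullet$ consists of $\varphi_i\colon A_i\to B_i$ with $\varphi_{i+1}\alpha_i=\beta_i\varphi_i$ ($1\le i\le n-1$) and $\Sigma\varphi_1\alpha_n=\beta_n\varphi_n$; isomorphisms have all $\varphi_i$ invertible. Direct sums are termwise; $A_\bullet$ is a direct summand of $B_\bullet$ if there are morphisms $\varphi\colon A_\bullet\to B_\bullet$, $\psi\colon B_\bullet\to A_\bullet$ with $\psi_i\varphi_i=1$. The mapping cone of $(\varphi_1,\dots,\varphi_n)$ is $A_2\oplus B_1\xrightarrow{\left[\begin{smallmatrix}-\alpha_2&0\\ \varphi_2&\beta_1\end{smallmatrix}\right]}A_3\oplus B_2\to\cdots\xrightarrow{\left[\begin{smallmatrix}-\alpha_n&0\\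 \varphi_n&\beta_{n-1}\end{smallmatrix}\right]}\Sigma A_1\oplus B_n\xrightarrow{\left[\begin{smallmatrix}-\Sigma\alpha_1&0\\ \Sigma\varphi_1&\beta_n\end{smallmatrix}\right]}\Sigma A_2\oplus\Sigma B_1$ (the map $A_k\oplus B_{k-1}\to A_{k+1}\oplus B_k$ being $\left[\begin{smallmatrix}-\alpha_k&0\\ \varphi_k&\beta_{k-1}\end{smallmatrix}\right]$). Sequences in $\mathscr{N}$ are called $n$-angles. Axioms: (N1)(a) $\mathscr{N}$ is closed under direct sums, direct summands and isomorphisms; (b) $A\xrightarrow{1}A\to0\to\cdots\to0\to\Sigma A$ is in $\mathscr{N}$ for every $A$; (c) every morphism $A_1\to A_2$ is the first morphism of some sequence in $\mathscr{N}$. (N2) a sequence is in $\mathscr{N}$ iff its left rotation is. (N3) given $A_\bullet,B_\bullet\in\mathscr{N}$ and $\varphi_1,\varphi_2$ with $\varphi_2\alpha_1=\beta_1\varphi_1$, there exist $\varphi_3,\dots,\varphi_n$ making $(\varphi_1,\dots,\varphi_n)$ a morphism. (N4) in the situation of (N3), $\varphi_3,\dots,\varphi_n$ can be chosen so that the mapping cone is in $\mathscr{N}$. (N4* ): Suppose given $n$-angles $A_1\xrightarrow{\alpha_1}A_2\xrightarrow{\alpha_2}\cdots\xrightarrow{\alpha_n}\Sigma A_1$, $A_1\xrightarrow{\beta_1}B_2\xrightarrow{\beta_2}B_3\to\cdots\xrightarrow{\beta_n}\Sigma A_1$ and $A_2\xrightarrow{\varphi_2}B_2\xrightarrow{\gamma_2}C_3\xrightarrow{\gamma_3}\cdots\xrightarrow{\gamma_{n-1}}C_n\xrightarrow{\gamma_n}\Sigma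 A_2$ with $\varphi_2\alpha_1=\beta_1$. Then there exist morphisms $\varphi_i\colon A_i\to B_i$ ($3\le i\le n$) and $\psi_j$ ($1\le j\le 2n-5$) such that (1) $(1_{A_1},\varphi_2,\dots,\varphi_n)$ is a morphism of $n$-$\Sigma$-sequences; (2) $\gamma_n\circ\psi_{2n-5}=\Sigma\alpha_1\circ\beta_n$, and the following $n$-$\Sigma$-sequence $D_1\xrightarrow{d_1}D_2\to\cdots\to D_n\xrightarrow{d_n}\Sigma D_1$ is in $\mathscr{N}$. Set $A_i=B_i=C_i=0$ for $i>n$ and $C_i=0$ for $i\le2$; let $D_1=A_3$ and $D_{k+1}=A_{k+3}\oplus B_{k+2}\oplus C_{k+1}$ for $1\le k\le n-1$ (so $D_2=A_4\oplus B_3$, $D_n=C_n$); $d_1=\left[\begin{smallmatrix}\alpha_3\\ \varphi_3\end{smallmatrix}\right]$; for $1\le k\le n-2$, $d_{k+1}\colon D_{k+1}\to D_{k+2}$ is the matrix $\left[\begin{smallmatrix}-\alpha_{k+3}&0&0\\ (-1)^{k+1}\varphi_{k+3}&-\beta_{k+2}&0\\ \psi_{2k}&\psi_{2k-1}&\gamma_{k+1}\end{smallmatrix}\right]$ with the rows and columns belonging to zero summands deleted (so $d_2=\left[\begin{smallmatrix}-\alpha_4&0\\ \varphi_4&-\beta_3\\ \psi_2&\psi_1\end{smallmatrix}\right]$, the map $A_n\oplus B_{n-1}\oplus C_{n-2}\to B_n\oplus C_{n-1}$ is $\left[\begin{smallmatrix}(-1)^n\varphi_n&-\beta_{n-1}&0\\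 \psi_{2n-6}&\psi_{2n-7}&\gamma_{n-2}\end{smallmatrix}\right]$, and the map $B_n\oplus C_{n-1}\to C_n$ is $[\psi_{2n-5}\ \gamma_{n-1}]$); and $d_n=\Sigma\alpha_2\circ\gamma_n\colon C_n\to\Sigma A_3$. (For $n=3$ this sequence is $A_3\xrightarrow{\varphi_3}B_3\xrightarrow{\psi_1}C_3\xrightarrow{\Sigma\alpha_2\circ\gamma_3}\Sigma A_3$.) *)

(* Defs.v *)
From mathcomp Require Import all_boot.

Set Implicit Arguments.
Unset Strict Implicit.
Unset Printing Implicit Defensive.

Record addcat := AddCat {
  Ob : Type;
  Mor : Type;
  dom : Mor -> Ob;
  cod : Mor -> Ob;
  idm : Ob -> Mor;
  cmp : Mor -> Mor -> Mor;            (* cmp g f = g o f *)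
  zm : Ob -> Ob -> Mor;
  cadd : Mor -> Mor -> Mor;
  copp : Mor -> Mor;
  z0 : Ob;
  bp : Ob -> Ob -> Ob;
  bi1 : Ob -> Ob -> Mor;
  bi2 : Ob -> Ob -> Mor;
  bq1 : Ob -> Ob -> Mor;
  bq2 : Ob -> Ob -> Mor;
  dom_id : forall X, dom (idm X) = X;
  cod_id : forall X, cod (idm X) = X;
  dom_cmp : forall f g, cod f = dom g -> dom (cmp g f) = dom f;
  cod_cmp : forall f g, cod f = dom g -> cod (cmp g f) = cod g;
  cmp_id : forall f, cmp f (idm (dom f)) = f;
  id_cmp : forall f, cmp (idm (cod f)) f = f;
  cmpA : forall f g h, cod f = dom g -> cod g = dom h ->
           cmp h (cmp g f) = cmp (cmp h g) f;
  dom_zm : forall X Y, dom (zm X Y) = X;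
  cod_zm : forall X Y, cod (zm X Y) = Y;
  dom_cadd : forall f g, dom f = dom g -> cod f = cod g -> dom (cadd f g) = dom f;
  cod_cadd : forall f g, dom f = dom g -> cod f = cod g -> cod (cadd f g) = cod f;
  dom_copp : forall f, dom (copp f) = dom f;
  cod_copp : forall f, cod (copp f) = cod f;
  caddA : forall f g h, dom f = dom g -> cod f = cod g -> dom g = dom h ->
            cod g = cod h -> cadd f (cadd g h) = cadd (cadd f g) h;
  caddC : forall f g, dom f = dom g -> cod f = cod g -> cadd f g = cadd g f;
  cadd0 : forall f, cadd (zm (dom f) (cod f)) f = f;
  caddN : forall f, cadd (copp f) f = zm (dom f) (cod f);
  cmp_addl : forall f g g', dom g = dom g' -> cod g = cod g' -> cod f = dom g ->
               cmp (cadd g g') f = cadd (cmp g f) (cmp g' f);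
  cmp_addr : forall f f' g, dom f = dom f' -> cod f = cod f' -> cod f = dom g ->
               cmp g (cadd f f') = cadd (cmp g f) (cmp g f');
  z0_initial : forall f, dom f = z0 -> f = zm z0 (cod f);
  z0_terminal : forall f, cod f = z0 -> f = zm (dom f) z0;
  dom_bi1 : forall X Y, dom (bi1 X Y) = X;
  cod_bi1 : forall X Y, cod (bi1 X Y) = bp X Y;
  dom_bi2 : forall X Y, dom (bi2 X Y) = Y;
  cod_bi2 : forall X Y, cod (bi2 X Y) = bp X Y;
  dom_bq1 : forall X Y, dom (bq1 X Y) = bp X Y;
  cod_bq1 : forall X Y, cod (bq1 X Y) = X;
  dom_bq2 : forall X Y, dom (bq2 X Y) = bp X Y;
  cod_bq2 : forall X Y, cod (bq2 X Y) = Y;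
  bq1i1 : forall X Y, cmp (bq1 X Y) (bi1 X Y) = idm X;
  bq2i2 : forall X Y, cmp (bq2 X Y) (bi2 X Y) = idm Y;
  bq1i2 : forall X Y, cmp (bq1 X Y) (bi2 X Y) = zm Y X;
  bq2i1 : forall X Y, cmp (bq2 X Y) (bi1 X Y) = zm X Y;
  bp_id : forall X Y, cadd (cmp (bi1 X Y) (bq1 X Y)) (cmp (bi2 X Y) (bq2 X Y))
                      = idm (bp X Y)
}.

Arguments z0 {_}.

Record autom (C : addcat) := Autom {
  so : Ob C -> Ob C;
  sm : Mor C -> Mor C;
  dom_sm : forall f, dom (sm f) = so (dom f);
  cod_sm : forall f, cod (sm f) = so (cod f);
  sm_cmp : forall f g, cod f = dom g -> sm (cmp g f) = cmp (sm g) (sm f);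
  sm_id : forall X, sm (idm X) = idm (so X);
  sm_add : forall f g, dom f = dom g -> cod f = cod g ->
             sm (cadd f g) = cadd (sm f) (sm g);
  so_bij : bijective so;
  sm_inj : forall f g, dom f = dom g -> cod f = cod g -> sm f = sm g -> f = g;
  sm_surj : forall X Y g, dom g = so X -> cod g = so Y ->
              exists f, [/\ dom f = X, cod f = Y & sm f = g]
}.

(* Raw data of an n-Sigma-sequence A_1 -> A_2 -> ... -> A_n -> Sigma A_1:
   objects sob i (1 <= i <= n) and morphisms smor i : A_i -> A_{i+1}
   (1 <= i <= n-1), smor n : A_n -> Sigma A_1.  Values at other indices are
   irrelevant (see is_seq). *)
Record sseq (C : addcat) := SSeq { sob : nat -> Ob C; smor : nat -> Mor C }.

Section NAngulated.
Variables (C : addcat) (S : autom C) (n : nat).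

Local Notation Sg := (so S).
Local Notation Sm := (sm S).

Definition is_seq (A : sseq C) : Prop :=
  (forall i, 0 < i < n -> dom (smor A i) = sob A i /\ cod (smor A i) = sob A i.+1)
  /\ dom (smor A n) = sob A n /\ cod (smor A n) = Sg (sob A 1).

Definition signm (k : nat) (f : Mor C) : Mor C := if odd k then copp f else f.

Definition lrot (A : sseq C) : sseq C :=
  SSeq (fun i => if i < n then sob A i.+1 else Sg (sob A 1))
       (fun i => if i < n then smor A i.+1 else signm n (Sm (smor A 1))).

Definition is_smorph (A B : sseq C) (phi : nat -> Mor C) : Prop :=
  [/\ (forall i, 0 < i <= n -> dom (phi i) = sob A i /\ cod (phi i) = sob B i),
      (forall i, 0 < i < n -> cmp (phi i.+1) (smor A i) = cmp (smor B i) (phi i))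
    & cmp (Sm (phi 1)) (smor A n) = cmp (smor B n) (phi n)].

Definition iso_mor (f : Mor C) : Prop :=
  exists g, [/\ dom g = cod f, cod g = dom f,
                cmp g f = idm (dom f) & cmp f g = idm (cod f)].

Definition seq_iso (A B : sseq C) : Prop :=
  exists phi, is_smorph A B phi /\ forall i, 0 < i <= n -> iso_mor (phi i).

(* 2x2 matrix [[a, b], [c, d]] : X1 (+) X2 -> Y1 (+) Y2,
   a : X1 -> Y1, b : X2 -> Y1, c : X1 -> Y2, d : X2 -> Y2 *)
Definition mat2 (X1 X2 Y1 Y2 : Ob C) (a b c d : Mor C) : Mor C :=
  cadd (cadd (cmp (bi1 Y1 Y2) (cmp a (bq1 X1 X2)))
             (cmp (bi1 Y1 Y2) (cmp b (bq2 X1 X2))))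
       (cadd (cmp (bi2 Y1 Y2) (cmp c (bq1 X1 X2)))
             (cmp (bi2 Y1 Y2) (cmp d (bq2 X1 X2)))).

Definition sig_bp (X Y : Ob C) : Mor C :=
  cadd (cmp (Sm (bi1 X Y)) (bq1 (Sg X) (Sg Y)))
       (cmp (Sm (bi2 X Y)) (bq2 (Sg X) (Sg Y))).

(* termwise direct sum of n-Sigma-sequences (the last term
   Sigma A_1 (+) Sigma B_1 is identified with Sigma (A_1 (+) B_1)) *)
Definition dsum (A B : sseq C) : sseq C :=
  SSeq (fun i => bp (sob A i) (sob B i))
       (fun i => if i < n then
          mat2 (sob A i) (sob B i) (sob A i.+1) (sob B i.+1)
               (smor A i) (zm (sob B i) (sob A i.+1))
               (zm (sob A i) (sob B i.+1)) (smor B i)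
        else cmp (sig_bp (sob A 1) (sob B 1))
                 (mat2 (sob A n) (sob B n) (Sg (sob A 1)) (Sg (sob B 1))
                       (smor A n) (zm (sob B n) (Sg (sob A 1)))
                       (zm (sob A n) (Sg (sob B 1))) (smor B n))).

Definition is_summand (A B : sseq C) : Prop :=
  exists phi psi, [/\ is_smorph A B phi, is_smorph B A psi &
    forall i, 0 < i <= n -> cmp (psi i) (phi i) = idm (sob A i)].

Definition trivseq (X : Ob C) : sseq C :=
  SSeq (fun i => if i <= 2 then X else z0)
       (fun i => if i == 1 then idm X else if i == 2 then zm X z0
                 else if i == n then zm z0 (Sg X) else zm z0 z0).

(* mapping cone of phi : A -> B;  k-th object A_{k+1} (+) B_k, where
   A_{n+1} := Sigma A_1, the last object Sigma A_2 (+) Sigma B_1 being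
   identified with Sigma (A_2 (+) B_1) *)
Definition coneA (A : sseq C) (k : nat) : Ob C :=
  if k < n then sob A k.+1 else Sg (sob A 1).

Definition cone (A B : sseq C) (phi : nat -> Mor C) : sseq C :=
  SSeq (fun k => bp (coneA A k) (sob B k))
       (fun k => if k < n then
          mat2 (coneA A k) (sob B k) (coneA A k.+1) (sob B k.+1)
               (copp (smor A k.+1)) (zm (sob B k) (coneA A k.+1))
               (phi k.+1) (smor B k)
        else cmp (sig_bp (sob A 2) (sob B 1))
                 (mat2 (Sg (sob A 1)) (sob B n) (Sg (sob A 2)) (Sg (sob B 1))
                       (copp (Sm (smor A 1))) (zm (sob B n) (Sg (sob A 2)))
                       (Sm (phi 1)) (smor B n))).

(* a summand is [Some X] if present and [None] if it is a (deleted) zero *)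
Definition oob (o : option (Ob C)) : Ob C := if o is Some X then X else z0.
Definition opres (o : option (Ob C)) : bool := if o is Some _ then true else false.

Definition osum (a b : option (Ob C)) : option (Ob C) :=
  match a, b with
  | Some X, Some Y => Some (bp X Y)
  | Some X, None => Some X
  | None, _ => b
  end.

Definition oin1 (a b : option (Ob C)) : Mor C :=
  match a, b with
  | Some X, Some Y => bi1 X Y
  | Some X, None => idm X
  | _, _ => zm (oob a) (oob (osum a b))
  end.
Definition oin2 (a b : option (Ob C)) : Mor C :=
  match a, b with
  | Some X, Some Y => bi2 X Y
  | None, Some Y => idm Y
  | _, _ => zm (oob b) (oob (osum a b))
  end.
Definition opr1 (a b : option (Ob C)) : Mor C :=
  match a, b with
  | Some X, Some Y => bq1 X Y
  | Some X, None => idm X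
  | _, _ => zm (oob (osum a b)) (oob a)
  end.
Definition opr2 (a b : option (Ob C)) : Mor C :=
  match a, b with
  | Some X, Some Y => bq2 X Y
  | None, Some Y => idm Y
  | _, _ => zm (oob (osum a b)) (oob b)
  end.

Definition osum3 (a b c : option (Ob C)) := osum a (osum b c).
Definition nth3 (a b c : option (Ob C)) (j : nat) :=
  match j with 0 => a | 1 => b | _ => c end.
Definition oin3 (a b c : option (Ob C)) (j : nat) : Mor C :=
  match j with
  | 0 => oin1 a (osum b c)
  | 1 => cmp (oin2 a (osum b c)) (oin1 b c)
  | _ => cmp (oin2 a (osum b c)) (oin2 b c)
  end.
Definition opr3 (a b c : option (Ob C)) (j : nat) : Mor C :=
  match j with
  | 0 => opr1 a (osum b c)
  | 1 => cmp (opr1 b c) (opr2 a (osum b c))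
  | _ => cmp (opr2 b c) (opr2 a (osum b c))
  end.

(* 3x3 matrix (M r c) from s0 (+) s1 (+) s2 to t0 (+) t1 (+) t2, rows and
   columns belonging to deleted (zero) summands being deleted *)
Definition mat3 (s0 s1 s2 t0 t1 t2 : option (Ob C)) (M : nat -> nat -> Mor C)
  : Mor C :=
  let X := oob (osum3 s0 s1 s2) in
  let Y := oob (osum3 t0 t1 t2) in
  foldr (fun rc acc =>
           cadd (if opres (nth3 t0 t1 t2 rc.1) && opres (nth3 s0 s1 s2 rc.2)
                 then cmp (oin3 t0 t1 t2 rc.1)
                          (cmp (M rc.1 rc.2) (opr3 s0 s1 s2 rc.2))
                 else zm X Y) acc)
        (zm X Y) [seq (r, c) | r <- iota 0 3, c <- iota 0 3].

(* The sequence D_1 -> ... -> D_n -> Sigma D_1 of (N4* ).  For i >= 2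
   (i = k+1), D_i = A_{i+2} (+) B_{i+1} (+) C_i with A_j = B_j = C_j = 0 for
   j > n and C_j = 0 for j <= 2 (zero summands deleted). *)
Definition DA (A : sseq C) (i : nat) :=
  if i.+2 <= n then Some (sob A i.+2) else None.
Definition DB (B : sseq C) (i : nat) :=
  if i.+1 <= n then Some (sob B i.+1) else None.
Definition DC (Cs : sseq C) (i : nat) :=
  if 3 <= i then Some (sob Cs i) else None.

Definition Dseq (A B Cs : sseq C) (phi psi : nat -> Mor C) : sseq C :=
  SSeq
    (fun i => if i == 1 then sob A 3
              else oob (osum3 (DA A i) (DB B i) (DC Cs i)))
    (fun i =>
       if i == 1 then
         mat3 (Some (sob A 3)) None None (DA A 2) (DB B 2) (DC Cs 2)
              (fun r c => match r with
                          | 0 => smor A 3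
                          | 1 => phi 3
                          | _ => zm (sob A 3) z0 end)
       else if i < n then
         mat3 (DA A i) (DB B i) (DC Cs i) (DA A i.+1) (DB B i.+1) (DC Cs i.+1)
              (fun r c => match r, c with
                          | 0, 0 => copp (smor A i.+2)
                          | 0, 1 => zm (sob B i.+1) (sob A i.+3)
                          | 0, _ => zm (sob Cs i) (sob A i.+3)
                          | 1, 0 => signm i (phi i.+2)
                          | 1, 1 => copp (smor B i.+1)
                          | 1, _ => zm (sob Cs i) (sob B i.+2)
                          | _, 0 => psi (2 * i - 2)
                          | _, 1 => psi (2 * i - 3)
                          | _, _ => smor Cs i
                          end)
       else
         cmp (Sm (smor A 2)) (smor Cs n)).

Definition N1 (N : sseq C -> Prop) : Prop :=
  [/\ (forall A B, N A -> N B -> N (dsum A B)),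
      (forall A B, is_seq A -> N B -> is_summand A B -> N A),
      (forall A B, N A -> is_seq B -> seq_iso A B -> N B),
      (forall X, N (trivseq X))
    & (forall f, exists A, N A /\ smor A 1 = f)].

Definition N2 (N : sseq C -> Prop) : Prop :=
  forall A, is_seq A -> (N A <-> N (lrot A)).

Definition N3 (N : sseq C -> Prop) : Prop :=
  forall A B phi1 phi2, N A -> N B ->
    dom phi1 = sob A 1 -> cod phi1 = sob B 1 ->
    dom phi2 = sob A 2 -> cod phi2 = sob B 2 ->
    cmp phi2 (smor A 1) = cmp (smor B 1) phi1 ->
    exists phi, [/\ phi 1 = phi1, phi 2 = phi2 & is_smorph A B phi].

Definition N4 (N : sseq C -> Prop) : Prop :=
  forall A B phi1 phi2, N A -> N B ->
    dom phi1 = sob A 1 -> cod phi1 = sob B 1 ->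
    dom phi2 = sob A 2 -> cod phi2 = sob B 2 ->
    cmp phi2 (smor A 1) = cmp (smor B 1) phi1 ->
    exists phi, [/\ phi 1 = phi1, phi 2 = phi2, is_smorph A B phi
                  & N (cone A B phi)].

(* typing of psi_1, ..., psi_{2n-5} as dictated by their position in D *)
Definition psi_typed (A B Cs : sseq C) (psi : nat -> Mor C) : Prop :=
  (forall k, 0 < k <= n - 2 ->
     dom (psi (2 * k - 1)) = sob B k.+2 /\ cod (psi (2 * k - 1)) = sob Cs k.+2) /\
  (forall k, 0 < k <= n - 3 ->
     dom (psi (2 * k)) = sob A k.+3 /\ cod (psi (2 * k)) = sob Cs k.+2).

Definition N4star (N : sseq C -> Prop) : Prop :=
  forall (A B Cs : sseq C) (phi2 : Mor C), N A -> N B -> N Cs ->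
    sob B 1 = sob A 1 ->
    sob Cs 1 = sob A 2 -> sob Cs 2 = sob B 2 -> smor Cs 1 = phi2 ->
    cmp phi2 (smor A 1) = smor B 1 ->
    exists phi psi,
      [/\ phi 1 = idm (sob A 1), phi 2 = phi2, is_smorph A B phi,
          psi_typed A B Cs psi &
          cmp (smor Cs n) (psi (2 * n - 5)) = cmp (Sm (smor A 1)) (smor B n)
          /\ N (Dseq A B Cs phi psi)].

End NAngulated.

(* Main.v *)
Require Import Defs.
From HB Require Import structures.
From mathcomp Require Import all_boot all_algebra boolp zify.
Set Implicit Arguments.
Unset Strict Implicit.
Unset Printing Implicit Defensive.
Import GRing.Theory.
Local Open Scope ring_scope.

(* The morphisms of the category act faithfully, by composition, on the group of all
   families of morphisms X -> Y, so they embed into its endomorphism ring; conjugation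
   extends the suspension to a ring automorphism. All matrix identities then become
   identities in one noncommutative ring, and zero summands simply contribute 0.

   (N4) => (N4* ): the cone of (1, phi_2, ..., phi_n) has the contractible summand A_1,
   and its complement is an n-angle K with K_1 = A_2. Completing (1, pr_B) : K -> C by
   (N4) and splitting contractible summands off its cone leaves the required sequence,
   with the psi_j read off from the components of K -> C.

   (N4* ) => (N4): let u : A_2 + B_1 -> A_3 + B_2 be the first map of the cone to be built
   and E an n-angle on u. Apply (N4* ) to u followed by minus the projection to A_3: the
   composite is the first map of the n-angle Q = (rotated A) + (rotated trivial B_1).
   Rotating the resulting n-angle twice to the right and mapping it to B by (N3) yields
   both the phi_i and a morphism from E to the cone of phi that is the identity in
   degrees 1 and 2. The cone of phi is exact, so it is a direct summand of E plus
   contractible n-angles. *)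

(** * Identities in noncommutative rings *)

(** (N3) leaves the completed components uncontrolled, so a comparison that is the identity in
    degrees 1 and 2 need not be invertible. Into an exact complex it still has an inverse up to
    homotopy on one side: null-homotopic maps factor through contractible n-angles, which closure
    under summands absorbs.

    The direction from [N4star] hinges on a split third n-angle A_3 + B_2 -> A_3 -> 0 -> ... -> 0 ->
    Sigma B_2. Its vanishing middle kills every psi_j except psi_(2n-5), and the output becomes E_3
    -> E_4 + A_4 -> ... -> E_n + A_n -> Sigma A_1 + Sigma B_1 -> Sigma B_2. Two right rotations put
    the last two objects in front, where (N3) lets their maps to B be prescribed: up to sign,
    (phi_1, 1) on A_1 + B_1 and 1 on B_2. The relation gamma_n psi_(2n-5) = Sigma alpha_1 beta_n
    makes that square commute. The other components restrict on A_k, k > 3, to phi_k up to sign, and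
    on E_k to the B_k-part of the comparison with the cone, again up to sign. *)

Inductive ncexp : Type :=
  | NcVar of nat | NcZero | NcOne
  | NcAdd of ncexp & ncexp | NcOpp of ncexp | NcMul of ncexp & ncexp.

(* A formal noncommutative polynomial: signed words, [true] being the sign -1. *)
Definition ncpoly := seq (bool * seq nat).

Definition ncmul (p q : ncpoly) : ncpoly :=
  flatten [seq [seq (x.1 (+) y.1, x.2 ++ y.2) | y <- q] | x <- p].

Definition ncopp (p : ncpoly) : ncpoly := [seq (~~ x.1, x.2) | x <- p].

Fixpoint ncnorm (e : ncexp) : ncpoly :=
  match e with
  | NcVar i => [:: (false, [:: i])]
  | NcZero => [::]
  | NcOne => [:: (false, [::])]
  | NcAdd a b => ncnorm a ++ ncnorm b
  | NcOpp a => ncopp (ncnorm a)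
  | NcMul a b => ncmul (ncnorm a) (ncnorm b)
  end.

Fixpoint ncprefix (u w : seq nat) : option (seq nat) :=
  match u, w with
  | [::], _ => Some w
  | a :: u', b :: w' => if eqn a b then ncprefix u' w' else None
  | _ :: _, [::] => None
  end.

(** A rule fires only if its left side normalises to one signed word; all others are skipped.
    Equations meant as rules are therefore written with the monomial to be eliminated on the
    left. *)
Fixpoint ncrule (rs : seq (ncexp * ncexp)) (w : seq nat) : option ncpoly :=
  match rs with
  | [::] => None
  | r :: rs' =>
    match ncnorm r.1 with
    | [:: (s, u)] =>
      match ncprefix u w with
      | Some w' => Some (ncmul [:: (s, [::])] (ncmul (ncnorm r.2) [:: (false, w')]))
      | None => ncrule rs' w
      end
    | _ => ncrule rs' w
    end
  end.

Fixpoint ncstep (rs : seq (ncexp * ncexp)) (w : seq nat) : option ncpoly :=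
  match ncrule rs w with
  | Some p => Some p
  | None =>
    match w with
    | [::] => None
    | a :: w' =>
      match ncstep rs w' with
      | Some p => Some (ncmul [:: (false, [:: a])] p)
      | None => None
      end
    end
  end.

(** The fuel [k] bounds the length of a chain of rewrites, so the rules need not form a terminating
    system. Stopping early is harmless: the word is kept, and the test can only become weaker. *)
Fixpoint ncred (k : nat) rs (t : bool * seq nat) : ncpoly :=
  if k is k'.+1 then
    match ncstep rs t.2 with
    | Some p => flatten [seq ncred k' rs x | x <- ncmul [:: (t.1, [::])] p]
    | None => [:: t]
    end
  else [:: t].

Fixpoint nceqw (u w : seq nat) : bool :=
  match u, w with
  | [::], [::] => true
  | a :: u', b :: w' => eqn a b && nceqw u' w'
  | _, _ => false
  end.

Fixpoint ncins (t : bool * seq nat) (p : ncpoly) : ncpoly :=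
  match p with
  | [::] => [:: t]
  | x :: p' => if (t.1 (+) x.1) && nceqw t.2 x.2 then p' else x :: ncins t p'
  end.

Definition ncdecide k rs (a b : ncexp) : bool :=
  nilp (foldr ncins [::]
         (flatten [seq ncred k rs x | x <- ncnorm (NcAdd a (NcOpp b))])).

Section NcEval.
Variables (R : pzRingType) (env : seq R).

Fixpoint nceval (e : ncexp) : R :=
  match e with
  | NcVar i => nth 0 env i
  | NcZero => 0
  | NcOne => 1
  | NcAdd a b => nceval a + nceval b
  | NcOpp a => - nceval a
  | NcMul a b => nceval a * nceval b
  end.

Definition ncterm (t : bool * seq nat) : R :=
  (-1) ^+ t.1 * \prod_(i <- t.2) nth 0 env i.
Definition ncsum (p : ncpoly) : R := \sum_(t <- p) ncterm t.

Lemma ncsum_mul p q : ncsum (ncmul p q) = ncsum p * ncsum q.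
Proof.
rewrite /ncsum /ncmul big_flatten big_map mulr_suml; apply: eq_bigr => x _.
rewrite big_map mulr_sumr; apply: eq_bigr => y _.
rewrite /ncterm /= big_cat /= signr_addb !mulrA; congr (_ * _).
by rewrite -!mulrA; congr (_ * _); case: y.1; rewrite ?expr1 ?expr0 ?mulr1 ?mul1r ?mulrN1 ?mulN1r.
Qed.

Lemma ncsum_norm e : ncsum (ncnorm e) = nceval e.
Proof.
elim: e => [i|||a IHa b IHb|a IHa|a IHa b IHb] /=.
- by rewrite /ncsum big_seq1 /ncterm big_seq1 mul1r.
- by rewrite /ncsum big_nil.
- by rewrite /ncsum big_seq1 /ncterm big_nil mul1r.
- by rewrite -IHa -IHb /ncsum big_cat.
- rewrite -IHa /ncsum /ncopp big_map -sumrN; apply: eq_bigr => t _.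
  by rewrite /ncterm /= signrN mulNr.
- by rewrite ncsum_mul IHa IHb.
Qed.

Lemma ncprefixP u w w' : ncprefix u w = Some w' -> w = u ++ w'.
Proof.
elim: u w => [|a u IH] [|b w] //=; [by case | by case|].
by case: eqnP => // -> /IH ->.
Qed.

Fixpoint ncvalid (rs : seq (ncexp * ncexp)) : Prop :=
  if rs is r :: rs' then nceval r.1 = nceval r.2 /\ ncvalid rs' else True.

Lemma ncsum_word s w : ncsum [:: (s, w)] = (-1) ^+ s * \prod_(i <- w) nth 0 env i.
Proof. by rewrite /ncsum big_seq1. Qed.

Lemma ncruleP rs w p : ncvalid rs -> ncrule rs w = Some p ->
  ncsum p = ncsum [:: (false, w)].
Proof.
elim: rs => //= -[l r] rs IH /= [E V]; have {}IH := IH V.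
case N1 : (ncnorm l) => [|[s u] [|??]] //.
case N2 : (ncprefix u w) => [w'|] // [<-].
rewrite !ncsum_mul ncsum_norm -E -ncsum_norm N1 !ncsum_word big_nil.
rewrite (ncprefixP N2) big_cat /= mulr1 expr0 !mul1r !mulrA; congr (_ * _).
by case: s {N1}; rewrite ?expr0 ?expr1 ?mulN1r ?mul1r ?opprK ?mul1r.
Qed.

Lemma ncstepP rs w p : ncvalid rs -> ncstep rs w = Some p ->
  ncsum p = ncsum [:: (false, w)].
Proof.
move=> V; elim: w p => [|a w IH] p /=.
  by case N1 : (ncrule rs _) => [q|] // [<-]; apply: ncruleP N1.
case N1 : (ncrule rs _) => [q|]; first by move=> [<-]; apply: ncruleP N1.
case N2 : (ncstep rs w) => [q|] // [<-].
by rewrite ncsum_mul (IH _ N2) !ncsum_word !big_cons big_nil mulr1 !mul1r.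
Qed.

Lemma ncsum_flatten (T : Type) (F : T -> ncpoly) s :
  ncsum (flatten [seq F x | x <- s]) = \sum_(x <- s) ncsum (F x).
Proof. by rewrite /ncsum big_flatten big_map. Qed.

Lemma ncredP k rs t : ncvalid rs -> ncsum (ncred k rs t) = ncterm t.
Proof.
move=> V; elim: k t => [|k IH] [s w] /=; first by rewrite /ncsum big_seq1.
case N1 : (ncstep rs w) => [p|]; last by rewrite /ncsum big_seq1.
rewrite ncsum_flatten; under eq_bigr do rewrite IH.
rewrite -/(ncsum _) ncsum_mul (ncstepP V N1) !ncsum_word big_nil mulr1.
by rewrite expr0 mul1r.
Qed.

Lemma nceqwP u w : nceqw u w -> u = w.
Proof.
by elim: u w => [|a u IH] [|b w] //= /andP[/eqnP-> /IH->].
Qed.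

Lemma ncinsP t p : ncsum (ncins t p) = ncterm t + ncsum p.
Proof.
elim: p => [|x p IH] /=; first by rewrite /ncsum big_seq1 big_nil addr0.
case: ifP => [/andP[E /nceqwP W]|_].
  rewrite {2}/ncsum big_cons addrA /ncterm W.
  have -> : t.1 = ~~ x.1 by case: t.1 x.1 E => [] [].
  by rewrite signrN mulNr addNr add0r.
by rewrite /ncsum !big_cons -/(ncsum _) IH addrCA.
Qed.

Lemma ncdecideP k rs a b : ncvalid rs -> ncdecide k rs a b -> nceval a = nceval b.
Proof.
move=> V D; apply/eqP; rewrite -subr_eq0; apply/eqP.
rewrite -[LHS]/(nceval (NcAdd a (NcOpp b))) -ncsum_norm.
have H p : ncsum (foldr ncins [::] p) = ncsum p.
  by elim: p => //= x p IH; rewrite ncinsP IH /ncsum big_cons.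
have H2 : ncsum (flatten [seq ncred k rs x | x <- ncnorm (NcAdd a (NcOpp b))]) = 0.
  by rewrite -H; move: D; rewrite /ncdecide /nilp size_eq0 => /eqP ->; rewrite /ncsum big_nil.
by rewrite -H2 ncsum_flatten; apply: eq_bigr => x _; rewrite ncredP.
Qed.

End NcEval.

Ltac nc_find x l :=
  lazymatch l with
  | x :: _ => constr:(0%N)
  | _ :: ?l' => let k := nc_find x l' in constr:(S k)
  end.

Ltac nc_mem x l :=
  lazymatch l with
  | x :: _ => true
  | _ :: ?l' => nc_mem x l'
  | _ => false
  end.

Ltac nc_atoms e l :=
  lazymatch e with
  | @GRing.add _ ?a ?b => let l1 := nc_atoms a l in nc_atoms b l1
  | @GRing.mul _ ?a ?b => let l1 := nc_atoms a l in nc_atoms b l1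
  | @GRing.opp _ ?a => nc_atoms a l
  | @GRing.zero _ => l
  | @GRing.one _ => l
  | _ => lazymatch nc_mem e l with true => l | false => constr:(e :: l) end
  end.

Ltac nc_reify e l :=
  lazymatch e with
  | @GRing.add _ ?a ?b =>
    let x := nc_reify a l in let y := nc_reify b l in constr:(NcAdd x y)
  | @GRing.mul _ ?a ?b =>
    let x := nc_reify a l in let y := nc_reify b l in constr:(NcMul x y)
  | @GRing.opp _ ?a => let x := nc_reify a l in constr:(NcOpp x)
  | @GRing.zero _ => constr:(NcZero)
  | @GRing.one _ => constr:(NcOne)
  | _ => let k := nc_find e l in constr:(NcVar k)
  end.

Ltac nc_atoms_eqs t l :=
  lazymatch t with
  | (?a = ?b) /\ ?t' => let l1 := nc_atoms a l in let l2 := nc_atoms b l1 in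
                        nc_atoms_eqs t' l2
  | _ => l
  end.

Ltac nc_rules t l :=
  lazymatch t with
  | (?a = ?b) /\ ?t' =>
    let x := nc_reify a l in let y := nc_reify b l in
    let r := nc_rules t' l in constr:((x, y) :: r)
  | _ => constr:(@nil (ncexp * ncexp))
  end.

(* [nc_with H] proves an identity of noncommutative rings by rewriting with the
   left-to-right rules in the conjunction [H]. *)
Ltac nc_with H :=
  lazymatch goal with
  | |- @eq ?T ?a ?b =>
    let th := type of H in
    let l0 := nc_atoms a (@nil T) in
    let l1 := nc_atoms b l0 in
    let l := nc_atoms_eqs th l1 in
    let rs := nc_rules th l in
    let x := nc_reify a l in
    let y := nc_reify b l in
    (* 60 is the rewriting fuel; it only has to exceed the longest chain of rewrites met by a
       word. *)
    refine (@ncdecideP _ l 60 rs x y H _); vm_compute; reflexivity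
  end.

(** A marker that lets the loop of [nc] tell the conjunction being accumulated from ordinary
    hypotheses. *)
Definition nc_box (P : Prop) : Prop := P.

(* All hypotheses that are equations of the ring serve as rewrite rules. *)
Ltac nc :=
  let H := fresh "NC" in
  have H : nc_box True by [];
  lazymatch goal with |- @eq ?T _ _ =>
    repeat match goal with
    | B : nc_box ?P, E : @eq ?U ?a ?b |- _ =>
      unify U T;
      let B' := fresh "NC" in
      pose proof (conj E B : nc_box ((a = b) /\ P)) as B'; clear B; clear E
    end
  end;
  lazymatch goal with B : nc_box ?P |- _ => change P in B; nc_with B end.

(** * Linearised additive categories *)

(* An additive category with automorphism, all of whose morphisms live in a single
   ring: composition is the product, and [hom X Y r] says that [r] represents a
   morphism from [X] to [Y]. *)
Record lincat := LinCat {
  lob : Type;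
  lring : pzRingType;
  hom : lob -> lob -> lring -> Prop;
  lid : lob -> lring;
  lso : lob -> lob;
  sg : lring -> lring;
  lz : lob;
  lbp : lob -> lob -> lob;
  lj1 : lob -> lob -> lring;
  lj2 : lob -> lob -> lring;
  lq1 : lob -> lob -> lring;
  lq2 : lob -> lob -> lring;
  hom0 : forall X Y, hom X Y 0;
  homD : forall X Y f g, hom X Y f -> hom X Y g -> hom X Y (f + g);
  homN : forall X Y f, hom X Y f -> hom X Y (- f);
  homM : forall X Y Z f g, hom X Y f -> hom Y Z g -> hom X Z (g * f);
  hom_id : forall X, hom X X (lid X);
  mul_id : forall X Y f, hom X Y f -> f * lid X = f;
  id_mul : forall X Y f, hom X Y f -> lid Y * f = f;
  lid_z : lid lz = 0;
  sgD : forall f g, sg (f + g) = sg f + sg g;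
  sgM : forall f g, sg (f * g) = sg f * sg g;
  sg_id : forall X, sg (lid X) = lid (lso X);
  hom_sg : forall X Y f, hom X Y f -> hom (lso X) (lso Y) (sg f);
  sg_full : forall X Y g, hom (lso X) (lso Y) g -> exists f, hom X Y f /\ sg f = g;
  sg_inj : injective sg;
  lso_surj : forall Y, exists X, lso X = Y;
  hom_j1 : forall X Y, hom X (lbp X Y) (lj1 X Y);
  hom_j2 : forall X Y, hom Y (lbp X Y) (lj2 X Y);
  hom_q1 : forall X Y, hom (lbp X Y) X (lq1 X Y);
  hom_q2 : forall X Y, hom (lbp X Y) Y (lq2 X Y);
  q1j1 : forall X Y, lq1 X Y * lj1 X Y = lid X;
  q2j2 : forall X Y, lq2 X Y * lj2 X Y = lid Y;
  q1j2 : forall X Y, lq1 X Y * lj2 X Y = 0;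
  q2j1 : forall X Y, lq2 X Y * lj1 X Y = 0;
  jq_id : forall X Y, lj1 X Y * lq1 X Y + lj2 X Y * lq2 X Y = lid (lbp X Y)
}.

Arguments lz {_}.
Arguments lid {_} X.
Arguments lso {_} X.
Arguments sg {_} f.

(** Biproducts are used through these equations only, so that chosen sums, suspended sums and sums
    with a deleted term are handled alike. [isbp_id] is solved for [j2 * q2] because a rewrite rule
    needs a monomial on its left. *)
Record isbp (L : lincat) (Z X Y : lob L) (j1 j2 q1 q2 : lring L) : Prop := IsBp {
  isbp_j1 : hom X Z j1;
  isbp_j2 : hom Y Z j2;
  isbp_q1 : hom Z X q1;
  isbp_q2 : hom Z Y q2;
  isbp_11 : q1 * j1 = lid X;
  isbp_22 : q2 * j2 = lid Y;
  isbp_12 : q1 * j2 = 0;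
  isbp_21 : q2 * j1 = 0;
  isbp_id : j2 * q2 = lid Z - j1 * q1
}.

Ltac bps :=
  repeat match goal with
  | H : isbp _ _ _ _ _ _ _ |- _ => destruct H
  end.

Ltac homs :=
  repeat match goal with
  | H : hom ?X ?Y ?r |- _ =>
    let H1 := fresh in let H2 := fresh in
    pose proof (mul_id H) as H1; pose proof (id_mul H) as H2; clear H
  end.

(* [nct]: as [nc], using also that [hom X Y r] makes [r] absorb the identities. *)
Ltac nct := bps; homs; nc.

Create HintDb hom.
Global Hint Resolve hom0 homD homN hom_id homM hom_sg hom_j1 hom_j2 hom_q1 hom_q2 : hom.
Ltac ht := bps; solve [eauto 30 with hom nocore].

Section Linear.
Variables (L : lincat) (n : nat).
Implicit Types (X Y U V : nat -> lob L) (f g h a b : nat -> lring L) (T : lob L) (r s : lring L).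

Lemma sg0 : sg 0 = 0 :> lring L.
Proof.
by apply: (@addrI _ (sg (0 : lring L))); rewrite -sgD !addr0.
Qed.

Lemma sgN r : sg (- r) = - sg r.
Proof. by apply/eqP; rewrite -addr_eq0 -sgD addNr sg0. Qed.

Lemma lid_lso_z : lid (lso lz) = 0 :> lring L.
Proof. by rewrite -sg_id lid_z sg0. Qed.

Lemma hom_from_0 T T' r : lid T = 0 -> hom T T' r -> r = 0.
Proof. by move=> T0 H; rewrite -(mul_id H) T0 mulr0. Qed.

Lemma hom_to_0 T T' r : lid T' = 0 -> hom T T' r -> r = 0.
Proof. by move=> T0 H; rewrite -(id_mul H) T0 mul0r. Qed.

Definition sgn (k : nat) r := if odd k then - r else r.

Lemma hom_sgn k T T' r : hom T T' r -> hom T T' (sgn k r).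
Proof. by rewrite /sgn; case: odd => // ?; ht. Qed.

Lemma sgnK k r : sgn k (sgn k r) = r.
Proof. by rewrite /sgn; case: odd; rewrite ?opprK. Qed.

Lemma sgn_mull k r s : sgn k r * s = sgn k (r * s).
Proof. by rewrite /sgn; case: odd; rewrite ?mulNr. Qed.

Lemma sgn_mulr k r s : r * sgn k s = sgn k (r * s).
Proof. by rewrite /sgn; case: odd; rewrite ?mulrN. Qed.

Lemma lbpP T T' : isbp (lbp T T') T T' (lj1 T T') (lj2 T T') (lq1 T T') (lq2 T T').
Proof.
split; rewrite ?q1j1 ?q2j2 ?q1j2 ?q2j1 //; try ht.
by rewrite -jq_id addrAC subrr add0r.
Qed.

Lemma isbp_sg (Z T T' : lob L) j1 j2 q1 q2 :
  isbp Z T T' j1 j2 q1 q2 ->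
  isbp (lso Z) (lso T) (lso T') (sg j1) (sg j2) (sg q1) (sg q2).
Proof.
case=> ? ? ? ? h11 h22 h12 h21 hid; split; try ht; rewrite -!sgM ?h11 ?h22 ?h12 ?h21 ?hid;
  by rewrite ?sg_id ?sg0 ?sgD ?sgN ?sg_id.
Qed.

(* Only the values of [X] at [1, ..., n+1] and of [f] at [1, ..., n] matter; the
   last object [X n.+1] is the suspension of the first one. *)
Definition lseq X f : Prop :=
  (forall i, (0 < i <= n)%N -> hom (X i) (X i.+1) (f i)) /\ X n.+1 = lso (X 1%N).

Definition lmor X f Y g a : Prop :=
  [/\ forall i, (0 < i <= n.+1)%N -> hom (X i) (Y i) (a i),
      forall i, (0 < i <= n)%N -> a i.+1 * f i = g i * a i
    & a n.+1 = sg (a 1%N)].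

(** At [n.+1] this is the suspension of the first sum and not the sum of the suspensions, so that
    the last object is literally [lso] of the first. The charts below are suspended accordingly. *)
Definition bpX U V i : lob L :=
  if (i <= n)%N then lbp (U i) (V i) else lso (lbp (U 1%N) (V 1%N)).
Definition J1 U V i : lring L :=
  if (i <= n)%N then lj1 (U i) (V i) else sg (lj1 (U 1%N) (V 1%N)).
Definition J2 U V i : lring L :=
  if (i <= n)%N then lj2 (U i) (V i) else sg (lj2 (U 1%N) (V 1%N)).
Definition Q1 U V i : lring L :=
  if (i <= n)%N then lq1 (U i) (V i) else sg (lq1 (U 1%N) (V 1%N)).
Definition Q2 U V i : lring L :=
  if (i <= n)%N then lq2 (U i) (V i) else sg (lq2 (U 1%N) (V 1%N)).

Lemma bpXP U V : U n.+1 = lso (U 1%N) -> V n.+1 = lso (V 1%N) ->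
  forall i, (0 < i <= n.+1)%N ->
  isbp (bpX U V i) (U i) (V i) (J1 U V i) (J2 U V i) (Q1 U V i) (Q2 U V i).
Proof.
move=> EU EV i i_n; rewrite /bpX /J1 /J2 /Q1 /Q2.
case: ltnP => [i_gt|_]; last exact: lbpP.
have -> : i = n.+1 by lia.
by rewrite EU EV; apply: isbp_sg; apply: lbpP.
Qed.

Lemma bpX_last U V : (0 < n)%N -> bpX U V n.+1 = lso (bpX U V 1%N).
Proof. by move=> n0; rewrite /bpX ltnn n0. Qed.
Lemma J1_last U V : (0 < n)%N -> J1 U V n.+1 = sg (J1 U V 1%N).
Proof. by move=> n0; rewrite /J1 ltnn n0. Qed.
Lemma J2_last U V : (0 < n)%N -> J2 U V n.+1 = sg (J2 U V 1%N).
Proof. by move=> n0; rewrite /J2 ltnn n0. Qed.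
Lemma Q1_last U V : (0 < n)%N -> Q1 U V n.+1 = sg (Q1 U V 1%N).
Proof. by move=> n0; rewrite /Q1 ltnn n0. Qed.
Lemma Q2_last U V : (0 < n)%N -> Q2 U V n.+1 = sg (Q2 U V 1%N).
Proof. by move=> n0; rewrite /Q2 ltnn n0. Qed.

Definition lsum X f Y g i : lring L :=
  J1 X Y i.+1 * f i * Q1 X Y i + J2 X Y i.+1 * g i * Q2 X Y i.

Definition ltrivX T i : lob L := if (i <= 2)%N then T else if (i <= n)%N then lz else lso T.
Definition ltrivf T i : lring L := if i == 1%N then lid T else 0.

Definition rotX X i : lob L := if (i <= n)%N then X i.+1 else lso (X 2%N).
Definition rotf f i : lring L := if (i < n)%N then f i.+1 else sgn n (sg (f 1%N)).

(** One more term after the last, without the sign of the left rotation: the cone puts its own minus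
    sign on all maps of its source, and exactness does not see signs. *)
Definition extX X i : lob L := if (i <= n.+1)%N then X i else lso (X 2%N).
Definition extf f i : lring L := if (i <= n)%N then f i else sg (f 1%N).

(** [N_retract] gathers closure under summands and under isomorphisms, since an isomorphism is a
    retraction. *)
Record lang (N : (nat -> lob L) -> (nat -> lring L) -> Prop) : Prop := Lang {
  N_seq : forall X f, N X f -> lseq X f;
  N_retract : forall X f Y g a b, lseq X f -> N Y g ->
    lmor X f Y g a -> lmor Y g X f b ->
    (forall i, (0 < i <= n)%N -> b i * a i = lid (X i)) -> N X f;
  N_sum : forall X f Y g, N X f -> N Y g -> N (bpX X Y) (lsum X f Y g);
  N_triv : forall T, N (ltrivX T) (ltrivf T);
  N_first : forall T T' r, hom T T' r ->
    exists X f, [/\ N X f, X 1%N = T, X 2%N = T' & f 1%N = r];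
  N_rot : forall X f, lseq X f -> N X f <-> N (rotX X) (rotf f);
  N_3 : forall X f Y g r s, N X f -> N Y g ->
    hom (X 1%N) (Y 1%N) r -> hom (X 2%N) (Y 2%N) s -> s * f 1%N = g 1%N * r ->
    exists a, [/\ a 1%N = r, a 2%N = s & lmor X f Y g a]
}.

End Linear.
Global Hint Resolve hom_sgn : hom.

(** * Long exact sequences *)

Section Exactness.
Variables (L : lincat) (n : nat) (n3 : (3 <= n)%N).
Variables (N : (nat -> lob L) -> (nat -> lring L) -> Prop) (HN : lang n N).
Implicit Types (X Y U V : nat -> lob L) (f g h a b : nat -> lring L) (T : lob L) (r s : lring L).

(** The identities form a retraction between sequences that agree at the meaningful indices, so
    membership cannot depend on the values elsewhere. *)
Lemma N_ext X f Y g : lseq n Y g -> N X f ->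
  (forall i, (0 < i <= n.+1)%N -> X i = Y i) ->
  (forall i, (0 < i <= n)%N -> f i = g i) -> N Y g.
Proof.
move=> [Yh Yn] NX EX Ef; have [Xh Xn] := N_seq HN NX.
apply: (N_retract HN (X := Y) (f := g) (Y := X) (g := f)
  (a := fun i => lid (X i)) (b := fun i => lid (X i))) => //.
- split=> [i i_n|i i_n|]; first by rewrite -EX //; ht.
  + by rewrite -Ef //; have := Xh i i_n => H; nct.
  + by rewrite Xn sg_id.
- split=> [i i_n|i i_n|]; first by rewrite -EX //; ht.
  + by rewrite -Ef //; have := Xh i i_n => H; nct.
  + by rewrite Xn sg_id.
- move=> i i_n; rewrite -EX; last by lia.
  by rewrite (mul_id (hom_id _)).
Qed.

Lemma lseq_rot X f : lseq n X f -> lseq n (rotX n X) (rotf n f).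
Proof.
move=> [Xh Xn]; split=> [i i_n|]; last by rewrite /rotX ltnn ifT; last lia.
rewrite /rotX /rotf; have [i_lt|i_ge] := ltnP i n.
  by rewrite ifT; [apply: Xh; lia|lia].
have -> : i = n by lia.
by rewrite leqnn Xn; apply: hom_sgn; apply: hom_sg; apply: Xh; lia.
Qed.

Lemma N_rot1 X f : N X f -> N (rotX n X) (rotf n f).
Proof. by move=> NX; apply: (proj1 (N_rot HN (N_seq HN NX))). Qed.

(** For [i = 1], (N3) maps the trivial n-angle on [X 1] to [X] with components 1 and [f 1]; the
    second square then makes [f 2 * f 1] factor through the zero third term. Rotation carries the
    statement to the other positions. *)
Lemma N_comp0 X f i : N X f -> (0 < i <= n)%N -> extf n f i.+1 * f i = 0.
Proof.
elim: i X f => [//|[|i] IH] X f NX i_n.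
  have [Xh Xn] := N_seq HN NX.
  have i1 : (0 < 1 <= n)%N by lia.
  have [|a [a1 a2 [ah ac _]]] := N_3 HN (N_triv HN (X 1%N)) NX
    (hom_id _) (Xh 1%N i1).
    by rewrite /ltrivf eqxx.
  rewrite /extf ifT; last by lia.
  have := ac 2%N; rewrite /ltrivf /= mulr0 a2 => <- //; lia.
have NR := N_rot1 NX; have := IH _ _ NR; rewrite /extf /rotf.
have -> /= : (i.+1 < n)%N by lia.
have i_lt : (i < n)%N by lia.
move=> /(_ i_lt); case: ltnP => // _.
by rewrite sgn_mull => E; rewrite -[LHS](sgnK n) E /sgn; case: odd; rewrite ?oppr0.
Qed.

(** Its left rotation is the trivial n-angle on [T], except that [lz] and [lso lz] may be different
    objects. Both have identity 0 in the ring, so components that are identities or 0 still give a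
    retraction. *)
Lemma N_cotriv T : N (fun i => if (i == 2%N) || (i == 3%N) then T
                     else if (i <= n)%N then lz else lso lz)
                     (fun i => if i == 2%N then lid T else 0).
Proof.
have z0 := lid_z L; have zz := lid_lso_z L.
set Y := fun i => _; set g := fun i => _.
have Yseq : lseq n Y g.
  split=> [i i_n|].
    by rewrite /Y /g; case: eqP => [->|_] /=; ht.
  rewrite /Y ltnn; have -> : ((n.+1 == 2%N) || (n.+1 == 3%N)) = false by lia.
  by have -> : (1 <= n)%N by lia.
apply/(N_rot HN) => //.
apply: (N_retract HN (a := fun i => if (i <= 2)%N then lid T else if (i <= n)%N then 0 else lid (lso T))
  (b := fun i => if (i <= 2)%N then lid T else if (i <= n)%N then 0 else lid (lso T))
  (lseq_rot Yseq) (N_triv HN T)).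
- split=> [i i_n|i i_n|].
  + rewrite /rotX /Y /ltrivX /=.
    case: (leqP i 2) => i2; first by have -> : (i.+1 == 2%N) || (i.+1 == 3%N) by [lia]; case: ifP => ?; [ht|lia].
    case: (leqP i n) => iN; last by ht.
    by ht.
  + rewrite /rotf /g /ltrivf.
    have [->|i1] := eqVneq i 1%N.
      by have -> : (1 < n)%N by lia.
    have -> : (i.+1 == 2%N) = false by lia.
    by rewrite mul0r; case: ifP => _; rewrite ?if_same ?sg0 /sgn ?oppr0 ?if_same mulr0.
  + by rewrite /= ltnn sg_id ifF //; lia.
- split=> [i i_n|i i_n|].
  + rewrite /rotX /Y /ltrivX /=.
    case: (leqP i 2) => i2; first by have -> : (i.+1 == 2%N) || (i.+1 == 3%N) by [lia]; case: ifP => ?; [ht|lia].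
    case: (leqP i n) => iN; last by ht.
    by ht.
  + rewrite /rotf /g /ltrivf.
    have [->|i1] := eqVneq i 1%N.
      by have -> : (1 < n)%N by lia.
    have -> : (i.+1 == 2%N) = false by lia.
    by rewrite mulr0; case: ifP => _; rewrite ?if_same ?sg0 /sgn ?oppr0 ?if_same mul0r.
  + by rewrite /= ltnn sg_id ifF //; lia.
- move=> i i_n; rewrite /rotX /Y.
  have -> : (i <= n)%N by lia.
  case: (leqP i 2) => i2; last by rewrite mul0r; case: ifP => [|_]; [lia|case: ifP].
  by rewrite ifT ?(mul_id (hom_id _)) //; lia.
Qed.

(** Each map is a weak cokernel of the one before it. For [i = 1], (N3) extends the pair (0, [r]) to
    a morphism into 0 -> T = T -> 0, whose third component is the factorisation. Rotation gives the
    rest, its sign being absorbed into [s]. *)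
Lemma N_contra X f i T r : N X f -> (0 < i <= n)%N ->
  hom (X i.+1) T r -> r * f i = 0 ->
  exists s, hom (extX n X i.+2) T s /\ r = s * extf n f i.+1.
Proof.
elim: i X f => [//|[|i] IH] X f NX i_n rh r0.
  have [|a [a1 a2 [ah ac _]]] := N_3 HN NX (N_cotriv T) (hom0 _ _) rh.
    by rewrite r0 /= mul0r.
  have i3 : (0 < 3 <= n.+1)%N by lia.
  exists (a 3%N); split; first by have /= := ah 3%N i3; rewrite /extX ifT.
  rewrite /extf ifT; last by lia.
  have := ac 2%N; rewrite /= a2 (id_mul rh) => -> //; lia.
have NR := N_rot1 NX.
have [||| s []] := IH _ _ NR.
- lia.
- by rewrite /rotX ifT //; lia.
- by rewrite /rotf ifT //; lia.
rewrite /extX /extf /rotX /rotf; have -> : (i.+3 <= n.+1)%N by lia.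
have -> : (i.+1 < n)%N by lia.
rewrite /= !ltnS => sh; case: ltnP => i_n' Er.
  by exists s; split=> //; move: sh; rewrite ifT.
exists (sgn n s); split; last by rewrite Er sgn_mulr sgn_mull.
by apply: hom_sgn; move: sh; case: ltnP => //; lia.
Qed.

(* [T] is the suspension of some [T'], and the rotated trivial angle
   [T' -> 0 -> ... -> 0 -> T] maps to [X]. *)
Lemma N_co X f T r : N X f -> hom T (lso (X 1%N)) r -> sg (f 1%N) * r = 0 ->
  exists s, hom T (X n) s /\ f n * s = r.
Proof.
have [T' <-] := lso_surj T => NX rh r0.
have [r' [r'h Er']] := sg_full rh.
have fr : f 1%N * r' = 0 by apply: sg_inj; rewrite sgM Er' r0 sg0.
have [|||a [a1 a2 [ah ac al]]] := N_3 HN (X := rotX n (ltrivX n T'))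
    (f := rotf n (ltrivf T')) (N_rot1 (N_triv HN T')) NX (r := r') (s := 0).
- by rewrite /rotX /= ifT //; lia.
- by ht.
- by rewrite fr mul0r.
exists (sgn n (a n)); split.
  apply: hom_sgn; have := ah n.
  by rewrite /rotX leqnn /ltrivX ltnn ifF; [apply; lia|lia].
rewrite sgn_mulr -ac; last by lia.
by rewrite /rotf ltnn /ltrivf eqxx sg_id sgn_mulr sgnK al a1 Er' (mul_id rh).
Qed.

End Exactness.

(** * Recognising angles by comparison *)

Section WeakIso.
Variables (L : lincat) (n : nat) (n3 : (3 <= n)%N).
Variables (N : (nat -> lob L) -> (nat -> lring L) -> Prop) (HN : lang n N).
Implicit Types (X Y U V : nat -> lob L) (f g h a b : nat -> lring L) (T : lob L) (r s : lring L).

Definition contrX T (j i : nat) : lob L :=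
  if (i == j) || (i == j.+1) then T else if (i <= n)%N then lz else lso lz.
Definition contrf T (j i : nat) : lring L := if i == j then lid T else 0.

Lemma contr_lseq T j : (1 < j < n)%N -> lseq n (contrX T j) (contrf T j).
Proof.
move=> j_n; split=> [i i_n|].
  by rewrite /contrX /contrf; case: eqP => [->|_]; rewrite ?eqxx ?orbT; ht.
rewrite /contrX ltnn; have -> : ((n.+1 == j) || (n.+1 == j.+1)) = false by lia.
have -> : ((1%N == j) || (1%N == j.+1)) = false by lia.
by have -> : (1 <= n)%N by lia.
Qed.

(** A left rotation moves the pair T = T one place to the left, so the induction starts from
    [N_cotriv]; at each step only the choice of zero objects has to be reconciled. *)
Lemma N_contr T j : (1 < j < n)%N -> N (contrX T j) (contrf T j).
Proof.
have z0 := lid_z L; have zz := lid_lso_z L.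
elim: j => [|[|[|j] IH]] // j_n; first exact: (N_cotriv n3 HN T).
have Yseq := contr_lseq T j_n.
apply/(N_rot HN) => //.
have NI := IH _.
have idh i : (0 < i <= n.+1)%N ->
    rotX n (contrX T j.+3) i = contrX T j.+2 i \/
    lid (rotX n (contrX T j.+3) i) = 0 /\ lid (contrX T j.+2 i) = 0.
  move=> i_n; rewrite /rotX /contrX !eqSS.
  case: (leqP i n) => i_n'; first by case: ifP => _; [left|right; case: ifP => _].
  have -> : ((i == j.+2) || (i == j.+3)) = false by lia.
  have -> /= : (2 <= n)%N by lia.
  by right; rewrite zz.
pose a i := lid (contrX T j.+2 i).
have ea i : (0 < i <= n.+1)%N -> a i = lid (rotX n (contrX T j.+3) i).
  by move=> /idh [E|[E1 E2]]; rewrite /a ?E ?E1 ?E2.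
have ef i : (0 < i <= n)%N -> rotf n (contrf T j.+3) i = contrf T j.+2 i.
  move=> i_n; rewrite /rotf /contrf eqSS; case: ltnP => // i_n'.
  have -> : (i == j.+2) = false by lia.
  by rewrite /= sg0 /sgn oppr0 if_same.
have j2 : (1 < j.+2 < n)%N by lia.
have ah i : (0 < i <= n.+1)%N -> hom (contrX T j.+2 i) (rotX n (contrX T j.+3) i) (a i).
  by move=> /idh [E|[E1 E2]]; rewrite /a ?E ?E2; ht.
have ah' i : (0 < i <= n.+1)%N -> hom (rotX n (contrX T j.+3) i) (contrX T j.+2 i) (a i).
  by move=> /idh [E|[E1 E2]]; rewrite /a ?E ?E2; ht.
have fh := (contr_lseq T j2).1.
have al : a n.+1 = sg (a 1%N).
  by rewrite /a (contr_lseq T j2).2 sg_id.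
have comm i : (0 < i <= n)%N -> a i.+1 * contrf T j.+2 i = contrf T j.+2 i * a i.
  by move=> i_n; have H := fh i i_n; rewrite /a; nct.
apply: (N_retract HN (a := a) (b := a) (lseq_rot n3 Yseq) (IH j2)).
- by split=> // i i_n; rewrite ef // comm.
- by split=> // i i_n; rewrite ef // comm.
- by move=> i i_n; rewrite ea ?(mul_id (hom_id _)) //; lia.
Qed.

(** Families that factor through an n-angle are closed under sums, because n-angles are, and [Y] is
    an n-angle once its identity is among them. This replaces an explicit direct sum decomposition
    by the addition of maps. *)
Definition thru Y f a : Prop :=
  exists Z h u v, [/\ N Z h, lmor n Y f Z h u, lmor n Z h Y f v
                    & forall i, (0 < i <= n)%N -> v i * u i = a i].

Lemma thru_ext Y f a b : (forall i, (0 < i <= n)%N -> a i = b i) ->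
  thru Y f a -> thru Y f b.
Proof.
move=> E [Z [h [u [v [NZ uh vh uv]]]]]; exists Z, h, u, v; split=> // i i_n.
by rewrite uv ?E.
Qed.

Lemma thru_id Y f : lseq n Y f -> thru Y f (fun i => lid (Y i)) -> N Y f.
Proof.
by move=> Ys [Z [h [u [v [NZ uh vh uv]]]]]; apply: (N_retract HN Ys NZ uh vh).
Qed.

Lemma thru_add Y f a b : thru Y f a -> thru Y f b -> thru Y f (fun i => a i + b i).
Proof.
move=> [Z [h [u [v [NZ [u1 u2 u3] [v1 v2 v3] uv]]]]].
move=> [Z' [h' [u' [v' [NZ' [u1' u2' u3'] [v1' v2' v3'] uv']]]]].
have [Zh Zn] := N_seq HN NZ; have [Zh' Zn'] := N_seq HN NZ'.
have ch := bpXP Zn Zn'; have n0 : (0 < n)%N by lia.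
exists (bpX n Z Z'), (lsum n Z h Z' h').
exists (fun i => J1 n Z Z' i * u i + J2 n Z Z' i * u' i).
exists (fun i => v i * Q1 n Z Z' i + v' i * Q2 n Z Z' i).
split; first exact: (N_sum HN).
- split=> [i i_n|i i_n|].
  + by have := ch i i_n; have := u1 i i_n; have := u1' i i_n => *; ht.
  + have i_n' : (0 < i <= n.+1)%N by lia.
    have i_n1 : (0 < i.+1 <= n.+1)%N by lia.
    have c1 := ch i i_n'; have c2 := ch i.+1 i_n1.
    have e1 := u2 i i_n; have e2 := u2' i i_n; have t1 := u1 i i_n'.
    have t2 := u1' i i_n'; have t3 := Zh i i_n; have t4 := Zh' i i_n.
    rewrite /lsum; clear -c1 c2 e1 e2 t1 t2 t3 t4; nct.
  + by rewrite sgD !sgM u3 u3' J1_last // J2_last.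
- split=> [i i_n|i i_n|].
  + by have := ch i i_n; have := v1 i i_n; have := v1' i i_n => *; ht.
  + have i_n' : (0 < i <= n.+1)%N by lia.
    have i_n1 : (0 < i.+1 <= n.+1)%N by lia.
    have c1 := ch i i_n'; have c2 := ch i.+1 i_n1.
    have e1 := v2 i i_n; have e2 := v2' i i_n; have t1 := v1 i.+1 i_n1.
    have t2 := v1' i.+1 i_n1; have t3 := Zh i i_n; have t4 := Zh' i i_n.
    rewrite /lsum; clear -c1 c2 e1 e2 t1 t2 t3 t4; nct.
  + by rewrite sgD !sgM v3 v3' Q1_last // Q2_last.
- move=> i i_n; have i_n' : (0 < i <= n.+1)%N by lia.
  have c1 := ch i i_n'; have t1 := u1 i i_n'; have t2 := u1' i i_n'.
  rewrite -uv // -uv' //; clear -c1 t1 t2; nct.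
Qed.

(** The null-homotopic map with the single homotopy component [r]. For [j < n] it factors through an
    identity placed at [j] and [j.+1]. For [j = n] the rotated trivial n-angle on [Y 1] takes over,
    with its objects at positions 1 and n; the second factor is 0 at position 1, hence at [n.+1],
    and the last square then requires [f n * r = 0]. *)
Lemma thru_contr Y f j r : lseq n Y f -> (1 < j <= n)%N -> hom (Y j.+1) (Y j) r ->
  (forall i, (0 < i < n)%N -> f i.+1 * f i = 0) -> sg (f 1%N) * f n = 0 ->
  (j = n -> f n * r = 0) ->
  thru Y f (fun i => if i == j then r * f i else if i == j.+1 then f j * r else 0).
Proof.
move=> [Yh Yn] j_n rh cplx cplxn rn.
have jh : hom (Y j) (Y j.+1) (f j) by apply: Yh; lia.
have [j_lt|j_ge] := ltnP j n.
  have j_n' : (1 < j < n)%N by lia.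
  exists (contrX (Y j.+1) j), (contrf (Y j.+1) j).
  exists (fun i => if i == j then f j else if i == j.+1 then lid (Y j.+1) else 0).
  exists (fun i => if i == j then r else if i == j.+1 then f j * r else 0).
  split; first exact: N_contr.
  - split=> [i i_n|i i_n|].
    + rewrite /contrX; case: eqP => [->|_]; first by ht.
      by case: eqP => [->|_]; ht.
    + rewrite /contrf eqSS; have [->|ij] := eqVneq i j.
        by have -> : (j.+1 == j) = false by lia.
      have [E|ij'] := eqVneq i.+1 j.
        by rewrite mul0r -E cplx //; lia.
      by rewrite !mul0r.
    + have -> : (n.+1 == j) = false by lia.
      have -> : (n.+1 == j.+1) = false by lia.
      have -> : (1%N == j) = false by lia.
      by have -> : (1%N == j.+1) = false by [lia]; rewrite sg0.
  - split=> [i i_n|i i_n|].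
    + rewrite /contrX; case: eqP => [->|_]; first by ht.
      by case: eqP => [->|_]; ht.
    + rewrite /contrf eqSS; have [->|ij] := eqVneq i j.
        have -> : (j.+1 == j) = false by lia.
        by rewrite -mulrA (mul_id rh).
      rewrite mulr0; case: eqP => [->|_]; last by rewrite mulr0.
      by rewrite mulrA cplx ?mul0r //; lia.
    + have -> : (n.+1 == j) = false by lia.
      have -> : (n.+1 == j.+1) = false by lia.
      have -> : (1%N == j) = false by lia.
      by have -> : (1%N == j.+1) = false by [lia]; rewrite sg0.
  - move=> i i_n; case: eqP => [->//|_]; case: eqP => [_|_]; last by rewrite mul0r.
    by rewrite -mulrA (mul_id rh).
have jE : j = n by lia.
subst j; have {}rn := rn erefl.
have tn : ltrivX n (Y 1%N) n.+1 = lso (Y 1%N).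
  by rewrite /ltrivX ltnn ifF //; lia.
exists (rotX n (ltrivX n (Y 1%N))), (rotf n (ltrivf (Y 1%N))).
exists (fun i => if i == 1%N then lid (Y 1%N) else if i == n then sgn n (f n)
                 else if i == n.+1 then lid (Y n.+1) else 0).
exists (fun i => if i == n then sgn n r else 0).
have n1 : (n == 1%N) = false by lia.
have nn : (n.+1 == n) = false by lia.
have n2 : (n.+1 == 1%N) = false by lia.
have rotE i : (0 < i < n)%N -> rotf n (ltrivf (Y 1%N)) i = 0.
  by case: i => [|i] // /andP[_ i_n]; rewrite /rotf i_n.
have rotEn : rotf n (ltrivf (Y 1%N)) n = sgn n (lid (lso (Y 1%N))).
  by rewrite /rotf ltnn /ltrivf eqxx sg_id.
split; first exact: (N_rot1 HN (N_triv HN _)).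
- split=> [i i_n|i i_n|].
  + rewrite /rotX; case: eqP => [->|_]; first by rewrite ifT; [ht|lia].
    case: eqP => [->|_]; first by rewrite leqnn tn -Yn; ht.
    case: eqP => [->|_]; last by ht.
    by rewrite ltnn Yn /ltrivX /=; ht.
  + have [i_lt|i_ge] := ltnP i n.
      rewrite rotE ?mul0r; last by lia.
      have -> : (i.+1 == 1%N) = false by lia.
      case: eqP => [E|_].
        by rewrite sgn_mull -E cplx ?/sgn ?oppr0 ?if_same //; lia.
      by have -> : (i.+1 == n.+1) = false by [lia]; rewrite mul0r.
    have -> : i = n by lia.
    rewrite rotEn n1 n2 nn !eqxx sgn_mull sgn_mulr sgnK -Yn.
    by rewrite (id_mul jh).
  + by rewrite n2 nn !eqxx sg_id Yn.
- split=> [i i_n|i i_n|].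
  + rewrite /rotX; case: eqP => [->|_]; last by ht.
    by rewrite leqnn tn -Yn; ht.
  + have [i_lt|i_ge] := ltnP i n.
      rewrite rotE ?mulr0; last by lia.
      have -> : (i == n) = false by lia.
      by rewrite mulr0.
    have -> : i = n by lia.
    by rewrite nn eqxx mul0r sgn_mulr rn /sgn oppr0 if_same.
  + by rewrite nn eq_sym n1 sg0.
- move=> i i_n; case: eqP => [->|_].
    by rewrite n1 sgn_mull sgn_mulr sgnK.
  by rewrite mul0r; case: eqP => //; lia.
Qed.

(** * Comparing an exact sequence with an n-angle *)

Section Exact.
Variables (X Y : nat -> lob L) (e f w : nat -> lring L).
Hypotheses (NX : N X e) (Ys : lseq n Y f).
Hypothesis cplx : forall i, (0 < i < n)%N -> f i.+1 * f i = 0.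
Hypothesis cplxn : sg (f 1%N) * f n = 0.
Hypothesis exY : forall i T r, (0 < i < n)%N -> hom (Y i.+1) T r -> r * f i = 0 ->
  exists s, hom (Y i.+2) T s /\ r = s * f i.+1.
Hypotheses (wm : lmor n X e Y f w) (X1 : X 1%N = Y 1%N) (X2 : X 2%N = Y 2%N).
Hypotheses (w1 : w 1%N = lid (Y 1%N)) (w2 : w 2%N = lid (Y 2%N)).

Definition upd a j r i : lring L := if i == j then r else a i.

(** Built from left to right by the weak cokernels of [Y]: the map [e * a] kills the preceding map
    of [Y] because [X] is a complex. Nothing is claimed about the last square, which involves the
    suspension. *)
Lemma exact_lift m : (1 < m <= n)%N -> exists a,
  [/\ a 1%N = lid (Y 1%N), a 2%N = lid (Y 2%N),
      forall i, (0 < i <= m)%N -> hom (Y i) (X i) (a i)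
    & forall i, (0 < i < m)%N -> a i.+1 * f i = e i * a i].
Proof.
have [Xh Xn] := N_seq HN NX; have [Yh Yn] := Ys; have [wh wc wn] := wm.
have n0 : (0 < 1 <= n)%N by lia.
elim: m => [|[|[|m] IH]] // m_n.
  exists (fun i => lid (Y i)); split=> // i i_m.
    have [->|->] : i = 1%N \/ i = 2%N by [lia]; rewrite ?X1 ?X2; ht.
  have -> : i = 1%N by lia.
  have := wc 1%N n0; rewrite w1 w2 => E; rewrite -X1 (mul_id (Xh _ n0)).
  have := Xh _ n0; rewrite X2 => xh1; have yh1 := Yh _ n0.
  by rewrite (mul_id yh1) in E; rewrite (id_mul xh1) in E; rewrite (id_mul yh1).
have [|a [a1 a2 ah ac]] := IH; first by lia.
have m_n1 : (0 < m.+2 <= m.+2)%N by lia.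
have m_n2 : (0 < m.+1 < n)%N by lia.
have m_n3 : (0 < m.+2 <= n)%N by lia.
have [||s [sh sE]] := @exY _ (X m.+3) (e m.+2 * a m.+2) m_n2.
- by apply: homM (ah _ m_n1) (Xh _ m_n3).
- rewrite -mulrA ac; last by lia.
  have := N_comp0 n3 HN NX (i := m.+1); rewrite /extf ifT; last by lia.
  by rewrite mulrA => -> //; [rewrite mul0r|lia].
exists (upd a m.+3 s); rewrite /upd; split=> // i i_m.
  case: eqP => [->//|i_ne]; apply: ah; lia.
rewrite eqSS; case: eqP => [->|i_ne].
  by have -> : (m.+2 == m.+3) = false by [lia]; rewrite sE.
by have -> : (i == m.+3) = false by [lia]; apply: ac; lia.
Qed.

(** [1 - w * a] is 0 in degrees 1 and 2, so the homotopy may start with 0. Later, the defect left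
    after subtracting [f * k] kills the preceding map of [Y] and factors through the next one; that
    factor is the new component. *)
Lemma exact_homotopy a m : (1 < m <= n)%N ->
  a 1%N = lid (Y 1%N) -> a 2%N = lid (Y 2%N) ->
  (forall i, (0 < i <= n)%N -> hom (Y i) (X i) (a i)) ->
  (forall i, (0 < i < n)%N -> a i.+1 * f i = e i * a i) ->
  exists k, [/\ k 1%N = 0, k 2%N = 0,
      forall i, (0 < i <= m)%N -> hom (Y i.+1) (Y i) (k i)
    & forall i, (1 < i <= m)%N ->
        lid (Y i) - w i * a i = f i.-1 * k i.-1 + k i * f i].
Proof.
have [Xh Xn] := N_seq HN NX; have [Yh Yn] := Ys; have [wh wc wn] := wm.
move=> m_n a1 a2 ah ac; elim: m m_n => [|[|[|m] IH]] // m_n.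
  exists (fun=> 0); split=> // i i_m; first by ht.
  have -> : i = 2%N by lia.
  by rewrite w2 a2 (mul_id (hom_id _)) subrr mulr0 mul0r addr0.
have [|k [k1 k2 kh kc]] := IH; first by lia.
have m_n2 : (0 < m.+2 < n)%N by lia.
have m_n3 : (0 < m.+2 <= n)%N by lia.
have m_n4 : (0 < m.+3 <= n)%N by lia.
have m_n5 : (0 < m.+3 <= n.+1)%N by lia.
have fh := Yh _ m_n3; have kh' := kh m.+2 (leqnn _).
have ah' := ah _ m_n4; have wh' := wh _ m_n5.
have [||s [sh sE]] := @exY _ (Y m.+3)
  (lid (Y m.+3) - w m.+3 * a m.+3 - f m.+2 * k m.+2) m_n2.
- by ht.
- have c1 := cplx (i := m.+1) ltac:(lia).
  have E1 : w m.+2 * a m.+2 = lid (Y m.+2) - f m.+1 * k m.+1 - k m.+2 * f m.+2.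
    by apply/eqP; rewrite -addrA -opprD -(kc m.+2) ?subKr //; lia.
  have E2 := ac _ m_n2; have E3 := wc _ m_n3.
  clear -E1 E2 E3 c1 fh kh' ah' wh'; nct.
exists (upd k m.+3 s); rewrite /upd; split=> // i i_m.
  case: eqP => [->//|i_ne]; apply: kh; lia.
have [->|i_ne] := eqVneq i m.+3.
  by rewrite /= (ltn_eqF (ltnSn m.+2)) -sE [RHS]addrC subrK.
by have -> : (i.-1 == m.+3) = false by [lia]; apply: kc; lia.
Qed.

(* A comparison with an angle makes [Y] a summand of that angle plus contractible
   ones; the null homotopy [k] has to be corrected at the last position, where the
   lift [a] built from exactness need not be compatible with the suspension. *)
Lemma N_weak_iso : N Y f.
Proof.
have [Xh Xn] := N_seq HN NX; have [Yh Yn] := Ys; have [wh wc wn] := wm.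
have nn : (1 < n <= n)%N by lia.
have n0 : (0 < n <= n)%N by lia.
have n1 : (0 < n <= n.+1)%N by lia.
have [a [a1 a2 ah ac]] := exact_lift nn.
have [k [k1 k2 kh kc]] := exact_homotopy nn a1 a2 ah ac.
have fh := Yh n n0; have knh := kh n n0; have ahn := ah n n0.
have eh := Xh n n0; have whn := wh n n1.
have e1 : e 1%N = f 1%N.
  have i1 : (0 < 1 <= n)%N by lia.
  have := wc 1%N i1; have := Xh 1%N i1; have := Yh 1%N i1.
  by rewrite w1 w2 X2 => H1 H2; rewrite (id_mul H2) (mul_id H1).
(* Since [w] is the identity in degree [n.+1], [e n = f n * w n]. A lift [c] of [f n * k n] along
   [e n] repairs two things at once: [a n + c * f n] commutes with the last maps, and
   [k n - w n * c] is killed by [f n], as [thru_contr] demands at the last position. *)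
have [||c [ch cE]] := N_co n3 HN NX (T := Y n.+1) (r := f n * k n).
- by rewrite X1 -Yn; ht.
- by rewrite e1 mulrA cplxn mul0r.
have wlast : w n.+1 = lid (Y n.+1) by rewrite wn w1 sg_id Yn.
have en : e n = f n * w n.
  rewrite -wc // wlast; move: eh; rewrite Xn X1 -Yn => H; by rewrite (id_mul H).
pose a' i := if i == n then a n + c * f n else if i == n.+1 then lid (Y n.+1) else a i.
pose k' i := if i == n then k n - w n * c else k i.
have nS : (n.+1 == n) = false by lia.
have a'm : lmor n Y f X e a'.
  split=> [i i_n|i i_n|]; rewrite /a'.
  - case: eqP => [->|i1]; first by ht.
    case: eqP => [->|i2]; first by rewrite Xn X1 -Yn; ht.
    by apply: ah; lia.
  - have [->|i_ne] := eqVneq i n.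
      rewrite nS eqxx mulrDr mulrA cE en.
      have := kc n nn => E; have := cplx (i := n.-1).
      have -> : n.-1.+1 = n by lia.
      move=> c0; have {}c0 := c0 ltac:(lia).
      have E1 : w n * a n = lid (Y n) - f n.-1 * k n.-1 - k n * f n.
        by apply/eqP; rewrite -addrA -opprD -E subKr.
      clear -E1 c0 fh knh ahn whn; nct.
    have -> : (i == n.+1) = false by lia.
    have -> : (i.+1 == n.+1) = false by lia.
    have aci := ac i ltac:(lia); case: eqP => // E.
    rewrite -E mulrDl aci -mulrA cplx; last by lia.
    by rewrite mulr0 addr0.
  - rewrite nS eqxx Yn -sg_id -a1; have -> : (1%N == n) = false by lia.
    by have -> : (1%N == n.+1) = false by lia.
have k'0 : f n * k' n = 0.
  by rewrite /k' eqxx mulrBr mulrA -en cE subrr.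
have T0 : thru Y f (fun i => w i * a' i).
  by exists X, e, a', w; split.
(* The part of [f * k' + k' * f] that comes from the homotopy components up to [m]; they are added
   one at a time, each by [thru_contr]. *)
pose C m i := (if (i <= m)%N then k' i * f i else 0)
   + (if (1 < i <= m.+1)%N then f i.-1 * k' i.-1 else 0).
have k'1 : k' 1%N = 0 by rewrite /k' ifF //; lia.
have k'2 : k' 2%N = 0 by rewrite /k' ifF //; lia.
have TC m : (1 < m <= n)%N -> thru Y f (fun i => w i * a' i + C m i).
  elim: m => [|[|[|m] IH]] // m_n.
    apply: thru_ext T0 => i i_n; rewrite /C; case: i i_n => [|[|[|[|i]]]] //= _;
    by rewrite ?k'1 ?k'2 ?mulr0 ?mul0r ?addr0.
  have m_n' : (1 < m.+3 <= n)%N by lia.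
  have kh' : hom (Y m.+4) (Y m.+3) (k' m.+3).
    rewrite /k'; case: eqP => [->|E]; first by ht.
    by apply: kh; lia.
  have T1 := thru_contr Ys m_n' kh' cplx cplxn.
  have {}T1 := T1 ltac:(by move=> ->).
  have {}IH := IH ltac:(lia).
  apply: thru_ext (thru_add IH T1) => i i_n /=; rewrite -addrA; congr (_ + _).
  rewrite /C; have [->|i1] := eqVneq i m.+3.
    have -> : (m.+3 <= m.+2)%N = false by lia.
    have -> : (1 < m.+3 <= m.+3)%N by lia.
    have -> : (1 < m.+3 <= m.+4)%N by lia.
    by rewrite leqnn add0r addrC.
  have [->|i2] := eqVneq i m.+4.
    have -> : (1 < m.+4 <= m.+3)%N = false by lia.
    have -> : (1 < m.+4 <= m.+4)%N by lia.
    have -> : (m.+4 <= m.+2)%N = false by lia.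
    have -> : (m.+4 <= m.+3)%N = false by lia.
    by rewrite !add0r.
  rewrite addr0; congr (_ + _).
    by have -> : (i <= m.+2)%N = (i <= m.+3)%N by lia.
  by have -> : (1 < i <= m.+3)%N = (1 < i <= m.+4)%N by lia.
apply: thru_id => //; apply: thru_ext (TC n nn) => i i_n; rewrite /C.
have -> : (i <= n)%N by lia.
have [->|i1] := eqVneq i 1%N.
  rewrite k'1 mul0r !addr0 w1 /a'.
  have -> : (1%N == n) = false by lia.
  have -> : (1%N == n.+1) = false by lia.
  by rewrite a1 (mul_id (hom_id _)).
have -> : (1 < i <= n.+1)%N by lia.
have := kc i ltac:(lia) => E.
have E1 : w i * a i = lid (Y i) - f i.-1 * k i.-1 - k i * f i.
  by apply/eqP; rewrite -addrA -opprD -E subKr.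
rewrite /a' /k'; have -> : (i.-1 == n) = false by lia.
have -> : (i == n.+1) = false by lia.
case: eqP E1 => [->|_] E1; first by clear -E1; nc.
by clear -E1; nc.
Qed.

End Exact.
End WeakIso.

(** * Mapping cones *)

Section Cone.
Variables (L : lincat) (n : nat) (n3 : (3 <= n)%N).
Variables (N : (nat -> lob L) -> (nat -> lring L) -> Prop) (HN : lang n N).
Implicit Types (X Y U V : nat -> lob L) (f g h a b : nat -> lring L) (T : lob L) (r s : lring L).

Definition coneU X i : lob L := extX n X i.+1.
Definition lconeX X Y : nat -> lob L := bpX n (coneU X) Y.
Definition lconef X f Y g a i : lring L :=
  J1 n (coneU X) Y i.+1 * - extf n f i.+1 * Q1 n (coneU X) Y i
  + J2 n (coneU X) Y i.+1 * a i.+1 * Q1 n (coneU X) Y i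
  + J2 n (coneU X) Y i.+1 * g i * Q2 n (coneU X) Y i.

Lemma extX_le X i : (i <= n.+1)%N -> extX n X i = X i.
Proof. by rewrite /extX => ->. Qed.

Lemma extf_le f i : (i <= n)%N -> extf n f i = f i.
Proof. by rewrite /extf => ->. Qed.

Lemma extf_hom X f i : lseq n X f -> (0 < i <= n.+1)%N ->
  hom (extX n X i) (extX n X i.+1) (extf n f i).
Proof.
move=> [Xh Xn] i_n; rewrite (extX_le X (i := i)); last by lia.
have [i_n'|i_n'] := leqP i n.
  by rewrite /extf i_n' extX_le //; apply: Xh; lia.
have -> : i = n.+1 by lia.
by rewrite /extf /extX !ltnn Xn; apply: hom_sg; apply: Xh; lia.
Qed.

Lemma coneU_last X : coneU X n.+1 = lso (coneU X 1%N).
Proof. by rewrite /coneU /extX ltnn ifT //; lia. Qed.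

Lemma coneP X Y : Y n.+1 = lso (Y 1%N) ->
  forall i, (0 < i <= n.+1)%N ->
  isbp (lconeX X Y i) (extX n X i.+1) (Y i) (J1 n (coneU X) Y i) (J2 n (coneU X) Y i)
    (Q1 n (coneU X) Y i) (Q2 n (coneU X) Y i).
Proof. by move=> Yn i i_n; apply: (bpXP (coneU_last X) Yn i_n). Qed.

Section ConeOf.
Variables (X Y : nat -> lob L) (f g a : nat -> lring L).
Hypotheses (NX : N X f) (NY : N Y g) (am : lmor n X f Y g a).

Let Yn : Y n.+1 = lso (Y 1%N) := (N_seq HN NY).2.

Lemma lcone_lseq : lseq n (lconeX X Y) (lconef X f Y g a).
Proof.
have [ah ac an] := am; have [Yh _] := N_seq HN NY.
split=> [i i_n|]; last by apply: bpX_last; lia.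
have c1 := coneP X Yn (i := i) ltac:(lia).
have c2 := coneP X Yn (i := i.+1) ltac:(lia).
have t1 := extf_hom (N_seq HN NX) (i := i.+1) ltac:(lia).
have := ah i.+1 ltac:(lia); rewrite -(extX_le X); last by lia.
move=> t2; have t3 := Yh i i_n.
by rewrite /lconef; ht.
Qed.

Lemma lcone_cplx i : (0 < i < n)%N ->
  lconef X f Y g a i.+1 * lconef X f Y g a i = 0.
Proof.
have [ah ac an] := am; have [Yh _] := N_seq HN NY => i_n.
have i1 : (0 < i.+1 <= n)%N by lia.
have c1 := coneP X Yn (i := i.+1) ltac:(lia).
have t1 := extf_hom (N_seq HN NX) (i := i.+1) ltac:(lia).
have t3 := Yh i ltac:(lia).
have t2 := ah i.+1 ltac:(lia); rewrite -(extX_le X) in t2; last by lia.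
have e1 := ac i.+1 ltac:(lia); have e2 := N_comp0 n3 HN NX (i := i.+1) ltac:(lia).
have e3 := N_comp0 n3 HN NY (i := i) ltac:(lia).
have Ef : extf n f i.+1 = f i.+1 by rewrite extf_le //; lia.
rewrite -Ef in e1 e2.
rewrite (extf_le g) in e3; last by lia.
rewrite /lconef; clear -c1 t1 t2 t3 e1 e2 e3; nct.
Qed.

Lemma lcone_cplxn : sg (lconef X f Y g a 1%N) * lconef X f Y g a n = 0.
Proof.
have [ah ac an] := am; have [Yh _] := N_seq HN NY; have [Xh Xn] := N_seq HN NX.
have n0 : (0 < n)%N by lia.
have c1 := coneP X Yn (i := n.+1) ltac:(lia).
have t1 := extf_hom (N_seq HN NX) (i := n.+1) ltac:(lia).
have t3 := Yh n ltac:(lia).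
have t2 := ah n.+1 ltac:(lia); rewrite -(extX_le X) in t2; last by lia.
have e1 := ac 1%N ltac:(lia); have e2 := N_comp0 n3 HN NX (i := 1%N) ltac:(lia).
have e3 := N_comp0 n3 HN NY (i := n) ltac:(lia).
have En : extf n f n.+1 = sg (f 1%N) by rewrite /extf ltnn.
have Eg : extf n g n.+1 = sg (g 1%N) by rewrite /extf ltnn.
have E2 : extf n f 2 = f 2%N by rewrite extf_le //; lia.
rewrite En in t1; rewrite Eg in e3; rewrite E2 in e2.
rewrite /lconef En E2 an !sgD !sgM -Q1_last // -Q2_last // !sgN.
move/(congr1 sg): e1; move/(congr1 sg): e2; rewrite !sgM sg0 an in t2 *.
move=> e2 e1; clear -c1 t1 t2 t3 e1 e2 e3; nct.
Qed.

(** True for every completion [a], whether or not its cone is an n-angle. The restriction of [r] to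
    the [Y]-summand kills [g i] and so extends along [g i.+1] to some [y]. *)
Lemma lcone_exact i T r : (0 < i < n)%N -> hom (lconeX X Y i.+1) T r ->
  r * lconef X f Y g a i = 0 ->
  exists s, hom (lconeX X Y i.+2) T s /\ r = s * lconef X f Y g a i.+1.
Proof.
have [ah ac an] := am; have [Yh _] := N_seq HN NY => i_n rh r0.
have c0 := coneP X Yn (i := i) ltac:(lia).
have c1 := coneP X Yn (i := i.+1) ltac:(lia).
have c2 := coneP X Yn (i := i.+2) ltac:(lia).
have t1 := extf_hom (N_seq HN NX) (i := i.+1) ltac:(lia).
have t1' := extf_hom (N_seq HN NX) (i := i.+2) ltac:(lia).
have t2 := ah i.+1 ltac:(lia); rewrite -(extX_le X) in t2; last by lia.
have t2' := ah i.+2 ltac:(lia); rewrite -(extX_le X) in t2'; last by lia.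
have t3 := Yh i ltac:(lia); have t3' := Yh i.+1 ltac:(lia).
have e1 := ac i.+1 ltac:(lia).
set j1 := J1 n (coneU X) Y i.+1 in c1; set j2 := J2 n (coneU X) Y i.+1 in c1.
have y0 : r * j2 * g i = 0.
  have -> : r * j2 * g i = r * lconef X f Y g a i * J2 n (coneU X) Y i.
    rewrite /lconef -/j1 -/j2; clear -c0 c1 t1 t2 t3; nct.
  by rewrite r0 mul0r.
have [||y [yh yE]] := N_contra n3 HN NY (i := i) (T := T) (r := r * j2) ltac:(lia).
- by ht.
- by [].
rewrite extf_le in yE; last by lia.
rewrite extX_le in yh; last by lia.
(* After the part forced by [y] is subtracted, the restriction to the [X]-summand kills [f i.+1].
   The factor [x] enters the result with a minus sign since the cone carries [- f]. *)
have [||x [xh xE]] := N_contra n3 HN NX (i := i.+1) (T := T) (r := r * j1 - y * a i.+2) ltac:(lia).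
- by rewrite -(extX_le X); [ht|lia].
- have : r * lconef X f Y g a i * J1 n (coneU X) Y i = 0 by rewrite r0 mul0r.
  rewrite -(extf_le f); last by lia.
  have -> : r * lconef X f Y g a i * J1 n (coneU X) Y i
      = - (r * j1 * extf n f i.+1) + (r * j2) * a i.+1.
    rewrite /lconef -/j1 -/j2; clear -c0 c1 t1 t2 t3; nct.
  rewrite yE -(mulrA y) -e1 => /eqP; rewrite addr_eq0 eqr_opp => /eqP E.
  by rewrite mulrBl E extf_le ?mulrA ?subrr //; lia.
exists (- x * Q1 n (coneU X) Y i.+2 + y * Q2 n (coneU X) Y i.+2).
split; first by ht.
have rE : r = r * j1 * Q1 n (coneU X) Y i.+1 + r * j2 * Q2 n (coneU X) Y i.+1.
  by clear -c1 rh; nct.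
rewrite [LHS]rE yE; move/eqP: xE; rewrite subr_eq => /eqP ->.
rewrite /lconef; clear -c1 c2 t1' t2' t3' xh yh; nct.
Qed.

End ConeOf.

Definition LN4 : Prop := forall X f Y g r s, N X f -> N Y g ->
  hom (X 1%N) (Y 1%N) r -> hom (X 2%N) (Y 2%N) s -> s * f 1%N = g 1%N * r ->
  exists a, [/\ a 1%N = r, a 2%N = s, lmor n X f Y g a
              & N (lconeX X Y) (lconef X f Y g a)].

End Cone.

(** * The sequence of (N4* ) *)

Section Options.
Variable (L : lincat).
Implicit Types (a b c : option (lob L)).

Definition lo a : lob L := if a is Some X then X else lz.
Definition losum a b : option (lob L) :=
  match a, b with
  | Some X, Some Y => Some (lbp X Y)
  | Some X, None => Some X
  | None, _ => b
  end.
Definition oj1 a b : lring L :=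
  match a, b with
  | Some X, Some Y => lj1 X Y
  | Some X, None => lid X
  | _, _ => 0
  end.
Definition oj2 a b : lring L :=
  match a, b with
  | Some X, Some Y => lj2 X Y
  | None, Some Y => lid Y
  | _, _ => 0
  end.
Definition oq1 a b : lring L :=
  match a, b with
  | Some X, Some Y => lq1 X Y
  | Some X, None => lid X
  | _, _ => 0
  end.
Definition oq2 a b : lring L :=
  match a, b with
  | Some X, Some Y => lq2 X Y
  | None, Some Y => lid Y
  | _, _ => 0
  end.

(** A missing summand stands for the zero object, whose identity is 0 in the ring, so the biproduct
    equations survive its deletion and no case distinction is needed in matrix computations. *)
Lemma losumP a b :
  isbp (lo (losum a b)) (lo a) (lo b) (oj1 a b) (oj2 a b) (oq1 a b) (oq2 a b).
Proof.
case: a => [X|]; case: b => [Y|] /=; first exact: lbpP.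
all: split; try ht; rewrite ?(mul_id (hom_id _)) ?mulr0 ?mul0r ?lid_z ?subrr ?subr0 //.
Qed.

End Options.

Section Octahedron.
Variables (L : lincat) (n : nat).
Implicit Types (A B C : nat -> lob L) (f g h a : nat -> lring L).

Definition dA A (i : nat) := if (i.+2 <= n)%N then Some (A i.+2) else None.
Definition dB B (i : nat) := if (i.+1 <= n)%N then Some (B i.+1) else None.
Definition dC C (i : nat) := if (3 <= i)%N then Some (C i) else None.

Section Charts.
Variables (A B C : nat -> lob L) (i : nat).
Definition dO : lob L := lo (losum (dA A i) (losum (dB B i) (dC C i))).
Definition dBC : lob L := lo (losum (dB B i) (dC C i)).
Definition dj1 := oj1 (dA A i) (losum (dB B i) (dC C i)).
Definition dj2 := oj2 (dA A i) (losum (dB B i) (dC C i)).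
Definition dq1 := oq1 (dA A i) (losum (dB B i) (dC C i)).
Definition dq2 := oq2 (dA A i) (losum (dB B i) (dC C i)).
Definition ej1 := oj1 (dB B i) (dC C i).
Definition ej2 := oj2 (dB B i) (dC C i).
Definition eq1 := oq1 (dB B i) (dC C i).
Definition eq2 := oq2 (dB B i) (dC C i).
Lemma dP : isbp dO (lo (dA A i)) dBC dj1 dj2 dq1 dq2.
Proof. exact: losumP. Qed.
Lemma eP : isbp dBC (lo (dB B i)) (lo (dC C i)) ej1 ej2 eq1 eq2.
Proof. exact: losumP. Qed.
End Charts.

(** The four truncated entries are 0 where a summand at one of their ends has been deleted. Indexing
    [pA] by [i.+2] allows [dphi] to truncate it as well. *)
Definition da f i : lring L := if (i.+3 <= n)%N then f i.+2 else 0.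
Definition dphi a i : lring L := if (i.+2 <= n)%N then a i.+2 else 0.
Definition db g i : lring L := if (i.+2 <= n)%N then g i.+1 else 0.
Definition dc h i : lring L := if (3 <= i)%N then h i else 0.

(* [pA i.+2] and [pB i] stand for [psi_(2i-2)] and [psi_(2i-3)]. *)
Definition LDX A B C i : lob L :=
  if i == 1%N then A 3%N else if (i <= n)%N then dO A B C i else lso (A 3%N).
Definition LDf A B C f g h a pA pB i : lring L :=
  if i == 1%N then dj1 A B C 2%N * da f 1%N + dj2 A B C 2%N * ej1 B C 2%N * dphi a 1%N
  else if (i < n)%N then
    dj1 A B C i.+1 * - da f i * dq1 A B C i
    + dj2 A B C i.+1 * ej1 B C i.+1 * sgn i (dphi a i) * dq1 A B C i
    + dj2 A B C i.+1 * ej1 B C i.+1 * - db g i * (eq1 B C i * dq2 A B C i)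
    + dj2 A B C i.+1 * ej2 B C i.+1 * dphi pA i * dq1 A B C i
    + dj2 A B C i.+1 * ej2 B C i.+1 * pB i * (eq1 B C i * dq2 A B C i)
    + dj2 A B C i.+1 * ej2 B C i.+1 * dc h i * (eq2 B C i * dq2 A B C i)
  else sg (f 2%N) * h n.

Definition LN4star (N : (nat -> lob L) -> (nat -> lring L) -> Prop) : Prop :=
  forall A f B g C h, N A f -> N B g -> N C h ->
  B 1%N = A 1%N -> C 1%N = A 2%N -> C 2%N = B 2%N -> h 1%N * f 1%N = g 1%N ->
  exists a pA pB,
    [/\ a 1%N = lid (A 1%N), a 2%N = h 1%N, lmor n A f B g a,
        (forall i, (1 < i < n)%N -> hom (B i.+1) (C i.+1) (pB i)) /\
        (forall i, (1 < i < n.-1)%N -> hom (A i.+2) (C i.+1) (pA i.+2))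
      & h n * pB n.-1 = sg (f 1%N) * g n /\ N (LDX A B C) (LDf A B C f g h a pA pB)].

End Octahedron.

(** * From (N4) to (N4* ) *)

Ltac ifs :=
  repeat match goal with
  | |- context [if ?c then _ else _] =>
    first [rewrite (_ : c = true); [|lia] | rewrite (_ : c = false); [|lia]]
  end.

(** * The reduced cone K of a morphism with first component 1 *)

Section Reduced.
Variables (L : lincat) (n : nat) (n3 : (3 <= n)%N).
Variables (N : (nat -> lob L) -> (nat -> lring L) -> Prop) (HN : lang n N).
Variables (A B : nat -> lob L) (f g a : nat -> lring L).
Hypotheses (NA : N A f) (NB : N B g) (BA : B 1%N = A 1%N).
Hypotheses (am : lmor n A f B g a) (a1 : a 1%N = lid (A 1%N)).

(* The cone of a morphism with first component an identity, with the contractible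
   part [A_1 = A_1] split off. *)
Definition kU i : lob L :=
  if (i < n)%N then A i.+1 else if i == n then lz else lso (A 2%N).
Definition kV i : lob L :=
  if i == 1%N then lz else if (i <= n)%N then B i else lso lz.
Definition kX : nat -> lob L := bpX n kU kV.
Definition kj1 := J1 n kU kV.
Definition kj2 := J2 n kU kV.
Definition kq1 := Q1 n kU kV.
Definition kq2 := Q2 n kU kV.
(** [ka] drops alpha_n, which ends in the removed Sigma A_1, and [kb] drops beta_1, which starts in
    the removed B_1. *)
Definition ka i : lring L := if (i.+1 < n)%N then f i.+1 else 0.
Definition kb i : lring L := if i == 1%N then 0 else g i.
(** The last map results from eliminating the entry Sigma phi_1 = 1 from the last map of the cone: 0
    - (- Sigma alpha_1) beta_n. *)
Definition kf i : lring L :=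
  if (i < n)%N then
    kj1 i.+1 * - ka i * kq1 i + kj2 i.+1 * a i.+1 * kq1 i + kj2 i.+1 * kb i * kq2 i
  else kj1 i.+1 * (sg (f 1%N) * g i) * kq2 i.

Lemma kP i : (0 < i <= n.+1)%N ->
  isbp (kX i) (kU i) (kV i) (kj1 i) (kj2 i) (kq1 i) (kq2 i).
Proof.
apply: bpXP.
  by rewrite /kU; ifs.
by rewrite /kV; ifs.
Qed.

Lemma kU_lt i : (i < n)%N -> kU i = A i.+1.
Proof. by rewrite /kU => ->. Qed.
Lemma kU_n : kU n = lz. Proof. by rewrite /kU ltnn eqxx. Qed.
Lemma kU_last : kU n.+1 = lso (A 2%N).
Proof. by rewrite /kU; ifs. Qed.
Lemma kV_gt i : (1 < i <= n)%N -> kV i = B i.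
Proof. by move=> i_n; rewrite /kV; ifs. Qed.
Lemma kj1_n : kj1 n = 0.
Proof.
by have [+ _ _ _ _ _ _ _ _] := kP (i := n) ltac:(lia); apply: hom_from_0; rewrite kU_n lid_z.
Qed.
Lemma kq1_n : kq1 n = 0.
Proof.
by have [_ _ + _ _ _ _ _ _] := kP (i := n) ltac:(lia); apply: hom_to_0; rewrite kU_n lid_z.
Qed.
Lemma kq2_1 : kq2 1%N = 0.
Proof.
by have [_ _ _ + _ _ _ _ _] := kP (i := 1%N) ltac:(lia); apply: hom_to_0; rewrite lid_z.
Qed.
Lemma kj1_last : kj1 n.+1 = sg (kj1 1%N). Proof. by apply: J1_last; lia. Qed.
Lemma kq1_last : kq1 n.+1 = sg (kq1 1%N). Proof. by apply: Q1_last; lia. Qed.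
Lemma ka_hom i : (0 < i < n)%N -> hom (kU i) (kU i.+1) (ka i).
Proof.
have [Ah An] := N_seq HN NA => i_n; rewrite kU_lt; last by lia.
rewrite /ka; case: ltnP => i_n'; last exact: hom0.
by rewrite kU_lt //; apply: Ah; lia.
Qed.

Lemma kb_hom i : (0 < i < n)%N -> hom (kV i) (kV i.+1) (kb i).
Proof.
have [Bh Bn] := N_seq HN NB => i_n; rewrite (kV_gt (i := i.+1)); last by lia.
rewrite /kb; have [->|i1] := eqVneq i 1%N; first exact: hom0.
by rewrite kV_gt; [apply: Bh; lia|lia].
Qed.

Lemma kphi_hom i : (0 < i < n)%N -> hom (kU i) (kV i.+1) (a i.+1).
Proof.
have [ah _ _] := am => i_n; rewrite kV_gt; last by lia.
by rewrite kU_lt; [apply: ah; lia|lia].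
Qed.

Lemma kn_hom : hom (kV n) (kU n.+1) (sg (f 1%N) * g n).
Proof.
have [Bh Bn] := N_seq HN NB; have [Ah An] := N_seq HN NA.
rewrite kV_gt ?kU_last; last by lia.
apply: homM (Bh n ltac:(lia)) _.
by rewrite Bn BA; apply: hom_sg; apply: Ah; lia.
Qed.

Lemma k_lseq : lseq n kX kf.
Proof.
split=> [i i_n|]; last by apply: bpX_last; lia.
have c1 := kP (i := i) ltac:(lia); have c2 := kP (i := i.+1) ltac:(lia).
rewrite /kf; case: ltnP => i_n'.
  have t1 := ka_hom (i := i) ltac:(lia); have t2 := kb_hom (i := i) ltac:(lia).
  have t3 := kphi_hom (i := i) ltac:(lia); ht.
have iE : i = n by lia.
by subst i; have t := kn_hom; ht.
Qed.

Let cU := coneU n A.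
Let cj1 := J1 n cU B.
Let cj2 := J2 n cU B.
Let cq1 := Q1 n cU B.
Let cq2 := Q2 n cU B.

Definition ki1 i : lring L := if (i < n)%N then lid (A i.+1) else 0.
Definition ki2 i : lring L := if i == 1%N then 0 else lid (B i).
(** In degree n the summand B_n is embedded by (- beta_n, 1), so that the component of the last cone
    map into Sigma B_1 vanishes on it. *)
Definition k_in0 i : lring L :=
  cj1 i * ki1 i * kq1 i + cj2 i * ki2 i * kq2 i
  + (if i == n then cj1 i * - g i * kq2 i else 0).
Definition k_in i := if i == n.+1 then sg (k_in0 1%N) else k_in0 i.
(** In degree 1 the retraction of A_2 + B_1 onto A_2 is (1, alpha_1); it is compatible with the next
    map because phi_2 alpha_1 = beta_1 and alpha_2 alpha_1 = 0. *)
Definition k_pr0 i : lring L :=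
  kj1 i * ki1 i * cq1 i + kj2 i * ki2 i * cq2 i
  + (if i == 1%N then kj1 i * f i * cq2 i else 0).
Definition k_pr i := if i == n.+1 then sg (k_pr0 1%N) else k_pr0 i.

Lemma cP i : (0 < i <= n.+1)%N ->
  isbp (lconeX n A B i) (extX n A i.+1) (B i) (cj1 i) (cj2 i) (cq1 i) (cq2 i).
Proof. exact: (coneP n3 A (N_seq HN NB).2). Qed.

Lemma ki1_hom i : (0 < i <= n)%N -> hom (kU i) (extX n A i.+1) (ki1 i) /\
  hom (extX n A i.+1) (kU i) (ki1 i).
Proof.
move=> i_n; rewrite /ki1; case: ltnP => i_n'; last by split; exact: hom0.
by rewrite kU_lt // extX_le; [split; ht|lia].
Qed.

Lemma ki2_hom i : (0 < i <= n)%N -> hom (kV i) (B i) (ki2 i) /\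
  hom (B i) (kV i) (ki2 i).
Proof.
move=> i_n; rewrite /ki2; have [->|i1] := eqVneq i 1%N; first by split; exact: hom0.
by rewrite kV_gt; [split; ht|lia].
Qed.

Lemma k_in_hom i : (0 < i <= n)%N -> hom (kX i) (lconeX n A B i) (k_in0 i).
Proof.
have [Bh Bn] := N_seq HN NB; have [Ah An] := N_seq HN NA => i_n.
have c1 := kP (i := i) ltac:(lia); have c2 := cP (i := i) ltac:(lia).
have [t1 _] := ki1_hom i_n; have [t2 _] := ki2_hom i_n.
rewrite /k_in0; case: eqP => [iE|_]; last by ht.
have t3 := Bh i i_n; subst i.
rewrite Bn BA -An -(extX_le A (leqnn n.+1)) -(kV_gt (i := n)) in t3; last by lia.
by ht.
Qed.

Lemma k_pr_hom i : (0 < i <= n)%N -> hom (lconeX n A B i) (kX i) (k_pr0 i).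
Proof.
have [Bh Bn] := N_seq HN NB; have [Ah An] := N_seq HN NA => i_n.
have c1 := kP (i := i) ltac:(lia); have c2 := cP (i := i) ltac:(lia).
have [_ t1] := ki1_hom i_n; have [_ t2] := ki2_hom i_n.
rewrite /k_pr0; case: eqP => [iE|_]; last by ht.
have t3 := Ah i i_n; subst i.
rewrite -BA -kU_lt in t3; last by lia.
by ht.
Qed.

Lemma k_in_mor : lmor n kX kf (lconeX n A B) (lconef n A f B g a) k_in.
Proof.
have [Bh Bn] := N_seq HN NB; have [Ah An] := N_seq HN NA; have [ah ac an] := am.
have nS i : (i <= n)%N -> (i == n.+1) = false by lia.
split=> [i i_n|i i_n|].
- rewrite /k_in; case: eqP => [->|E]; last by apply: k_in_hom; lia.
  rewrite /kX bpX_last; last by lia.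
  rewrite /lconeX bpX_last; last by lia.
  by apply: hom_sg; apply: k_in_hom; lia.
- have c1 := kP (i := i) ltac:(lia); have c2 := kP (i := i.+1) ltac:(lia).
  have c3 := cP (i := i) ltac:(lia); have c4 := cP (i := i.+1) ltac:(lia).
  have [t1 _] := ki1_hom i_n; have [t2 _] := ki2_hom i_n.
  have t3 := extf_hom n3 (N_seq HN NA) (i := i.+1) ltac:(lia).
  have t4 := Bh i i_n.
  rewrite /k_in (nS i); last by lia.
  rewrite /lconef -/cU -/(cj1 _) -/(cj2 _) -/(cq1 _) -/(cq2 _).
  have [i_lt|i_ge] := ltnP i n.
    have t5 := ah i.+1 ltac:(lia); rewrite -(extX_le (n := n) A) in t5; last by lia.
    have t6 := ka_hom (i := i) ltac:(lia); have t7 := kb_hom (i := i) ltac:(lia).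
    have t8 := kphi_hom (i := i) ltac:(lia).
    have [t9 _] := ki1_hom (i := i.+1) ltac:(lia); have [t10 _] := ki2_hom (i := i.+1) ltac:(lia).
    rewrite (nS i.+1) // /kf i_lt /k_in0 (ltn_eqF i_lt).
    have e1 : ki2 i.+1 = lid (B i.+1) by rewrite /ki2 ifF //; lia.
    have e2 : ki1 i = lid (extX n A i.+1) by rewrite /ki1 i_lt extX_le //; lia.
    have [i2_lt|i2_ge] := ltnP i.+1 n.
      have e3 : ki1 i.+1 = lid (extX n A i.+2) by rewrite /ki1 i2_lt extX_le //; lia.
      have e4 : ka i = extf n f i.+1 by rewrite /ka i2_lt extf_le.
      rewrite (ltn_eqF i2_lt).
      have [iE|i1] := eqVneq i 1%N.
        have e5 : kq2 i = 0 by rewrite iE kq2_1.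
        clear - c1 c2 c3 c4 t1 t2 t3 t4 t5 t6 t7 t8 t9 t10 e1 e2 e3 e4 e5; nct.
      have e5 : kb i = g i by rewrite /kb ifF //; lia.
      have e6 : ki2 i = lid (B i) by rewrite /ki2 ifF //; lia.
      clear - c1 c2 c3 c4 t1 t2 t3 t4 t5 t6 t7 t8 t9 t10 e1 e2 e3 e4 e5 e6; nct.
    have iE : i.+1 = n by lia.
    have e3 : ki1 i.+1 = 0 by rewrite /ki1 ifF //; lia.
    have e4 : ka i = 0 by rewrite /ka ifF //; lia.
    have e5 : kb i = g i by rewrite /kb ifF //; lia.
    have e6 : ki2 i = lid (B i) by rewrite /ki2 ifF //; lia.
    (* As phi_1 = 1, the last square of the morphism reads beta_n phi_n = alpha_n; this cancels the
       alpha_n missing from K against the entry - beta_n of the inclusion. *)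
    have e7 : g i.+1 * a i.+1 = extf n f i.+1.
      rewrite -ac; last by lia.
      have Hn := Ah i.+1 ltac:(lia).
      rewrite iE in Hn *.
      rewrite an a1 sg_id extf_le // -An; exact: id_mul Hn.
    have e8 : g i.+1 * g i = 0.
      by have := N_comp0 n3 HN NB i_n; rewrite extf_le //.
    have e9 : lid (kV i.+1) = lid (B i.+1) by rewrite kV_gt //; lia.
    have -> : (i.+1 == n) = true by exact/eqP.
    clear - c1 c2 c3 c4 t1 t2 t3 t4 t5 t6 t7 t8 t9 t10 e1 e2 e3 e4 e5 e6 e7 e8 e9; nct.
  have iE : i = n by lia.
  subst i; rewrite eqxx /kf ltnn /k_in0 eqxx ifF; last by lia.
  have e1 : ki1 1%N = lid (A 2%N) by rewrite /ki1 ifT //; lia.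
  have e2 : ki2 1%N = 0 by [].
  rewrite e1 e2 mulr0 mul0r !addr0 !sgM sg_id -kq1_last.
  have -> : sg (cj1 1%N) = cj1 n.+1 by rewrite /cj1 J1_last //; lia.
  have e3 : extf n f n.+1 = sg (f 1%N) by rewrite /extf ltnn.
  have e4 : ki1 n = 0 by rewrite /ki1 ltnn.
  have e5 : ki2 n = lid (B n) by rewrite /ki2 ifF //; lia.
  have e6 := kq1_n.
  have e7 : a n.+1 = lid (B n.+1) by rewrite an a1 sg_id Bn BA.
  have t5 := kn_hom; have e8 := kU_last.
  have e9 : lid (lso (A 2%N)) = lid (kU n.+1) by rewrite kU_last.
  have e10 : extX n A n.+2 = kU n.+1 by rewrite kU_last /extX ltnn.
  rewrite e10 in c4 t3.
  have e11 : extX n A n.+1 = B n.+1 by rewrite extX_le // An Bn BA.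
  rewrite e11 in c3 t3.
  clear - c1 c2 c3 c4 t1 t2 t3 t4 t5 e3 e4 e5 e6 e7 e9; nct.
- by rewrite /k_in eqxx ifF //; lia.
Qed.

Lemma k_pr_mor : lmor n (lconeX n A B) (lconef n A f B g a) kX kf k_pr.
Proof.
have [Bh Bn] := N_seq HN NB; have [Ah An] := N_seq HN NA; have [ah ac an] := am.
have nS i : (i <= n)%N -> (i == n.+1) = false by lia.
split=> [i i_n|i i_n|].
- rewrite /k_pr; case: eqP => [->|E]; last by apply: k_pr_hom; lia.
  rewrite /kX bpX_last; last by lia.
  rewrite /lconeX bpX_last; last by lia.
  by apply: hom_sg; apply: k_pr_hom; lia.
- have c1 := kP (i := i) ltac:(lia); have c2 := kP (i := i.+1) ltac:(lia).
  have c3 := cP (i := i) ltac:(lia); have c4 := cP (i := i.+1) ltac:(lia).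
  have [_ t1] := ki1_hom i_n; have [_ t2] := ki2_hom i_n.
  have t3 := extf_hom n3 (N_seq HN NA) (i := i.+1) ltac:(lia).
  have t4 := Bh i i_n.
  rewrite /k_pr (nS i); last by lia.
  rewrite /lconef -/cU -/(cj1 _) -/(cj2 _) -/(cq1 _) -/(cq2 _).
  have [i_lt|i_ge] := ltnP i n.
    have t5 := ah i.+1 ltac:(lia); rewrite -(extX_le (n := n) A) in t5; last by lia.
    have t6 := ka_hom (i := i) ltac:(lia); have t7 := kb_hom (i := i) ltac:(lia).
    have t8 := kphi_hom (i := i) ltac:(lia).
    have [_ t9] := ki1_hom (i := i.+1) ltac:(lia); have [_ t10] := ki2_hom (i := i.+1) ltac:(lia).
    have e1 : ki2 i.+1 = lid (B i.+1) by rewrite /ki2 ifF //; lia.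
    have e2 : ki1 i = lid (extX n A i.+1) by rewrite /ki1 i_lt extX_le //; lia.
    rewrite (nS i.+1) // /kf i_lt /k_pr0; have -> : (i.+1 == 1%N) = false by lia.
    have [i2_lt|i2_ge] := ltnP i.+1 n.
      have e3 : ki1 i.+1 = lid (extX n A i.+2) by rewrite /ki1 i2_lt extX_le //; lia.
      have e4 : ka i = extf n f i.+1 by rewrite /ka i2_lt extf_le.
      have [iE|i1] := eqVneq i 1%N.
        have e5 : kb i = 0 by rewrite iE.
        have e6 : a i.+1 * f i = g i.
          rewrite ac // iE a1 -BA; apply: mul_id; apply: Bh; lia.
        have e7 : extf n f i.+1 * f i = 0 by apply: (N_comp0 n3 HN NA).
        have e8 : ki2 i = 0 by rewrite iE.
        have t11 := Ah i i_n; rewrite {1}iE -BA -{1}iE -(extX_le (n := n) A) in t11; last by lia.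
        have e9 : kU i = extX n A i.+1 by rewrite kU_lt ?extX_le //; lia.
        rewrite e9 in c1 t1 t6 t8.
        clear - c1 c2 c3 c4 t1 t2 t3 t4 t5 t6 t7 t8 t9 t10 t11 e1 e2 e3 e4 e5 e6 e7 e8; nct.
      have e5 : kb i = g i by rewrite /kb ifF //; lia.
      have e6 : ki2 i = lid (B i) by rewrite /ki2 ifF //; lia.
      clear - c1 c2 c3 c4 t1 t2 t3 t4 t5 t6 t7 t8 t9 t10 e1 e2 e3 e4 e5 e6; nct.
    have iE : i.+1 = n by lia.
    have -> : (i == 1%N) = false by lia.
    have e3 : kj1 i.+1 = 0 by rewrite iE kj1_n.
    have e5 : kb i = g i by rewrite /kb ifF //; lia.
    have e6 : ki2 i = lid (B i) by rewrite /ki2 ifF //; lia.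
    clear - c1 c2 c3 c4 t1 t2 t3 t4 t5 t6 t7 t8 t9 t10 e1 e2 e3 e5 e6; nct.
  have iE : i = n by lia.
  subst i; rewrite eqxx /kf ltnn /k_pr0 eqxx ifF; last by lia.
  have e1 : ki1 1%N = lid (A 2%N) by rewrite /ki1 ifT //; lia.
  have e2 : ki2 1%N = 0 by [].
  rewrite e1 e2 mulr0 mul0r !addr0 !sgD !sgM sg_id -kj1_last.
  have -> : sg (cq1 1%N) = cq1 n.+1 by rewrite /cq1 Q1_last //; lia.
  have -> : sg (cq2 1%N) = cq2 n.+1 by rewrite /cq2 Q2_last //; lia.
  have e3 : extf n f n.+1 = sg (f 1%N) by rewrite /extf ltnn.
  have e4 : ki1 n = 0 by rewrite /ki1 ltnn.
  have e5 : ki2 n = lid (B n) by rewrite /ki2 ifF //; lia.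
  have e6 := kq1_n.
  have e7 : a n.+1 = lid (B n.+1) by rewrite an a1 sg_id Bn BA.
  have t5 := kn_hom.
  have e9 : lid (lso (A 2%N)) = lid (kU n.+1) by rewrite kU_last.
  have e10 : extX n A n.+2 = kU n.+1 by rewrite kU_last /extX ltnn.
  rewrite e10 in c4 t3.
  have e11 : extX n A n.+1 = B n.+1 by rewrite extX_le // An Bn BA.
  rewrite e11 in c3 t3.
  have e12 : kj1 n = 0 by exact: kj1_n.
  rewrite e3 in t3.
  clear - c1 c2 c3 c4 t1 t2 t3 t4 t5 e3 e4 e5 e6 e7 e9 e12; nct.
- by rewrite /k_pr eqxx ifF //; lia.
Qed.

Lemma N_k : N (lconeX n A B) (lconef n A f B g a) -> N kX kf.
Proof.
move=> NC; apply: (N_retract HN k_lseq NC k_in_mor k_pr_mor) => i i_n.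
have c1 := kP (i := i) ltac:(lia); have c3 := cP (i := i) ltac:(lia).
have [t1 t1'] := ki1_hom i_n; have [t2 t2'] := ki2_hom i_n.
have -> : k_pr i = k_pr0 i by rewrite /k_pr ifF //; lia.
have -> : k_in i = k_in0 i by rewrite /k_in ifF //; lia.
rewrite /k_pr0 /k_in0.
have [Bh Bn] := N_seq HN NB; have [Ah An] := N_seq HN NA.
have [iE|i1] := eqVneq i 1%N.
  have -> : (i == n) = false by lia.
  have e1 : ki1 i = lid (kU i) by rewrite /ki1 ifT ?kU_lt //; lia.
  have e2 : kq2 i = 0 by rewrite iE kq2_1.
  have e3 : lid (kX i) = kj1 i * kq1 i.
    by apply/eqP; rewrite -subr_eq0 -(isbp_id c1) e2 mulr0.
  clear -c1 c3 t1 t1' t2 t2' e1 e2 e3; nct.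
have e2 : ki2 i = lid (kV i) by rewrite /ki2 kV_gt ?ifF //; lia.
have e3 : lid (B i) = lid (kV i) by rewrite kV_gt //; lia.
have [iE|i2] := eqVneq i n.
  have e1 : kj1 i = 0 by rewrite iE kj1_n.
  clear -c1 c3 t1 t1' t2 t2' e1 e2 e3; nct.
have e1 : ki1 i = lid (kU i) by rewrite /ki1 ifT ?kU_lt //; lia.
clear -c1 c3 t1 t1' t2 t2' e1 e2 e3; nct.
Qed.

End Reduced.

(** * Splitting the cone of K -> C *)

Section ConeToOctahedron.
Variables (L : lincat) (n : nat) (n3 : (3 <= n)%N).
Variables (N : (nat -> lob L) -> (nat -> lring L) -> Prop) (HN : lang n N).
Variables (A B C : nat -> lob L) (f g h a m : nat -> lring L).
Hypotheses (NA : N A f) (NB : N B g) (NC : N C h).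
Hypotheses (BA : B 1%N = A 1%N) (CA : C 1%N = A 2%N) (CB : C 2%N = B 2%N).
Hypotheses (am : lmor n A f B g a) (a1 : a 1%N = lid (A 1%N)) (a2 : a 2%N = h 1%N).

Local Notation kX := (kX n A B).
Local Notation kf := (kf n A B f g a).
Local Notation kU := (kU n A).
Local Notation kV := (kV n B).
Local Notation kj1 := (kj1 n A B).
Local Notation kj2 := (kj2 n A B).
Local Notation kq1 := (kq1 n A B).
Local Notation kq2 := (kq2 n A B).
Local Notation ka := (ka n f).
Local Notation kb := (kb g).
Local Notation dj1 := (dj1 n A B C).
Local Notation dj2 := (dj2 n A B C).
Local Notation dq1 := (dq1 n A B C).
Local Notation dq2 := (dq2 n A B C).
Local Notation ej1 := (ej1 n B C).
Local Notation ej2 := (ej2 n B C).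
Local Notation eq1 := (eq1 n B C).
Local Notation eq2 := (eq2 n B C).
Local Notation xj1 := (J1 n (coneU n kX) C).
Local Notation xj2 := (J2 n (coneU n kX) C).
Local Notation xq1 := (Q1 n (coneU n kX) C).
Local Notation xq2 := (Q2 n (coneU n kX) C).
Local Notation xX := (lconeX n kX C).
Local Notation xf := (lconef n kX kf C h m).

Hypothesis mm : lmor n kX kf C h m.
Hypotheses (m1 : m 1%N = kq1 1%N) (m2 : m 2%N = kq2 2%N).

(** The sign is that of the change of basis on A_(i+2) in degree i, made by [o_in0] and [o_pr0];
    here j = i+2, so (-1)^(i+1) appears as the sign of j-1. *)
Definition opA j : lring L := sgn j.-1 (m j.-1 * kj1 j.-1).
Definition opB i : lring L := m i.+1 * kj2 i.+1.

Local Notation D := (LDX n A B C).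
Local Notation d := (LDf n A B C f g h a opA opB).

Definition oiA (i : nat) : lring L := if (i.+2 <= n)%N then lid (A i.+2) else 0.
Definition oiB (i : nat) : lring L := if (i.+1 <= n)%N then lid (B i.+1) else 0.
Definition oiC (i : nat) : lring L := if (3 <= i)%N then lid (C i) else 0.

(** The cone of [m] has A_(i+2) + B_(i+1) + C_i in the middle degrees, with entries alpha, -phi,
    -beta since the maps of K are negated. The signs (-1)^(i+1) on A turn them into the -alpha,
    (-1)^i phi, -beta required of D. The entry for [i = n] comes from cancelling C_1 = A_2 against
    Sigma A_2, where Sigma [m 1] is the identity. *)
Definition o_in0 i : lring L :=
  xj1 i * kj1 i.+1 * sgn i.+1 (oiA i) * dq1 i
  + xj1 i * kj2 i.+1 * oiB i * eq1 i * dq2 i + xj2 i * oiC i * eq2 i * dq2 i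
  + (if i == n then xj1 i * kj1 i.+1 * - h i * eq2 i * dq2 i else 0).
Definition o_in1 : lring L := - (xj1 1%N * kj1 2%N).
Definition o_in i : lring L :=
  if i == 1%N then o_in1 else if i == n.+1 then sg o_in1 else o_in0 i.
(** C_2 = B_2 in degree 2 cancels against B_2 in degree 1 because [m 2] is the projection onto B_2.
    The entry [g 2] makes the retraction vanish on the image of that summand. In [o_pr1], the entry
    [f 2] plays the same part for C_1 = A_2. *)
Definition o_pr0 i : lring L :=
  dj1 i * sgn i.+1 (oiA i) * kq1 i.+1 * xq1 i
  + dj2 i * ej1 i * oiB i * kq2 i.+1 * xq1 i + dj2 i * ej2 i * oiC i * xq2 i
  + (if i == 2%N then dj2 i * ej1 i * g i * xq2 i else 0).
Definition o_pr1 : lring L := - (kq1 2%N * xq1 1%N) + f 2%N * xq2 1%N.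
Definition o_pr i : lring L :=
  if i == 1%N then o_pr1 else if i == n.+1 then sg o_pr1 else o_pr0 i.

Lemma oxP i : (0 < i <= n)%N -> isbp (xX i) (kX i.+1) (C i) (xj1 i) (xj2 i) (xq1 i) (xq2 i).
Proof.
move=> i_n; have := coneP n3 kX (N_seq HN NC).2 (i := i) ltac:(lia).
by rewrite extX_le //; lia.
Qed.

Lemma oxP_last : isbp (xX n.+1) (lso (kX 2%N)) (C n.+1) (xj1 n.+1) (xj2 n.+1)
  (xq1 n.+1) (xq2 n.+1).
Proof.
have := coneP n3 kX (N_seq HN NC).2 (i := n.+1) ltac:(lia).
by rewrite /extX ltnn.
Qed.

Lemma loA i : (i.+2 <= n)%N -> lo (dA n A i) = A i.+2.
Proof. by rewrite /dA => ->. Qed.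
Lemma loB i : (i.+1 <= n)%N -> lo (dB n B i) = B i.+1.
Proof. by rewrite /dB => ->. Qed.
Lemma loC i : (3 <= i)%N -> lo (dC C i) = C i.
Proof. by rewrite /dC => ->. Qed.

Lemma oiA_hom i : (0 < i <= n)%N ->
  hom (lo (dA n A i)) (kU i.+1) (oiA i) /\ hom (kU i.+1) (lo (dA n A i)) (oiA i).
Proof.
move=> i_n; rewrite /oiA; case: ifP => i_n'; last by split; exact: hom0.
by rewrite loA // kU_lt //; split; ht.
Qed.
Lemma oiB_hom i : (0 < i <= n)%N ->
  hom (lo (dB n B i)) (kV i.+1) (oiB i) /\ hom (kV i.+1) (lo (dB n B i)) (oiB i).
Proof.
move=> i_n; rewrite /oiB; case: ifP => i_n'; last by split; exact: hom0.
by rewrite loB // (kV_gt n3); [split; ht|lia].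
Qed.
Lemma oiC_hom i : hom (lo (dC C i)) (C i) (oiC i) /\ hom (C i) (lo (dC C i)) (oiC i).
Proof.
rewrite /oiC; case: ifP => i_n'; last by split; exact: hom0.
by rewrite loC //; split; ht.
Qed.

Lemma da_hom i : (0 < i <= n)%N -> hom (lo (dA n A i)) (lo (dA n A i.+1)) (da n f i).
Proof.
move=> i_n; rewrite /da; case: ifP => i_n'; last exact: hom0.
by rewrite !loA; try lia; apply: (N_seq HN NA).1; lia.
Qed.
Lemma dphi_hom i : (0 < i <= n)%N -> hom (lo (dA n A i)) (lo (dB n B i.+1)) (dphi n a i).
Proof.
move=> i_n; rewrite /dphi; case: ifP => i_n'; last exact: hom0.
by have [ah _ _] := am; rewrite loA // loB //; apply: ah; lia.
Qed.
Lemma db_hom i : (0 < i <= n)%N -> hom (lo (dB n B i)) (lo (dB n B i.+1)) (db n g i).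
Proof.
move=> i_n; rewrite /db; case: ifP => i_n'; last exact: hom0.
by rewrite !loB; try lia; apply: (N_seq HN NB).1; lia.
Qed.
Lemma dc_hom i : (0 < i <= n)%N -> hom (lo (dC C i)) (lo (dC C i.+1)) (dc h i).
Proof.
move=> i_n; rewrite /dc; case: ifP => i_n'; last exact: hom0.
by rewrite !loC; try lia; apply: (N_seq HN NC).1; lia.
Qed.
Lemma m_hom i : (0 < i <= n.+1)%N -> hom (kX i) (C i) (m i).
Proof. by case: mm => mh _ _; apply: mh. Qed.
Lemma opB_hom i : (1 < i < n)%N -> hom (B i.+1) (C i.+1) (opB i).
Proof.
move=> i_n; have t := m_hom (i := i.+1) ltac:(lia).
have c := kP n3 A B (i := i.+1) ltac:(lia).
by rewrite -(kV_gt n3) /opB; [ht|lia].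
Qed.
Lemma opA_hom i : (1 < i < n.-1)%N -> hom (A i.+2) (C i.+1) (opA i.+2).
Proof.
move=> i_n; have t := m_hom (i := i.+1) ltac:(lia).
have c := kP n3 A B (i := i.+1) ltac:(lia).
by rewrite -(kU_lt (n := n)) /opA /=; [ht|lia].
Qed.
Lemma opB_hom' i : (1 < i < n)%N -> hom (lo (dB n B i)) (lo (dC C i.+1)) (opB i).
Proof. by move=> i_n; rewrite loB ?loC; [apply: opB_hom|lia|lia]. Qed.
Lemma dpA_hom i : (1 < i < n)%N -> hom (lo (dA n A i)) (lo (dC C i.+1)) (dphi n opA i).
Proof.
move=> i_n; rewrite /dphi; case: ifP => i_n'; last exact: hom0.
by rewrite loA // loC; [apply: opA_hom; lia|lia].
Qed.

Lemma dpAE i : dphi n opA i = sgn i.+1 (m i.+1 * kj1 i.+1 * oiA i).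
Proof.
rewrite /dphi /opA /oiA; case: ifP => i_n /=; last by rewrite mulr0 /sgn oppr0 if_same.
have c := kP n3 A B (i := i.+1) ltac:(lia).
have [c1 _ _ _ _ _ _ _ _] := c; rewrite kU_lt // in c1.
by rewrite -(mulrA (m _)) (mul_id c1).
Qed.

Lemma oc1 : d 1%N = dj1 2%N * da n f 1%N + dj2 2%N * ej1 2%N * dphi n a 1%N.
Proof. by []. Qed.

Lemma oxf i : (0 < i < n)%N ->
  xf i = xj1 i.+1 * - kf i.+1 * xq1 i + xj2 i.+1 * m i.+1 * xq1 i
         + xj2 i.+1 * h i * xq2 i.
Proof. by move=> i_n; rewrite /lconef extf_le //; lia. Qed.

(** This yields the required gamma_n psi_(2n-5) = Sigma alpha_1 beta_n: [m n.+1] is the suspended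
    identity of A_2, and Sigma alpha_1 beta_n is the last map of K. *)
Lemma hm_last : h n * m n = sg (f 1%N) * g n * kq2 n.
Proof.
have [mh mc mn] := mm; rewrite -mc; last by lia.
have c := kP n3 A B (i := n.+1) ltac:(lia); have t := kn_hom n3 HN NA NB BA.
rewrite mn m1 -kq1_last // /kf ltnn.
have c' := kP n3 A B (i := n) ltac:(lia).
clear -c c' t; nct.
Qed.

(** Only C_n is left in degree n, so its chart is the identity. The index is kept apart from [n] so
    that the lemma also applies to a successor [i.+1 = n]. *)
Lemma d_last0 i : i = n -> [/\ dq1 i = 0, dj1 i = 0, eq1 i = 0 & ej1 i = 0] /\
  [/\ dq2 i = lid (C i), dj2 i = lid (C i), eq2 i = lid (C i), ej2 i = lid (C i) & D i = C i].
Proof.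
move=> ->; rewrite /dq1 /dj1 /eq1 /ej1 /dq2 /dj2 /eq2 /ej2 /LDX /dO /dA /dB /dC.
have -> : (n.+2 <= n)%N = false by lia.
have -> : (n.+1 <= n)%N = false by lia.
have -> : (n == 1%N) = false by lia.
by rewrite n3 leqnn.
Qed.

Lemma kn_hom' i : i = n -> hom (kV i) (kU i.+1) (sg (f 1%N) * g i).
Proof. by move=> ->; apply: kn_hom NA NB BA. Qed.

Lemma d_pen0 i : i.+1 = n -> [/\ dq1 i = 0 & dj1 i = 0].
Proof.
move=> E; rewrite /dq1 /dj1 /dA; have -> : (i.+2 <= n)%N = false by lia.
by case: losum.
Qed.

Lemma d_eq i : (1 < i < n)%N ->
  d i = dj1 i.+1 * - da n f i * dq1 i
    + dj2 i.+1 * ej1 i.+1 * sgn i (dphi n a i) * dq1 i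
    + dj2 i.+1 * ej1 i.+1 * - db n g i * (eq1 i * dq2 i)
    + dj2 i.+1 * ej2 i.+1 * sgn i.+1 (m i.+1 * kj1 i.+1 * oiA i) * dq1 i
    + dj2 i.+1 * ej2 i.+1 * opB i * (eq1 i * dq2 i)
    + dj2 i.+1 * ej2 i.+1 * dc h i * (eq2 i * dq2 i).
Proof.
move=> i_n; rewrite /LDf dpAE ifF; last by lia.
by rewrite ifT //; lia.
Qed.

Lemma D_eq i : (1 < i <= n)%N -> D i = dO n A B C i.
Proof. by move=> i_n; rewrite /LDX; ifs. Qed.

(** The generic square. Degrees 1, n-1 and n are treated apart: the maps of D change shape at the
    ends, K has a different last map, and the correction of the inclusion enters. *)
Lemma o_in_mid i : (1 < i)%N -> (i.+1 < n)%N -> o_in0 i.+1 * d i = xf i * o_in0 i.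
Proof.
move=> i1 i_n; rewrite d_eq ?oxf; try lia.
have c1 := dP n A B C i; have c2 := dP n A B C i.+1.
have c3 := eP n B C i; have c4 := eP n B C i.+1.
have c5 := kP n3 A B (i := i.+1) ltac:(lia); have c6 := kP n3 A B (i := i.+2) ltac:(lia).
have c7 := oxP (i := i) ltac:(lia); have c8 := oxP (i := i.+1) ltac:(lia).
have [t1 _] := oiA_hom (i := i) ltac:(lia); have [t2 _] := oiA_hom (i := i.+1) ltac:(lia).
have [t3 _] := oiB_hom (i := i) ltac:(lia); have [t4 _] := oiB_hom (i := i.+1) ltac:(lia).
have [t5 _] := oiC_hom i; have [t6 _] := oiC_hom i.+1.
have t7 := da_hom (i := i) ltac:(lia); have t8 := dphi_hom (i := i) ltac:(lia).
have t9 := db_hom (i := i) ltac:(lia); have t10 := dc_hom (i := i) ltac:(lia).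
have t11 := opB_hom' (i := i) ltac:(lia).
have t13 := m_hom (i := i.+1) ltac:(lia).
have t14 := kphi_hom n3 am (i := i.+1) ltac:(lia).
have t15 := kb_hom n3 HN NB (i := i.+1) ltac:(lia).
have t16 := ka_hom n3 HN NA (i := i.+1) ltac:(lia).
have e1 : oiA i.+1 * da n f i = da n f i.
  rewrite /oiA /da; case: ifP => i_n'; last by rewrite mulr0.
  by apply: id_mul; apply: (N_seq HN NA).1; lia.
have e2 : ka i.+1 * oiA i = da n f i.
  rewrite /oiA i_n /ka /da; case: ifP => i_n'; last by rewrite mul0r.
  by apply: mul_id; apply: (N_seq HN NA).1; lia.
have e3 : oiB i.+1 * db n g i = db n g i.
  rewrite /oiB /db; case: ifP => i_n'; last by rewrite mulr0.
  by apply: id_mul; apply: (N_seq HN NB).1; lia.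
have e4 : kb i.+1 * oiB i = db n g i.
  rewrite /oiB /db /kb; ifs; apply: mul_id; apply: (N_seq HN NB).1; lia.
have e5 : oiB i.+1 * dphi n a i = a i.+2 * oiA i.
  have [ah _ _] := am; have H := ah i.+2 ltac:(lia).
  by rewrite /oiB /dphi /oiA; ifs; rewrite (id_mul H) (mul_id H).
have e6 : h i * oiC i = dc h i.
  rewrite /oiC /dc; case: ifP => _; last by rewrite mulr0.
  by apply: mul_id; apply: (N_seq HN NC).1; lia.
have e7 : oiC i.+1 = lid (C i.+1) by rewrite /oiC; ifs.
have e8 : oiB i = lid (kV i.+1).
  by rewrite /oiB (kV_gt n3) ?ifT //; lia.
have e9 : lid (lo (dC C i.+1)) = lid (C i.+1) by rewrite loC //; lia.
have e10 : lid (lo (dB n B i)) = lid (kV i.+1) by rewrite loB ?(kV_gt n3) //; lia.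
rewrite /o_in0 /kf i_n; have -> : (i.+1 == n) = false by lia.
have -> : (i == n) = false by lia.
rewrite /opB in t11 *; rewrite /sgn /=; case: (odd i) => /=;
clear -c1 c2 c3 c4 c5 c6 c7 c8 t1 t2 t3 t4 t5 t6 t7 t8 t9 t10 t11 t13 t14 t15 t16 e1 e2 e3 e4 e5 e6 e7 e8 e9 e10; nct.
Qed.

Lemma o_in_pen i : i.+1 = n -> o_in0 i.+1 * d i = xf i * o_in0 i.
Proof.
move=> iE; rewrite d_eq ?oxf; try lia.
have c1 := dP n A B C i; have c2 := dP n A B C i.+1.
have c3 := eP n B C i; have c4 := eP n B C i.+1.
have c5 := kP n3 A B (i := i.+1) ltac:(lia); have c6 := kP n3 A B (i := i.+2) ltac:(lia).
have c7 := oxP (i := i) ltac:(lia); have c8 := oxP (i := i.+1) ltac:(lia).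
have [t3 _] := oiB_hom (i := i) ltac:(lia).
have [t5 _] := oiC_hom i; have [t6 _] := oiC_hom i.+1.
have t10 := dc_hom (i := i) ltac:(lia).
have t11 := opB_hom' (i := i) ltac:(lia).
have t13 := m_hom (i := i.+1) ltac:(lia).
have t14 := kn_hom' iE.
have t15 := (N_seq HN NC).1 i.+1 ltac:(lia).
have [e1 e2] := d_pen0 iE.
have [[e3 e4 e5 e6] _] := d_last0 iE.
have e7 : h i * oiC i = dc h i.
  rewrite /oiC /dc; case: ifP => _; last by rewrite mulr0.
  by apply: mul_id; apply: (N_seq HN NC).1; lia.
have e8 : oiC i.+1 = lid (C i.+1) by rewrite /oiC; ifs.
have e9 : oiB i = lid (kV i.+1) by rewrite /oiB (kV_gt n3) ?ifT //; lia.
have e10 : lid (lo (dC C i.+1)) = lid (C i.+1) by rewrite loC //; lia.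
have e11 : lid (lo (dB n B i)) = lid (kV i.+1) by rewrite loB ?(kV_gt n3) //; lia.
have e12 : h i.+1 * m i.+1 = sg (f 1%N) * g i.+1 * kq2 i.+1 by rewrite iE hm_last.
have e13 : h i.+1 * dc h i = 0.
  rewrite /dc; case: ifP => _; last by rewrite mulr0.
  by have := N_comp0 n3 HN NC (i := i) ltac:(lia); rewrite extf_le //; lia.
have e14 : kj1 i.+1 = 0 by rewrite iE kj1_n.
rewrite /o_in0 /kf; have -> : (i.+1 < n)%N = false by lia.
have -> : (i.+1 == n) = true by lia.
have -> : (i == n) = false by lia.
rewrite /opB in t11 *.
have t14' := mul_id t14; have t14'' := id_mul t14.
rewrite -mulrA in t14'.
clear -c1 c2 c3 c4 c5 c6 c7 c8 t3 t5 t6 t10 t11 t13 t14' t14'' t15 e1 e2 e3 e4 e5 e6 e7 e8 e9 e10 e11 e12 e13 e14; nct.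
Qed.

Lemma o_in_first : o_in0 2%N * d 1%N = xf 1%N * o_in1.
Proof.
rewrite oc1 oxf; last by lia.
have c2 := dP n A B C 2; have c4 := eP n B C 2.
have c5 := kP n3 A B (i := 2%N) ltac:(lia); have c6 := kP n3 A B (i := 3%N) ltac:(lia).
have c7 := oxP (i := 1%N) ltac:(lia); have c8 := oxP (i := 2%N) ltac:(lia).
have [t2 _] := oiA_hom (i := 2%N) ltac:(lia).
have [t4 _] := oiB_hom (i := 2%N) ltac:(lia).
have t7 := da_hom (i := 1%N) ltac:(lia); have t8 := dphi_hom (i := 1%N) ltac:(lia).
have t14 := kphi_hom n3 am (i := 2%N) ltac:(lia).
have t16 := ka_hom n3 HN NA (i := 2%N) ltac:(lia).
have e1 : oiA 2%N * da n f 1%N = da n f 1%N.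
  rewrite /oiA /da; case: ifP => i_n'; last by rewrite mulr0.
  by apply: id_mul; apply: (N_seq HN NA).1; lia.
have e2 : ka 2%N = da n f 1%N by [].
have e3 : oiB 2%N = lid (kV 3%N) by rewrite /oiB (kV_gt n3) ?ifT //; lia.
have e4 : dphi n a 1%N = a 3%N by rewrite /dphi; ifs.
have e5 : lid (lo (dB n B 2)) = lid (kV 3%N) by rewrite loB ?(kV_gt n3) //; lia.
have e6 := m2.
have e7 : oiC 2%N = 0 by [].
have e8 : lo (dA n A 1) = kU 2%N by rewrite loA ?kU_lt //; lia.
rewrite e8 in t7 t8.
rewrite /o_in0 /o_in1 /kf; ifs; rewrite /sgn /=.
clear -c2 c4 c5 c6 c7 c8 t2 t4 t7 t8 t14 t16 e1 e2 e3 e4 e5 e6 e7; nct.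
Qed.

Lemma o_in_last : sg o_in1 * d n = xf n * o_in0 n.
Proof.
have -> : d n = sg (f 2%N) * h n by rewrite /LDf; ifs.
have En : extf n kf n.+1 = sg (kf 1%N) by rewrite /extf ltnn.
have [mh mc mn] := mm.
have e1 : m n.+1 = kq1 n.+1 by rewrite mn m1 kq1_last.
have c5 := kP n3 A B (i := n.+1) ltac:(lia); have c6 := isbp_sg (kP n3 A B (i := 2%N) ltac:(lia)).
have c7 := oxP (i := n) ltac:(lia); have c8 := oxP_last.
have [[e3 e4 e5 e6] [e7 e8 e9 e10 _]] := d_last0 (erefl n).
have e11 : oiC n = lid (C n) by rewrite /oiC; ifs.
have e12 : sg (a 2%N) * h n = 0.
  by have := N_comp0 n3 HN NC (i := n) ltac:(lia); rewrite /extf ltnn a2.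
have e13 : sg (ka 1%N) = sg (f 2%N) by rewrite /ka; ifs.
have t1 := (N_seq HN NC).1 n ltac:(lia).
rewrite (N_seq HN NC).2 CA -(kU_last n3) in t1.
have t2 := hom_sg ((N_seq HN NA).1 2%N ltac:(lia)).
rewrite -(kU_last n3) -(kU_lt A (n := n)) in t2; last by lia.
rewrite /o_in0 /o_in1 /lconef En /kf; ifs.
rewrite !(sgN, sgD, sgM) -(kq1_last n3 A B).
have e15 : sg (kq2 1%N) = 0 by rewrite kq2_1 // sg0.
have -> : sg (xj1 1%N) = xj1 n.+1 by rewrite J1_last //; lia.
have e14 : C n.+1 = kU n.+1 by rewrite (kU_last n3) (N_seq HN NC).2 CA.
rewrite e14 in c8.
clear -c5 c6 c7 c8 t1 t2 e1 e3 e4 e5 e6 e7 e8 e9 e10 e11 e12 e13 e15; nct.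
Qed.

Lemma o_pr_mid i : (1 < i)%N -> (i.+1 < n)%N -> o_pr0 i.+1 * xf i = d i * o_pr0 i.
Proof.
move=> i1 i_n; rewrite d_eq ?oxf; try lia.
have c1 := dP n A B C i; have c2 := dP n A B C i.+1.
have c3 := eP n B C i; have c4 := eP n B C i.+1.
have c5 := kP n3 A B (i := i.+1) ltac:(lia); have c6 := kP n3 A B (i := i.+2) ltac:(lia).
have c7 := oxP (i := i) ltac:(lia); have c8 := oxP (i := i.+1) ltac:(lia).
have [_ t2] := oiA_hom (i := i.+1) ltac:(lia).
have t7 := da_hom (i := i) ltac:(lia).
have t10 := dc_hom (i := i) ltac:(lia).
have t13 := m_hom (i := i.+1) ltac:(lia).
have t14 := kphi_hom n3 am (i := i.+1) ltac:(lia).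
have t15 := kb_hom n3 HN NB (i := i.+1) ltac:(lia).
have EA : lo (dA n A i) = kU i.+1 by rewrite loA ?kU_lt //; lia.
have EB : lo (dB n B i) = kV i.+1 by rewrite loB ?(kV_gt n3) //; lia.
have EB' : lo (dB n B i.+1) = kV i.+2 by rewrite loB ?(kV_gt n3) //; lia.
have EC' : lo (dC C i.+1) = C i.+1 by rewrite loC //; lia.
rewrite EA in c1 t7; rewrite EB in c3; rewrite EB' EC' in c4; rewrite EC' in t10.
have e1 : oiA i.+1 * da n f i = da n f i.
  rewrite /oiA /da; case: ifP => i_n'; last by rewrite mulr0.
  by apply: id_mul; apply: (N_seq HN NA).1; lia.
have e2 : ka i.+1 = da n f i by [].
have e3 : oiA i = lid (kU i.+1) by rewrite /oiA i_n kU_lt.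
have e4 : dphi n a i = a i.+2 by rewrite /dphi ifT //; lia.
have e5 : db n g i = kb i.+1 by rewrite /db /kb; ifs.
have e6 : oiB i = lid (kV i.+1) by rewrite /oiB (kV_gt n3) ?ifT //; lia.
have e7 : oiB i.+1 = lid (kV i.+2) by rewrite /oiB (kV_gt n3) ?ifT //; lia.
have e8 : oiC i.+1 = lid (C i.+1) by rewrite /oiC; ifs.
rewrite /o_pr0 /kf /opB i_n; have -> : (i.+1 == 2%N) = false by lia.
have [iE|i2] := eqVneq i 2%N.
  have e9 : oiC i = 0 by rewrite iE.
  have e10 : kb i.+1 * g i = 0.
    have := N_comp0 n3 HN NB (i := i) ltac:(lia); rewrite extf_le; last by lia.
    by rewrite /kb; ifs.
  (* The second square of [m], restricted to the summand B_2 of K_2, where [m 2] is the identity,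
     says psi_1 beta_2 = gamma_2. *)
  have e11 : m i.+1 * kj2 i.+1 * g i = h i.
    have [_ mc _] := mm.
    have E := mc i ltac:(lia); rewrite {4}iE m2 -iE in E.
    have Ebi : kb i = g i by rewrite /kb ifF //; lia.
    have c9 := kP n3 A B (i := i) ltac:(lia).
    have t1 := (N_seq HN NB).1 i ltac:(lia).
    have t2' := (N_seq HN NC).1 i ltac:(lia).
    have t3 := kb_hom n3 HN NB (i := i) ltac:(lia).
    have EV : kV i = C i by rewrite (kV_gt n3) ?iE ?CB //; lia.
    have H : m i.+1 * kf i * kj2 i = h i.
      by rewrite E; rewrite EV in c9; clear -c9 t2'; nct.
    rewrite -[RHS]H /kf; have -> : (i < n)%N by lia.
    rewrite Ebi in t3 *; clear -c9 c5 t3 t13; nct.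
  have t16 := (N_seq HN NB).1 i ltac:(lia).
  rewrite -(kV_gt n3 B (i := i.+1)) in t16; last by lia.
  rewrite {1}iE -CB -{1}iE in t16.
  have t17 := (N_seq HN NC).1 i ltac:(lia).
  rewrite /sgn /=; case: (odd i) => /=;
  clear -c1 c2 c3 c4 c5 c6 c7 c8 t2 t7 t10 t13 t14 t15 t16 t17 e1 e2 e3 e4 e5 e6 e7 e8 e9 e10 e11; nct.
have EC : lo (dC C i) = C i by rewrite loC //; lia.
rewrite EC in c3 t10.
have e9 : oiC i = lid (C i) by rewrite /oiC ifT //; lia.
have e10 : dc h i = h i by rewrite /dc ifT //; lia.
have t17 := (N_seq HN NC).1 i ltac:(lia).
rewrite /sgn /=; case: (odd i) => /=;
clear -c1 c2 c3 c4 c5 c6 c7 c8 t2 t7 t10 t13 t14 t15 t17 e1 e2 e3 e4 e5 e6 e7 e8 e9 e10; nct.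
Qed.

Lemma o_pr_pen i : i.+1 = n -> o_pr0 i.+1 * xf i = d i * o_pr0 i.
Proof.
move=> iE; rewrite d_eq ?oxf; try lia.
have c1 := dP n A B C i; have c2 := dP n A B C i.+1.
have c3 := eP n B C i; have c4 := eP n B C i.+1.
have c5 := kP n3 A B (i := i.+1) ltac:(lia).
have c7 := oxP (i := i) ltac:(lia); have c8 := oxP (i := i.+1) ltac:(lia).
have t10 := dc_hom (i := i) ltac:(lia).
have t13 := m_hom (i := i.+1) ltac:(lia).
have EB : lo (dB n B i) = kV i.+1 by rewrite loB ?(kV_gt n3) //; lia.
have EC' : lo (dC C i.+1) = C i.+1 by rewrite loC //; lia.
rewrite EB in c3; rewrite EC' in c4; rewrite EC' in t10.
have [[e1 e2 e3 e4] _] := d_last0 iE.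
have [e5 e5'] := d_pen0 iE.
have e6 : oiB i = lid (kV i.+1) by rewrite /oiB (kV_gt n3) ?ifT //; lia.
have e7 : kj1 i.+1 = 0 by rewrite iE kj1_n.
have e12 : sgn i.+1 (m i.+1 * kj1 i.+1 * oiA i) = 0.
  by rewrite e7 mulr0 mul0r /sgn oppr0 if_same.
have e8 : oiC i.+1 = lid (C i.+1) by rewrite /oiC; ifs.
rewrite /o_pr0 /opB; have -> : (i.+1 == 2%N) = false by lia.
have t17 := (N_seq HN NC).1 i ltac:(lia).
have [i2|i2] := eqVneq i 2%N.
  have e9 : oiC i = 0 by rewrite i2.
  have e11 : m i.+1 * kj2 i.+1 * g i = h i.
    have [_ mc _] := mm.
    have E := mc i ltac:(lia); rewrite {4}i2 m2 -i2 in E.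
    have Ebi : kb i = g i by rewrite /kb ifF //; lia.
    have c9 := kP n3 A B (i := i) ltac:(lia).
    have t3 := kb_hom n3 HN NB (i := i) ltac:(lia).
    have EV : kV i = C i by rewrite (kV_gt n3) ?i2 ?CB //; lia.
    have H : m i.+1 * kf i * kj2 i = h i.
      by rewrite E; rewrite EV in c9; clear -c9 t17; nct.
    rewrite -[RHS]H /kf; have -> : (i < n)%N by lia.
    rewrite Ebi in t3 *; clear -c9 c5 t3 t13; nct.
  have t16 := (N_seq HN NB).1 i ltac:(lia).
  rewrite -(kV_gt n3 B (i := i.+1)) in t16; last by lia.
  rewrite {1}i2 -CB -{1}i2 in t16.
  clear -c1 c2 c3 c4 c5 c7 c8 t10 t13 t16 t17 e1 e2 e3 e4 e5 e5' e6 e7 e8 e9 e11 e12; nct.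
have EC : lo (dC C i) = C i by rewrite loC //; lia.
rewrite EC in c3 t10.
have e9 : oiC i = lid (C i) by rewrite /oiC ifT //; lia.
have e10 : dc h i = h i by rewrite /dc ifT //; lia.
clear -c1 c2 c3 c4 c5 c7 c8 t10 t13 t17 e1 e2 e3 e4 e5 e5' e6 e7 e8 e9 e10 e12; nct.
Qed.

Lemma o_pr_first : o_pr0 2%N * xf 1%N = d 1%N * o_pr1.
Proof.
rewrite oc1 oxf; last by lia.
have c2 := dP n A B C 2; have c4 := eP n B C 2.
have c5 := kP n3 A B (i := 2%N) ltac:(lia); have c6 := kP n3 A B (i := 3%N) ltac:(lia).
have c7 := oxP (i := 1%N) ltac:(lia); have c8 := oxP (i := 2%N) ltac:(lia).
have [_ t2] := oiA_hom (i := 2%N) ltac:(lia).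
have t7 := da_hom (i := 1%N) ltac:(lia).
have EA : lo (dA n A 1) = kU 2%N by rewrite loA ?kU_lt //; lia.
have EB : lo (dB n B 2) = kV 3%N by rewrite loB ?(kV_gt n3) //; lia.
rewrite EA in t7; rewrite EB in c4.
have t14 := kphi_hom n3 am (i := 2%N) ltac:(lia).
have t15 := kb_hom n3 HN NB (i := 2%N) ltac:(lia).
have e1 : oiA 2%N * da n f 1%N = da n f 1%N.
  rewrite /oiA /da; case: ifP => i_n'; last by rewrite mulr0.
  by apply: id_mul; apply: (N_seq HN NA).1; lia.
have e2 : ka 2%N = da n f 1%N by [].
have e3 : oiB 2%N = lid (kV 3%N) by rewrite /oiB (kV_gt n3) ?ifT //; lia.
have e4 : dphi n a 1%N = a 3%N by rewrite /dphi; ifs.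
have e6 := m2.
have e7 : oiC 2%N = 0 by [].
have e8 : kb 2%N = g 2%N by [].
have [_ ac _] := am.
have e9 : a 3%N * f 2%N = g 2%N * h 1%N by rewrite ac ?a2 //; lia.
have e10 : da n f 1%N * f 2%N = 0.
  rewrite /da; case: ifP => i_n; last by rewrite mul0r.
  by have := N_comp0 n3 HN NA (i := 2%N) ltac:(lia); rewrite extf_le //; lia.
have t16 := (N_seq HN NA).1 2%N ltac:(lia).
have t17 := (N_seq HN NC).1 1%N ltac:(lia).
have EV : kV 2%N = C 2%N by rewrite (kV_gt n3) ?CB //; lia.
have EU : A 3%N = kU 2%N by rewrite kU_lt //; lia.
rewrite EU -CA in t16; rewrite EV in c5 t15; rewrite e8 in t15.
rewrite /o_pr0 /o_pr1 /kf; ifs; rewrite /sgn /=.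
clear -c2 c4 c5 c6 c7 c8 t2 t7 t14 t15 t16 t17 e1 e2 e3 e4 e6 e7 e8 e9 e10; nct.
Qed.

Lemma o_pr_last : sg o_pr1 * xf n = d n * o_pr0 n.
Proof.
have -> : d n = sg (f 2%N) * h n by rewrite /LDf; ifs.
have En : extf n kf n.+1 = sg (kf 1%N) by rewrite /extf ltnn.
have [mh mc mn] := mm.
have e1 : m n.+1 = kq1 n.+1 by rewrite mn m1 kq1_last.
have c5 := kP n3 A B (i := n.+1) ltac:(lia); have c6 := isbp_sg (kP n3 A B (i := 2%N) ltac:(lia)).
have c7 := oxP (i := n) ltac:(lia); have c8 := oxP_last.
have [[e3 e4 e5 e6] [e7 e8 e9 e10 _]] := d_last0 (erefl n).
have e11 : oiC n = lid (C n) by rewrite /oiC; ifs.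
have e13 : sg (ka 1%N) = sg (f 2%N) by rewrite /ka; ifs.
have t1 := (N_seq HN NC).1 n ltac:(lia).
have t2 := hom_sg ((N_seq HN NA).1 2%N ltac:(lia)).
rewrite -(kU_last n3) -(kU_lt A (n := n)) in t2; last by lia.
rewrite /o_pr0 /o_pr1 /lconef En /kf; ifs.
rewrite !(sgN, sgD, sgM) -(kq1_last n3 A B).
have e15 : sg (kq2 1%N) = 0 by rewrite kq2_1 // sg0.
have -> : sg (xq1 1%N) = xq1 n.+1 by rewrite Q1_last //; lia.
have -> : sg (xq2 1%N) = xq2 n.+1 by rewrite Q2_last //; lia.
have e14 : C n.+1 = kU n.+1 by rewrite (kU_last n3) (N_seq HN NC).2 CA.
rewrite e14 in c8 t1.
clear -c5 c6 c7 c8 t1 t2 e1 e3 e4 e5 e6 e7 e8 e9 e10 e11 e13 e15; nct.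
Qed.

Lemma o_pr_in i : (1 < i <= n)%N -> o_pr0 i * o_in0 i = lid (dO n A B C i).
Proof.
move=> i_n.
have c1 := dP n A B C i; have c3 := eP n B C i.
have c5 := kP n3 A B (i := i.+1) ltac:(lia).
have c7 := oxP (i := i) ltac:(lia).
have [iE|i1] := eqVneq i n.
  have [[e3 e4 e5 e6] _] := d_last0 iE.
  have EC : lo (dC C i) = C i by rewrite loC //; lia.
  rewrite EC in c3.
  have e1 : oiC i = lid (C i) by rewrite /oiC ifT //; lia.
  rewrite /o_pr0 /o_in0; have -> : (i == n) = true by apply/eqP.
  have -> : (i == 2%N) = false by lia.
  clear -c1 c3 c5 c7 e1 e3 e4 e5 e6; nct.
have EB : lo (dB n B i) = kV i.+1 by rewrite loB ?(kV_gt n3) //; lia.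
rewrite EB in c3.
have e1 : oiB i = lid (kV i.+1) by rewrite /oiB (kV_gt n3) ?ifT //; lia.
have e2 : dj1 i * sgn i.+1 (oiA i) * lid (kU i.+1) * sgn i.+1 (oiA i) * dq1 i = dj1 i * dq1 i.
  have [iE|i2] := eqVneq i.+1 n; first by have [-> ->] := d_pen0 iE; rewrite !mul0r.
  have EA : lo (dA n A i) = kU i.+1 by rewrite loA ?kU_lt //; lia.
  rewrite EA in c1.
  have e : oiA i = lid (kU i.+1) by rewrite /oiA kU_lt ?ifT //; lia.
  by rewrite /sgn; case: odd; clear -c1 e; nct.
have e3 : (if i == 2%N then dj2 i * ej1 i * g i * xq2 i else 0) * xj2 i * oiC i = 0.
  have [->|_] := eqVneq i 2%N; last by rewrite !mul0r.
  by rewrite mulr0.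
have e4 : ej2 i * oiC i * lid (C i) * oiC i * eq2 i = ej2 i * eq2 i.
  have [ic|ic] := ltnP 2 i.
    have EC : lo (dC C i) = C i by rewrite loC //; lia.
    rewrite EC in c3; have e : oiC i = lid (C i) by rewrite /oiC ifT //; lia.
    clear -c3 e; nct.
  have -> : ej2 i = 0.
    have [_ H _ _ _ _ _ _ _] := c3; apply: hom_from_0 H.
    by rewrite /dC ifF ?lid_z //; lia.
  by rewrite !mul0r.
rewrite /o_pr0 /o_in0; have -> : (i == n) = false by lia.
(* The correction in degree 2 is isolated as [s]. It meets only C_2, on which the inclusion is 0, so
   both products with [s] vanish. *)
have -> : forall p q r s t u : lring L, (p + q + r + s) * (t + u + xj2 i * oiC i * eq2 i * dq2 i + 0)
   = (p + q + r) * (t + u + xj2 i * oiC i * eq2 i * dq2 i)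
     + s * (t + u) + s * xj2 i * oiC i * eq2 i * dq2 i by move=> *; nc.
rewrite e3 !mul0r addr0.
have e5 : (if i == 2%N then dj2 i * ej1 i * g i * xq2 i else 0) * xj1 i = 0.
  by case: ifP => _; rewrite ?mul0r // -mulrA (isbp_21 c7) mulr0.
have [_ t1] := oiA_hom (i := i) ltac:(lia).
have t2 := hom_sgn i.+1 t1.
have e6 : dj1 i * sgn i.+1 (oiA i) * sgn i.+1 (oiA i) * dq1 i = dj1 i * dq1 i.
  by rewrite -e2 -(mulrA (dj1 i) _ (lid _)) (mul_id t2).
have [_ t3] := oiC_hom i.
have e7 : ej2 i * oiC i * oiC i * eq2 i = ej2 i * eq2 i.
  by rewrite -e4 -(mulrA (ej2 i) _ (lid _)) (mul_id t3).
clear e2 e3 e4 t1.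
clear -c1 c3 c5 c7 e1 t2 t3 e5 e6 e7; nct.
Qed.

Lemma d_lseq : lseq n D d.
Proof.
split=> [i i_n|]; last first.
  by rewrite /LDX; ifs.
have [->|i1] := eqVneq i 1%N.
  have c2 := dP n A B C 2; have c4 := eP n B C 2.
  have t7 := da_hom (i := 1%N) ltac:(lia); have t8 := dphi_hom (i := 1%N) ltac:(lia).
  have EA : lo (dA n A 1) = A 3%N by rewrite loA.
  rewrite EA in t7 t8; rewrite (D_eq (i := 2%N)) ?oc1; last by lia.
  by rewrite /LDX /=; ht.
have [i_lt|i_ge] := ltnP i n.
  have c1 := dP n A B C i; have c2 := dP n A B C i.+1.
  have c3 := eP n B C i; have c4 := eP n B C i.+1.
  have t7 := da_hom (i := i) ltac:(lia); have t8 := dphi_hom (i := i) ltac:(lia).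
  have t9 := db_hom (i := i) ltac:(lia); have t10 := dc_hom (i := i) ltac:(lia).
  have t11 := opB_hom' (i := i) ltac:(lia); have t12 := dpA_hom (i := i) ltac:(lia).
  rewrite !D_eq; try lia; rewrite /LDf ifF; last by lia.
  by rewrite i_lt; ht.
have iE : i = n by lia.
subst i; have [_ [_ _ _ _ ->]] := d_last0 (erefl n).
have t1 := (N_seq HN NC).1 n ltac:(lia).
have t2 := hom_sg ((N_seq HN NA).1 2%N ltac:(lia)).
rewrite (N_seq HN NC).2 CA in t1.
by rewrite /LDX /LDf; ifs; ht.
Qed.

Lemma N_d : N xX xf -> N D d.
Proof.
move=> NXX; apply: (N_retract HN d_lseq NXX (a := o_in) (b := o_pr)).
- have in1h : hom (D 1%N) (xX 1%N) o_in1.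
    have c5 := kP n3 A B (i := 2%N) ltac:(lia); have c7 := oxP (i := 1%N) ltac:(lia).
    rewrite kU_lt in c5; last by lia.
    by rewrite /o_in1 /LDX /=; ht.
  split=> [i i_n|i i_n|].
  + rewrite /o_in; have [->//|i1] := eqVneq i 1%N.
    case: eqP => [->|i2].
      rewrite d_lseq.2 /lconeX bpX_last; last by lia.
      exact: hom_sg.
    have c1 := dP n A B C i; have c3 := eP n B C i.
    have c5 := kP n3 A B (i := i.+1) ltac:(lia); have c7 := oxP (i := i) ltac:(lia).
    have [t1 _] := oiA_hom (i := i) ltac:(lia); have [t3 _] := oiB_hom (i := i) ltac:(lia).
    have [t5 _] := oiC_hom i.
    rewrite D_eq; last by lia.
    rewrite /o_in0; case: eqP => [iE|_]; last by ht.
    have t := (N_seq HN NC).1 i ltac:(lia).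
    have EC : lo (dC C i) = C i by rewrite loC //; lia.
    have EU : C i.+1 = kU i.+1 by rewrite iE (kU_last n3) (N_seq HN NC).2 CA.
    by rewrite -EC EU in t; ht.
  + have [->|i1] := eqVneq i 1%N.
      by rewrite /o_in /=; ifs; rewrite o_in_first.
    rewrite {2}/o_in; ifs.
    have [i_lt|i_ge] := ltnP i n.
      rewrite /o_in; ifs; have [E|E] := eqVneq i.+1 n; first exact: o_in_pen.
      by apply: o_in_mid; lia.
    have -> : i = n by lia.
    by rewrite /o_in; ifs; rewrite o_in_last.
  + by rewrite /o_in; ifs.
- have pr1h : hom (xX 1%N) (D 1%N) o_pr1.
    have c5 := kP n3 A B (i := 2%N) ltac:(lia); have c7 := oxP (i := 1%N) ltac:(lia).
    rewrite kU_lt in c5; last by lia.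
    have t := (N_seq HN NA).1 2%N ltac:(lia); rewrite -CA in t.
    by rewrite /o_pr1 /LDX /=; ht.
  split=> [i i_n|i i_n|].
  + rewrite /o_pr; have [->//|i1] := eqVneq i 1%N.
    case: eqP => [->|i2].
      rewrite d_lseq.2 /lconeX bpX_last; last by lia.
      exact: hom_sg.
    have c1 := dP n A B C i; have c3 := eP n B C i.
    have c5 := kP n3 A B (i := i.+1) ltac:(lia); have c7 := oxP (i := i) ltac:(lia).
    have [_ t1] := oiA_hom (i := i) ltac:(lia); have [_ t3] := oiB_hom (i := i) ltac:(lia).
    have [_ t5] := oiC_hom i.
    rewrite D_eq; last by lia.
    rewrite /o_pr0; case: eqP => [iE|_]; last by ht.
    have t := (N_seq HN NB).1 i ltac:(lia).
    have EB : lo (dB n B i) = B i.+1 by rewrite loB //; lia.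
    have EU : B i = C i by rewrite iE CB.
    by rewrite -EB EU in t; ht.
  + have [->|i1] := eqVneq i 1%N.
      by rewrite /o_pr /=; ifs; rewrite o_pr_first.
    rewrite {2}/o_pr; ifs.
    have [i_lt|i_ge] := ltnP i n.
      rewrite /o_pr; ifs; have [E|E] := eqVneq i.+1 n; first exact: o_pr_pen.
      by apply: o_pr_mid; lia.
    have -> : i = n by lia.
    by rewrite /o_pr; ifs; rewrite o_pr_last.
  + by rewrite /o_pr; ifs.
- move=> i i_n; have [->|i1] := eqVneq i 1%N; last first.
    by rewrite /o_in /o_pr; ifs; rewrite D_eq ?o_pr_in //; lia.
  have c5 := kP n3 A B (i := 2%N) ltac:(lia); have c7 := oxP (i := 1%N) ltac:(lia).
  rewrite kU_lt in c5; last by lia.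
  have t := (N_seq HN NA).1 2%N ltac:(lia).
  rewrite /o_in /o_pr /LDX /= /o_in1 /o_pr1; clear -c5 c7 t; nct.
Qed.

End ConeToOctahedron.

Lemma LN4_LN4star (L : lincat) (n : nat) (N : (nat -> lob L) -> (nat -> lring L) -> Prop) :
  (3 <= n)%N -> lang n N -> LN4 n N -> LN4star n N.
Proof.
move=> n3 HN H4 A f B g C h NA NB NC BA CA CB hf.
have [Ah An] := N_seq HN NA; have [Bh Bn] := N_seq HN NB; have [Ch Cn] := N_seq HN NC.
have h1 := Ch 1%N ltac:(lia); rewrite CA CB in h1.
have [|||a [a1 a2 am Nc]] := H4 A f B g (lid (A 1%N)) (h 1%N) NA NB.
- by rewrite BA; ht.
- by [].
- by rewrite hf -BA (mul_id (Bh 1%N _)) //; lia.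
have NK := N_k n3 HN NA NB BA am a1 Nc.
have c1 := kP n3 A B (i := 1%N) ltac:(lia); have c2 := kP n3 A B (i := 2%N) ltac:(lia).
(* The first map of K is (- alpha_2, phi_2), and its B_2-part is phi_2 = [h 1]; hence the pair of
   projections commutes with the first maps. *)
have [|||m [m1 m2 mm Nx]] := H4 _ _ _ _ (kq1 n A B 1%N) (kq2 n A B 2%N) NK NC.
- by rewrite CA -(kU_lt A (n := n)) //; [case: c1|lia].
- by rewrite CB -(kV_gt n3 B (i := 2%N)); [case: c2|lia].
- have t1 := kphi_hom n3 am (i := 1%N) ltac:(lia).
  have e1 : kb g 1%N = 0 by [].
  rewrite /kf ifT; last by lia.
  rewrite -a2; clear -c1 c2 t1 e1; nct.
exists a, (opA n A B m), (opB n A B m); split=> //.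
- split=> i i_n.
    exact: (opB_hom n3 mm).
  exact: (opA_hom n3 mm).
- split; last by apply: (N_d n3 HN NA NB NC BA CA CB am).
  have E := hm_last n3 HN NA NB BA mm m1.
  have c := kP n3 A B (i := n) ltac:(lia); have t := kn_hom n3 HN NA NB BA.
  rewrite /opB; have -> : n.-1.+1 = n by lia.
  have t14 := mul_id t; rewrite -mulrA in t14.
  clear -E c t14; nct.
Qed.

(** * From (N4* ) to (N4) *)

Section Assemble.
Variables (L : lincat) (n : nat) (n3 : (3 <= n)%N).
Variables (N : (nat -> lob L) -> (nat -> lring L) -> Prop) (HN : lang n N).
Variables (A B E Q : nat -> lob L) (f g e q : nat -> lring L) (r s : lring L).
Local Notation cX := (lconeX n A B).
Local Notation cj1 := (J1 n (coneU n A) B).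
Local Notation cj2 := (J2 n (coneU n A) B).
Local Notation cq1 := (Q1 n (coneU n A) B).
Local Notation cq2 := (Q2 n (coneU n A) B).
Hypotheses (NA : N A f) (NB : N B g) (NE : N E e).
Hypotheses (rh : hom (A 1%N) (B 1%N) r) (sh : hom (A 2%N) (B 2%N) s).
Hypothesis sr : s * f 1%N = g 1%N * r.
Hypotheses (E1 : E 1%N = cX 1%N) (E2 : E 2%N = cX 2%N).
Hypothesis e1 : e 1%N = cj1 2%N * - f 2%N * cq1 1%N + cj2 2%N * s * cq1 1%N
                        + cj2 2%N * g 1%N * cq2 1%N.
Variables (qj1 qq1 : nat -> lring L) (qq2 : lring L).
Hypothesis qj1h : forall i, (0 < i <= n)%N -> hom (A i.+1) (Q i) (qj1 i).
Hypothesis qq1h : forall i, (0 < i <= n)%N -> hom (Q i) (A i.+1) (qq1 i).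
Hypothesis qq2h : hom (Q n) (lso (B 1%N)) qq2.
Hypothesis qqj : forall i, (0 < i <= n)%N -> qq1 i * qj1 i = lid (A i.+1).
Hypothesis qjq : forall i, (1 < i < n)%N -> qj1 i * qq1 i = lid (Q i).
Hypothesis qq2j : qq2 * qj1 n = 0.
Hypothesis qE : forall i, (0 < i < n)%N -> q i = qj1 i.+1 * f i.+1 * qq1 i.
Hypothesis qn : q n = sgn n (cj1 n.+1 * sg (f 1%N) * qq1 n + cj2 n.+1 * qq2).
Variables (x p t : nat -> lring L).
Hypotheses (xm : lmor n E e Q q x) (x1 : x 1%N = lid (E 1%N)).
Hypothesis x2 : x 2%N = - (qj1 2%N * cq1 2%N).
Hypothesis ph : forall k, (2 < k <= n)%N -> hom (E k) (B k) (p k).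
Hypothesis th : forall k, (2 < k < n)%N -> hom (Q k) (B k.+1) (t k).
Hypothesis R1 : - p 3%N * e 2%N * cj2 2%N = g 2%N.
Hypothesis R2 : forall k, (2 < k < n)%N ->
  g k * p k = - p k.+1 * e k + sgn k (t k * x k).
Hypothesis R3 : g n * p n = (sg r * qq1 n + qq2) * x n.
Hypothesis R4 : forall k, (2 < k)%N -> (k.+1 < n)%N -> - t k.+1 * q k = g k.+1 * t k.
Hypothesis R5 : (3 < n)%N -> g n * t n.-1 = - sgn n ((sg r * qq1 n + qq2) * q n.-1).

(** [p k] and [t k.-1] are to be the parts on E_k and Q_(k-1) of a morphism into [B], and [R1] to
    [R5] the parts of its squares. Since Q_(k-1) contains A_k, [t] yields phi_k for k > 3. The map -
    p_3 e_2 on A_3 + B_2 has B_2-part beta_2 by [R1], and its A_3-part is taken as phi_3. *)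
Definition asm k : lring L :=
  if k == 1%N then r else if k == 2%N then s
  else if k == 3%N then - p 3%N * e 2%N * cj1 2%N
  else if k == n.+1 then sg r else - sgn k (t k.-1 * qj1 k.-1).

Lemma asm_cP i : (0 < i <= n.+1)%N ->
  isbp (cX i) (extX n A i.+1) (B i) (cj1 i) (cj2 i) (cq1 i) (cq2 i).
Proof. exact: (coneP n3 A (N_seq HN NB).2). Qed.

Lemma asm_cP' i : (0 < i <= n)%N ->
  isbp (cX i) (A i.+1) (B i) (cj1 i) (cj2 i) (cq1 i) (cq2 i).
Proof.
move=> i_n; have := asm_cP (i := i) ltac:(lia); by rewrite extX_le //; lia.
Qed.

Lemma asm_hom i : (0 < i <= n.+1)%N -> hom (A i) (B i) (asm i).
Proof.
have [Ah An] := N_seq HN NA; have [Bh Bn] := N_seq HN NB; have [Eh En] := N_seq HN NE.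
move=> i_n; rewrite /asm; have [->//|i1] := eqVneq i 1%N.
have [->//|i2] := eqVneq i 2%N; have [->|i3] := eqVneq i 3%N.
  have c := asm_cP' (i := 2%N) ltac:(lia).
  have t1 := ph (k := 3%N) ltac:(lia); have t2 := Eh 2%N ltac:(lia).
  rewrite E2 in t2; ht.
have [->|i4] := eqVneq i n.+1; first by rewrite An Bn; ht.
have t1 := th (k := i.-1) ltac:(lia); have t2 := qj1h (i := i.-1) ltac:(lia).
have iE : i.-1.+1 = i by lia.
rewrite iE in t1 t2; ht.
Qed.

Lemma asm3 : asm 3%N = - p 3%N * e 2%N * cj1 2%N. Proof. by []. Qed.
Lemma asm_gt k : (3 < k <= n)%N -> asm k = - sgn k (t k.-1 * qj1 k.-1).
Proof. by move=> k_n; rewrite /asm; ifs. Qed.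
Lemma asm_last : asm n.+1 = sg r.
Proof. by rewrite /asm; ifs. Qed.

(** The second square is e_2 e_1 = 0 restricted to A_2. The third combines [x 2 = - (qj1 2 * cq1 2)]
    with [R2], or with [R3] if n = 3. The later ones are [R4], and for n > 3 the last is [R5]. *)
Lemma asm_mor : lmor n A f B g asm.
Proof.
have [Ah An] := N_seq HN NA; have [Bh Bn] := N_seq HN NB; have [Eh En] := N_seq HN NE.
have [xh xc xn] := xm.
split=> [i|i i_n|]; [exact: asm_hom| |exact: asm_last].
have c1 := asm_cP' (i := 1%N) ltac:(lia); have c2 := asm_cP' (i := 2%N) ltac:(lia).
have ee : e 2%N * e 1%N = 0.
  by have := N_comp0 n3 HN NE (i := 1%N) ltac:(lia); rewrite extf_le //; lia.
have t0 := Eh 2%N ltac:(lia); have tf := Ah i i_n.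
have xe2 : x 3%N * e 2%N = q 2%N * x 2%N by apply: xc; lia.
have qE2 := qE (i := 2%N) ltac:(lia).
rewrite E2 in t0.
have [iE|i1] := eqVneq i 1%N; first by rewrite iE /asm.
have [iE|i2] := eqVneq i 2%N.
  rewrite iE asm3 {1}/asm /= -R1; rewrite iE in tf.
  have E0 : e 2%N * (cj1 2%N * f 2%N) = e 2%N * (cj2 2%N * s).
    have t1 := Bh 1%N ltac:(lia).
    apply/eqP; rewrite -subr_eq0 -oppr_eq0; apply/eqP.
    transitivity (e 2%N * e 1%N * cj1 1%N); last by rewrite ee mul0r.
    by rewrite e1; clear -c1 c2 tf t0 sh t1; nct.
  by clear -E0 t0 sh c2 tf; nc.
have [iE|i3] := eqVneq i 3%N.
  subst i; rewrite asm3.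
  have R3' := R3; have R2' := @R2 3%N.
  have tq := qj1h (i := 2%N) ltac:(lia); have tq3 := qj1h (i := 3%N) ltac:(lia).
  have qqj2 := qqj (i := 2%N) ltac:(lia).
  have tx := xh 3%N ltac:(lia).
  have [n_gt|n_le] := ltnP 3 n.
    have ee3 : e 3%N * e 2%N = 0.
      by have := N_comp0 n3 HN NE (i := 2%N) ltac:(lia); rewrite extf_le //; lia.
    have R := R2' ltac:(lia); rewrite /sgn /= in R.
    rewrite asm_gt ?/sgn /=; last by lia.
    have tt := th (k := 3%N) ltac:(lia).
    have x2' := x2.
    clear -R ee3 xe2 qE2 x2' c2 tf tq tq3 qqj2 tt; nct.
  have n3E : n = 3%N by lia.
  rewrite -{1}n3E asm_last; rewrite n3E in R3'.
  have qq0 := qq2j; rewrite n3E in qq0.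
  have qqj3 := qqj (i := 3%N) ltac:(lia).
  have x2' := x2; have tr := hom_sg rh; rewrite -An n3E in tr.
  clear -R3' xe2 qE2 x2' c2 tf tq tq3 qqj2 qq0 qqj3 tr; nct.
have tq := qj1h (i := i) ltac:(lia); have tq' := qj1h (i := i.-1) ltac:(lia).
have iE : i.-1.+1 = i by lia.
have qE' := qE (i := i.-1) ltac:(lia); have qqj' := qqj (i := i.-1) ltac:(lia).
have tt := th (k := i.-1) ltac:(lia).
rewrite iE in qE' qqj' tq' tt.
have [i_lt|i_ge] := ltnP i n.
  have R := esym (@R4 i.-1 ltac:(lia) ltac:(lia)); rewrite iE in R.
  have tt' := th (k := i) ltac:(lia).
  rewrite !asm_gt /sgn /=; try lia.
  by case: (odd i) => /=; clear -R qE' qqj' tf tq tq' tt tt'; nct.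
have {}i_ge : i = n by lia.
subst i; rewrite asm_last asm_gt; last by lia.
have R := R5 ltac:(lia).
have qq0 := qq2j; have qqjn := qqj (i := n) ltac:(lia).
have tr := hom_sg rh; rewrite -An in tr.
rewrite mulrN sgn_mulr mulrA R.
by rewrite /sgn; case: (odd n) => /=; clear -qE' qqj' tf tq tq' tt qq0 qqjn tr; nct.
Qed.

(** Above degree 2 the A-part is [x] followed by the projection of Q, and the B-part is [p]. The
    alternating signs are due to the cone having -alpha where Q has alpha. *)
Definition asw k : lring L :=
  if (k <= 2)%N then lid (cX k) else if (k <= n)%N then
    cj1 k * sgn k.+1 (qq1 k * x k) + cj2 k * sgn k (p k)
  else lid (cX k).

Lemma asw_mor : lmor n E e cX (lconef n A f B g asm) asw.
Proof.
have [Ah An] := N_seq HN NA; have [Bh Bn] := N_seq HN NB; have [Eh En] := N_seq HN NE.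
have [xh xc xn] := xm.
split=> [i i_n|i i_n|].
- rewrite /asw; have [i2|i2] := leqP i 2.
    by have [->|->] : i = 1%N \/ i = 2%N by [lia]; rewrite ?E1 ?E2; ht.
  have [i_n'|i_n'] := leqP i n.
    have c := asm_cP' (i := i) ltac:(lia).
    have t1 := ph (k := i) ltac:(lia); have t2 := xh i ltac:(lia).
    have t3 := qq1h (i := i) ltac:(lia); ht.
  have -> : i = n.+1 by lia.
  by rewrite En E1 /lconeX bpX_last; [ht|lia].
- have c1 := asm_cP (i := i) ltac:(lia); have c2 := asm_cP (i := i.+1) ltac:(lia).
  have t1 := extf_hom n3 (N_seq HN NA) (i := i.+1) ltac:(lia).
  have t2 := Bh i i_n; have t3 := Eh i i_n.
  have xci := xc i i_n.
  have [iE|i1] := eqVneq i 1%N.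
    subst i; rewrite /asw /= /lconef {1}/asm /=; rewrite E1 E2 in t3.
    rewrite (id_mul t3) e1 extf_le; last by lia.
    rewrite extf_le in t1; last by lia.
    have t4 := sh; rewrite -(extX_le (n := n) A) in t4; last by lia.
    clear -c1 c2 t1 t2 t4; nct.
  have t4 := asm_hom (i := i.+1) ltac:(lia).
  rewrite -(extX_le (n := n) A) in t4; last by lia.
  have [iE|i2] := eqVneq i 2%N.
    subst i; rewrite /asw ltnn leqnn n3 /lconef asm3.
    rewrite asm3 in t4.
    have t5 := xh 3%N ltac:(lia); have t6 := ph (k := 3%N) ltac:(lia).
    have x2' := x2; have qE2 := qE (i := 2%N) ltac:(lia).
    rewrite extf_le in t1 *; last by lia.
    have t7 := qq1h (i := 3%N) ltac:(lia); have t8 := qj1h (i := 3%N) ltac:(lia).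
    have qqj3 := qqj (i := 3%N) ltac:(lia); have qqj2 := qqj (i := 2%N) ltac:(lia).
    rewrite E2 in t3.
    have tf := Ah 3%N ltac:(lia).
    rewrite -!(extX_le (n := n) A (i := 4%N)) in t7 t8 qqj3 tf; try lia.
    rewrite -!(extX_le (n := n) A (i := 3%N)) in tf qqj2; try lia.
    rewrite -R1 /sgn /=.
    clear -c1 c2 t1 t3 t5 t6 t7 t8 xci qE2 x2' qqj3 qqj2 tf; nct.
  have t5 := ph (k := i) ltac:(lia); have t6 := xh i ltac:(lia).
  have t7 := qq1h (i := i) ltac:(lia).
  rewrite -(extX_le (n := n) A (i := i.+1)) in t7; last by lia.
  have [i_lt|i_ge] := ltnP i n.
    have R := R2 (k := i) ltac:(lia).
    have qEi' := qE (i := i) ltac:(lia).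
    have jq := qjq (i := i) ltac:(lia).
    have qqj' := qqj (i := i.+1) ltac:(lia).
    have t8 := th (k := i) ltac:(lia); have t9 := ph (k := i.+1) ltac:(lia).
    have t10 := qq1h (i := i.+1) ltac:(lia); have t11 := xh i.+1 ltac:(lia).
    have t12 := qj1h (i := i) ltac:(lia); have tf := Ah i.+1 ltac:(lia).
    rewrite -(extX_le (n := n) A (i := i.+2)) in qqj' t10 tf; last by lia.
    rewrite -(extX_le (n := n) A (i := i.+1)) in t12 tf; last by lia.
    rewrite /asw; ifs; rewrite /lconef extf_le; last by lia.
    rewrite asm_gt; last by lia.
    rewrite /sgn /= in R *.
    case: (odd i) R => /= R;
    clear -c1 c2 tf t2 t3 t5 t6 t7 t8 t9 t10 t11 t12 xci R qEi' jq qqj'; nct.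
  have {}i_ge : i = n by lia.
  subst i.
  have -> : asw n.+1 = lid (cX n.+1) by rewrite /asw; ifs.
  have -> : asw n = cj1 n * sgn n.+1 (qq1 n * x n) + cj2 n * sgn n (p n) by rewrite /asw; ifs.
  rewrite xn x1 sg_id -En (id_mul t3) in xci.
  rewrite xci /lconef asm_last.
  have -> : extf n f n.+1 = sg (f 1%N) by rewrite /extf ltnn.
  rewrite /extf ltnn in t1.
  have R := R3; have t8 := hom_sg rh; rewrite -An -Bn -(extX_le (n := n) A) in t8; last by lia.
  have t9 := qq2h; rewrite -Bn in t9.
  have qn' := qn.
  rewrite /sgn /= in qn' *.
  case: (odd n) qn' => /= qn'; clear -c1 c2 t1 t2 t3 t5 t6 t7 t8 t9 R qn'; nct.
- by rewrite /asw; ifs; rewrite /lconeX bpX_last ?sg_id //; lia.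
Qed.

Lemma assemble : exists a, [/\ a 1%N = r, a 2%N = s, lmor n A f B g a
  & N cX (lconef n A f B g a)].
Proof.
exists asm; split=> //; first exact: asm_mor.
apply: (N_weak_iso n3 HN NE (lcone_lseq n3 HN NA NB asm_mor) _ _ _ asw_mor) => //.
- by move=> i; apply: (lcone_cplx n3 HN NA NB asm_mor).
- exact: (lcone_cplxn n3 HN NA NB asm_mor).
- by move=> i T u; apply: (lcone_exact n3 HN NA NB asm_mor).
Qed.

End Assemble.

(** * The octahedron with a split third n-angle *)

Section OctahedronToCone.
Variables (L : lincat) (n : nat) (n3 : (3 <= n)%N).
Variables (N : (nat -> lob L) -> (nat -> lring L) -> Prop) (HN : lang n N).

(** Right rotation. Its first object and first map are obtained from surjectivity and fullness of
    the suspension, so they are described only after suspending. *)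
Lemma N_rrot X f : N X f -> exists P p, [/\ N P p, lso (P 1%N) = X n,
  sg (p 1%N) = sgn n (f n), forall i, (0 < i <= n)%N -> P i.+1 = X i
  & forall i, (0 < i < n)%N -> p i.+1 = f i].
Proof.
move=> NX; have [Xh Xn] := N_seq HN NX.
have [T ET] := lso_surj (X n).
have fh := hom_sgn n (Xh n ltac:(lia)); rewrite -ET Xn in fh.
have [r [rh rE]] := sg_full fh.
pose P i := if i == 1%N then T else X i.-1.
pose p i := if i == 1%N then r else f i.-1.
exists P, p; split=> //; last first.
- by move=> i i_n; rewrite /p; ifs.
- by move=> i i_n; rewrite /P; ifs.
have Ps : lseq n P p.
  split=> [i i_n|]; last by rewrite /P; ifs.
  rewrite /P /p; have [->|i1] := eqVneq i 1%N; first by ifs.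
  ifs; have := Xh i.-1 ltac:(lia).
  by have -> : i.-1.+1 = i by lia.
apply/(N_rot HN) => //; apply: (N_ext n3 HN (lseq_rot n3 Ps) NX) => i i_n.
  rewrite /rotX /P; case: leqP => i_n'; first by ifs.
  have -> : i = n.+1 by lia.
  by rewrite Xn; ifs.
rewrite /rotf /p; case: ltnP => i_n'; first by ifs.
have -> : i = n by lia.
by rewrite /= rE sgnK.
Qed.

(** Conjugation by -1 in degree 2, which changes the sign of the two maps meeting there and nothing
    else. *)
Lemma N_sign X f : N X f ->
  N X (fun i => if (i == 1%N) || (i == 2%N) then - f i else f i).
Proof.
move=> NX; have [Xh Xn] := N_seq HN NX; set g := fun i => _.
have gs : lseq n X g.
  by split=> // i i_n; rewrite /g; case: ifP => _; have t := Xh i i_n; ht.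
pose a i := if i == 2%N then - lid (X i) else lid (X i).
have ah i : hom (X i) (X i) (a i) by rewrite /a; case: ifP => _; ht.
have an : a n.+1 = sg (a 1%N) by rewrite /a; ifs; rewrite Xn sg_id.
apply: (N_retract HN gs NX (a := a) (b := a)).
- split=> // i i_n; rewrite /a /g; have t := Xh i i_n.
  have [iE|i1] := eqVneq i 1%N; first by subst i; rewrite /=; clear -t; nct.
  have [E|i2] := eqVneq i 2%N; ifs; clear -t; nct.
- split=> // i i_n; rewrite /a /g; have t := Xh i i_n.
  have [iE|i1] := eqVneq i 1%N; first by subst i; rewrite /=; clear -t; nct.
  have [E|i2] := eqVneq i 2%N; ifs; clear -t; nct.
- by move=> i i_n; rewrite /a; case: ifP => _; rewrite ?mulrNN (mul_id (hom_id _)).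
Qed.

Variables (A B : nat -> lob L) (f g : nat -> lring L) (r s : lring L).
Local Notation cX := (lconeX n A B).
Local Notation cj1 := (J1 n (coneU n A) B).
Local Notation cj2 := (J2 n (coneU n A) B).
Local Notation cq1 := (Q1 n (coneU n A) B).
Local Notation cq2 := (Q2 n (coneU n A) B).
Hypotheses (NA : N A f) (NB : N B g).
Hypotheses (rh : hom (A 1%N) (B 1%N) r) (sh : hom (A 2%N) (B 2%N) s).
Hypothesis sr : s * f 1%N = g 1%N * r.

Local Notation V := (rotX n (ltrivX n (B 1%N))).
Local Notation Q := (bpX n (rotX n A) V).
Local Notation qj1 := (J1 n (rotX n A) V).
Local Notation qj2 := (J2 n (rotX n A) V).
Local Notation qq1 := (Q1 n (rotX n A) V).
Local Notation qq2 := (Q2 n (rotX n A) V).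
Local Notation q := (lsum n (rotX n A) (rotf n f) V (rotf n (ltrivf (B 1%N)))).

Local Notation W1 := (ltrivX n (A 3%N)).
Local Notation W2 := (rotX n (ltrivX n (B 2%N))).
Local Notation S := (bpX n W1 W2).
Local Notation sj1 := (J1 n W1 W2).
Local Notation sj2 := (J2 n W1 W2).
Local Notation sq1 := (Q1 n W1 W2).
Local Notation sq2 := (Q2 n W1 W2).
Local Notation l := (lsum n W1 (ltrivf (A 3%N)) W2 (rotf n (ltrivf (B 2%N)))).
(** With this sign the n-angle starts with minus the projection A_3 + B_2 -> A_3. Composed with the
    first map of [E], whose A_3-row is - alpha_2, it gives + alpha_2, the first map of [Q]. *)
Definition splitc (i : nat) : lring L := if (i == 1%N) || (i == 2%N) then - l i else l i.
Local Notation c := splitc.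

Lemma NQ : N Q q.
Proof. exact: (N_sum HN (N_rot1 HN NA) (N_rot1 HN (N_triv HN _))). Qed.

Lemma NS : N S c.
Proof. exact: (N_sign (N_sum HN (N_triv HN _) (N_rot1 HN (N_triv HN _)))). Qed.

Lemma rtrivX (T : lob L) i : (1 < i < n)%N -> rotX n (ltrivX n T) i = lz.
Proof. by move=> i_n; rewrite /rotX /ltrivX; ifs. Qed.
Lemma rtrivX_n (T : lob L) : rotX n (ltrivX n T) n = lso T.
Proof. by rewrite /rotX /ltrivX; ifs. Qed.
Lemma rtrivf (T : lob L) i : (0 < i < n)%N -> rotf n (ltrivf T) i = 0.
Proof. by case: i => // i i_n; rewrite /rotf; ifs. Qed.
Lemma rtrivf_n (T : lob L) : rotf n (ltrivf T) n = sgn n (lid (lso T)).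
Proof. by rewrite /rotf ltnn /ltrivf eqxx sg_id. Qed.

Lemma qP i : (0 < i <= n.+1)%N ->
  isbp (Q i) (rotX n A i) (V i) (qj1 i) (qj2 i) (qq1 i) (qq2 i).
Proof.
apply: bpXP; first exact: (N_seq HN (N_rot1 HN NA)).2.
exact: (N_seq HN (N_rot1 HN (N_triv HN _))).2.
Qed.

Lemma qP' i : (0 < i <= n)%N ->
  isbp (Q i) (A i.+1) (V i) (qj1 i) (qj2 i) (qq1 i) (qq2 i).
Proof.
move=> i_n; have := qP (i := i) ltac:(lia).
by have -> : rotX n A i = A i.+1 by rewrite /rotX; ifs.
Qed.

Lemma sP i : (0 < i <= n.+1)%N ->
  isbp (S i) (W1 i) (W2 i) (sj1 i) (sj2 i) (sq1 i) (sq2 i).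
Proof.
apply: bpXP; first exact: (N_seq HN (N_triv HN _)).2.
exact: (N_seq HN (N_rot1 HN (N_triv HN _))).2.
Qed.

Lemma qjq0 i : (1 < i < n)%N -> qj1 i * qq1 i = lid (Q i).
Proof.
move=> i_n; have cc := qP' (i := i) ltac:(lia).
rewrite (rtrivX _ i_n) in cc; have [_ _ _ h0 _ _ _ _ hid] := cc.
by apply/eqP; rewrite eq_sym -subr_eq0 -hid (hom_to_0 (lid_z L) h0) mulr0.
Qed.

Lemma qE0 i : (0 < i < n)%N -> q i = qj1 i.+1 * f i.+1 * qq1 i.
Proof.
move=> i_n; rewrite /lsum (rtrivf _ i_n) mulr0 mul0r addr0.
by rewrite /rotf; ifs.
Qed.

Lemma q_first : [/\ Q 1%N = cX 1%N, qj1 1%N = cj1 1%N, qj2 1%N = cj2 1%N, qq1 1%N = cq1 1%N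
  & qq2 1%N = cq2 1%N].
Proof. by rewrite /lconeX /bpX /J1 /J2 /Q1 /Q2 /rotX /ltrivX /coneU /extX; ifs. Qed.

Lemma s_first : [/\ S 1%N = cX 2%N, sj1 1%N = cj1 2%N, sj2 1%N = cj2 2%N, sq1 1%N = cq1 2%N
  & sq2 1%N = cq2 2%N].
Proof. by rewrite /lconeX /bpX /J1 /J2 /Q1 /Q2 /rotX /ltrivX /coneU /extX; ifs. Qed.

Lemma s_second : [/\ S 2%N = Q 2%N, sj1 2%N = qj1 2%N & sq1 2%N = qq1 2%N].
Proof. by rewrite /bpX /J1 /J2 /Q1 /Q2 /rotX /ltrivX; ifs. Qed.

Lemma qn0 : q n = sgn n (cj1 n.+1 * sg (f 1%N) * qq1 n + cj2 n.+1 * qq2 n).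
Proof.
have [_ E1 E2 _ _] := q_first.
rewrite /lsum rtrivf_n /rotf ltnn.
have -> : qj1 n.+1 = cj1 n.+1 by rewrite !J1_last ?E1 //; lia.
have -> : qj2 n.+1 = cj2 n.+1 by rewrite !J2_last ?E2 //; lia.
have [_ _ _ h2 _ _ _ _ _] := qP (i := n) ltac:(lia); rewrite rtrivX_n in h2.
rewrite !sgn_mulr !sgn_mull -(mulrA (cj2 _)) (id_mul h2) /sgn.
by case: odd; rewrite // opprD.
Qed.

Lemma c_first : c 1%N = - (qj1 2%N * cq1 2%N).
Proof.
have [_ _ _ E1 _] := s_first; have [_ E2 _] := s_second.
rewrite /splitc /lsum rtrivf ?mulr0 ?mul0r ?addr0; last by lia.
have [_ _ h1 _ _ _ _ _ _] := sP (i := 1%N) ltac:(lia).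
by rewrite /ltrivf /= -(mulrA (sj1 2%N)) (id_mul h1) E1 E2.
Qed.

Lemma c_mid i : (1 < i < n)%N -> c i = 0.
Proof.
move=> i_n; rewrite /splitc.
have -> : l i = 0.
  by rewrite /lsum rtrivf /ltrivf; ifs; rewrite ?mulr0 ?mul0r ?addr0 //; lia.
by rewrite oppr0 if_same.
Qed.

Lemma c_last : c n = sgn n (sj2 n.+1 * sq2 n).
Proof.
rewrite /splitc; ifs; rewrite /lsum rtrivf_n /ltrivf; ifs.
have [_ _ _ h2 _ _ _ _ _] := sP (i := n) ltac:(lia); rewrite rtrivX_n in h2.
by rewrite mulr0 mul0r add0r sgn_mulr sgn_mull -mulrA (id_mul h2).
Qed.

(** The point of the split n-angle: below degree n, D reduces to E_(i+2) + Q_(i+1), and every psi_j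
    with target strictly between degrees 2 and n is 0. *)
Lemma S_mid i : (2 < i < n)%N -> lid (S i) = 0.
Proof.
move=> i_n; have [_ _ h1 h2 _ _ _ _ hid] := sP (i := i) ltac:(lia).
have e1 : W1 i = lz by rewrite /ltrivX; ifs.
have e2 : W2 i = lz by rewrite rtrivX //; lia.
rewrite e1 in h1; rewrite e2 in h2.
move/eqP: hid; rewrite (hom_to_0 (lid_z L) h1) (hom_to_0 (lid_z L) h2) !mulr0 subr0.
by move/eqP.
Qed.

Variables (E : nat -> lob L) (e : nat -> lring L).
Hypothesis NE : N E e.
Hypotheses (E1 : E 1%N = cX 1%N) (E2 : E 2%N = cX 2%N).
Hypothesis e1 : e 1%N = cj1 2%N * - f 2%N * cq1 1%N + cj2 2%N * s * cq1 1%N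
                        + cj2 2%N * g 1%N * cq2 1%N.
Variables (x pA pB : nat -> lring L).
Hypotheses (xm : lmor n E e Q q x) (x1 : x 1%N = lid (E 1%N)) (x2 : x 2%N = c 1%N).
Hypothesis pBh : forall i, (1 < i < n)%N -> hom (Q i.+1) (S i.+1) (pB i).
Hypothesis cpB : c n * pB n.-1 = sg (e 1%N) * q n.
Local Notation D := (LDX n E Q S).
Local Notation d := (LDf n E Q S e q c x pA pB).
Hypothesis ND : N D d.

Local Notation dj1 := (dj1 n E Q S).
Local Notation dj2 := (dj2 n E Q S).
Local Notation dq1 := (dq1 n E Q S).
Local Notation dq2 := (dq2 n E Q S).
Local Notation ej1 := (ej1 n Q S).
Local Notation ej2 := (ej2 n Q S).
Local Notation eq1 := (eq1 n Q S).
Local Notation eq2 := (eq2 n Q S).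

Lemma ej2_mid i : (i < n)%N -> ej2 i = 0 /\ eq2 i = 0.
Proof.
move=> i_n; have [_ h1 _ h2 _ _ _ _ _] := eP n Q S i.
have z : lid (lo (dC S i)) = 0.
  rewrite /dC; case: ifP => i3 /=; last exact: lid_z.
  by apply: S_mid; lia.
by split; [apply: hom_from_0 h1|apply: hom_to_0 h2].
Qed.

(** The B_2-part of the relation for psi_(2n-5), simplified with s alpha_1 = beta_1 r. Desuspended,
    it is the commutative square to which (N3) is applied after two right rotations. *)
Lemma sq2_pB : sq2 n * pB n.-1 = sg (g 1%N) * (sg r * qq1 n + qq2 n).
Proof.
have c1 := sP (i := n.+1) ltac:(lia); have c2 := sP (i := n) ltac:(lia).
have cc := coneP n3 A (N_seq HN NB).2.
have c3 := isbp_sg (cc 1%N ltac:(lia)); have c4 := isbp_sg (cc 2%N ltac:(lia)).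
rewrite extX_le in c3; last by lia.
have [_ _ _ _ Es] := s_first.
have Es' : sq2 n.+1 = sg (cq2 2%N) by rewrite Q2_last ?Es //; lia.
have k1 : sq2 n.+1 * (c n * pB n.-1) = sgn n (sq2 n * pB n.-1).
  rewrite c_last !sgn_mull sgn_mulr; congr sgn.
  have e2 : W2 n = W2 n.+1 by rewrite rtrivX_n /rotX /ltrivX; ifs.
  rewrite e2 in c2; clear -c1 c2; nct.
rewrite -[LHS](sgnK n) -k1 cpB qn0 !sgn_mulr sgnK Es' e1.
rewrite !(sgD, sgM) !sgN J1_last ?J2_last; try lia.
have t1 := hom_sg sh; have t2 := hom_sg rh; have Ah := (N_seq HN NA).1.
have t3 := hom_sg (Ah 1%N ltac:(lia)); have t4 := hom_sg ((N_seq HN NB).1 1%N ltac:(lia)).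
have t5 := isbp_q2 (qP' (i := n) ltac:(lia)); rewrite rtrivX_n in t5.
have k2 := congr1 sg sr; rewrite !sgM in k2.
clear -c3 c4 t1 t2 t3 t4 t5 k2; nct.
Qed.

Lemma d_pen : d n.-1 = pB n.-1 * eq1 n.-1 * dq2 n.-1.
Proof.
have nE : n.-1.+1 = n by lia.
have [[k1 k2 k3 k4] [k5 k6 k7 k8 _]] := d_last0 n3 E Q S (erefl n).
rewrite /LDf nE; ifs; rewrite k2 k4 k6 k8.
have -> : dphi n pA n.-1 = 0 by rewrite /dphi; ifs.
have -> : dc c n.-1 = 0 by rewrite /dc; case: ifP => // _; apply: c_mid; lia.
have t := pBh (i := n.-1) ltac:(lia); rewrite nE in t.
clear -t; nct.
Qed.

Lemma d_n : d n = sg (e 2%N) * c n.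
Proof. by rewrite /LDf; ifs. Qed.

Lemma d_one : d 1%N = dj1 2%N * da n e 1%N + dj2 2%N * ej1 2%N * dphi n x 1%N.
Proof. by []. Qed.

Lemma d_mid i : (1 < i)%N -> (i.+1 < n)%N ->
  d i = - (dj1 i.+1 * da n e i * dq1 i)
        + sgn i (dj2 i.+1 * ej1 i.+1 * x i.+2 * dq1 i)
        - dj2 i.+1 * ej1 i.+1 * q i.+1 * eq1 i * dq2 i.
Proof.
move=> i1 i_n; rewrite /LDf; ifs.
have [-> _] := ej2_mid i_n.
have -> : dphi n x i = x i.+2 by rewrite /dphi; ifs.
have -> : db n q i = q i.+1 by rewrite /db; ifs.
by rewrite /sgn; case: odd; nc.
Qed.

Section Comparison.
Variables (P : nat -> lob L) (p chi : nat -> lring L).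
Hypothesis PE : forall i, (0 < i < n)%N -> P i.+2 = D i.
Hypothesis pE : forall i, (0 < i < n.-1)%N -> p i.+2 = d i.
Hypothesis p2 : sg (p 2%N) = sgn n (d n).
Hypothesis chim : lmor n P p B g chi.
Hypothesis chi1 : sg (chi 1%N) = sgn n ((sg r * qq1 n + qq2 n) * eq1 n.-1 * dq2 n.-1).
Hypothesis chi2 : sg (chi 2%N) = sq2 n.

(** The sign at 3 makes the later relations uniform: d_1 contains + alpha_3 whereas all following
    d_i contain - alpha. *)
Definition dpi k : lring L := if k == 3%N then - chi 3%N else chi k * dj1 k.-2.
Definition dtau k : lring L := chi k.+1 * dj2 k.-1 * ej1 k.-1.

Lemma chi_hom i : (0 < i < n)%N -> hom (D i) (B i.+2) (chi i.+2).
Proof.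
move=> i_n; have [ch _ _] := chim; have := ch i.+2 ltac:(lia).
by rewrite PE.
Qed.

Lemma dpi_hom k : (2 < k <= n)%N -> hom (E k) (B k) (dpi k).
Proof.
move=> k_n; rewrite /dpi; case: eqP => [->|k3].
  by have := chi_hom (i := 1%N) ltac:(lia); rewrite /LDX /= => t; ht.
have t1 := chi_hom (i := k.-2) ltac:(lia); have t2 := dP n E Q S k.-2.
have kE : k.-2.+2 = k by lia.
rewrite loA ?kE in t2; last by lia.
by rewrite kE D_eq // in t1; [ht|lia].
Qed.

Lemma dtau_hom k : (2 < k < n)%N -> hom (Q k) (B k.+1) (dtau k).
Proof.
move=> k_n; rewrite /dtau.
have t1 := chi_hom (i := k.-1) ltac:(lia); have t2 := dP n E Q S k.-1.
have t3 := eP n Q S k.-1.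
have kE : k.-1.+1 = k by lia.
rewrite loB ?kE in t3; last by lia.
by rewrite kE D_eq // in t1; [ht|lia].
Qed.

(** The second square of [chi], where [chi 2] desuspends the projection onto Sigma B_2. The equation
    is checked after suspending because the rotated maps are known only there. *)
Lemma dR1 : - dpi 3%N * e 2%N * cj2 2%N = g 2%N.
Proof.
have [ch cc cn] := chim; have [_ _ Es _ _] := s_first.
apply: sg_inj; rewrite /dpi /= opprK.
have k := congr1 sg (cc 2%N ltac:(lia)).
rewrite !sgM p2 chi2 d_n c_last !sgn_mulr sgnK in k.
rewrite J2_last in k; last by lia.
rewrite Es in k.
have c2 := sP (i := n) ltac:(lia); rewrite rtrivX_n in c2.
have t1 := hom_sg ((N_seq HN NB).1 2%N ltac:(lia)).
have t2 := isbp_j2 (isbp_sg (coneP n3 A (N_seq HN NB).2 (i := 2%N) ltac:(lia))).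
transitivity (sg (chi 3%N) * (sg (e 2%N) * (sg (cj2 2%N) * sq2 n)) * sj2 n).
  rewrite !sgM; clear -c2 t2; nct.
rewrite k; clear -c2 t1; nct.
Qed.

Lemma dR2 k : (2 < k < n)%N ->
  g k * dpi k = - dpi k.+1 * e k + sgn k (dtau k * x k).
Proof.
move=> k_n; have [ch cc cn] := chim.
have [kE|k3] := eqVneq k 3%N.
  subst k; have := cc 3%N ltac:(lia); rewrite pE; last by lia.
  rewrite d_one /da /dphi; ifs; rewrite /dpi /dtau /sgn /= => k.
  rewrite mulrN -k; clear; nc.
have k2 : (1 < k.-2)%N by lia.
have kE2 : k.-2.+2 = k by lia.
have kE1 : k.-2.+1 = k.-1 by lia.
have := cc k ltac:(lia).
have -> : p k = d k.-2 by rewrite -[in LHS]kE2 pE //; lia.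
rewrite d_mid //; last by lia.
rewrite kE2 kE1 /dpi /dtau; ifs => K.
have -> : k.+1.-2 = k.-1 by lia.
have c1 := dP n E Q S k.-2.
have t1 := xm; have [xh _ _] := xm; have t2 := xh k ltac:(lia).
have t3 := (N_seq HN NE).1 k ltac:(lia).
rewrite loA ?kE2 in c1; last by lia.
have Ek : da n e k.-2 = e k by rewrite /da kE2; ifs.
have odd2 : odd k.-2 = odd k by rewrite -[in RHS]kE2 /= negbK.
rewrite mulrA -K Ek /sgn odd2; case: odd; clear -c1 t2 t3; nct.
Qed.

(** The n-th square of [chi], whose upper edge is the suspension of [chi 1], restricted to E_n. Its
    restriction to Q_(n-1) is [dR5], which is void for n = 3 since D_1 is just E_3. *)
Lemma dR3 : g n * dpi n = (sg r * qq1 n + qq2 n) * x n.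
Proof.
have [ch cc cn] := chim; have [xh _ _] := xm; have t2 := xh n ltac:(lia).
have c2 := dP n E Q S n.-1; have c3 := eP n Q S n.-1.
have nE : n.-1.+1 = n by lia.
rewrite loB ?nE in c3; last by lia.
have K := cc n ltac:(lia); rewrite cn chi1 in K.
have [n3E|n4] := eqVneq n 3%N.
  have pn : p n = dj2 n.-1 * ej1 n.-1 * x n.
    rewrite [in LHS]n3E pE; last by lia.
    rewrite d_one /da /dphi; ifs; rewrite mulr0 add0r.
    have -> : n.-1 = 2%N by lia.
    by have -> : x n = x 3%N by rewrite n3E.
  rewrite pn in K; have -> : dpi n = - chi n by rewrite /dpi n3E.
  rewrite mulrN -K /sgn; have -> : odd n by rewrite n3E.
  clear -c2 c3 t2; nct.
have nE2 : n.-2.+2 = n by lia.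
have nE1 : n.-2.+1 = n.-1 by lia.
have pn : p n = d n.-2 by rewrite -[in LHS]nE2 pE //; lia.
rewrite pn d_mid ?nE2 ?nE1 in K; try lia.
have Ek : da n e n.-2 = 0 by rewrite /da; ifs.
have c1 := dP n E Q S n.-2.
rewrite loA ?nE2 in c1; last by lia.
rewrite /dpi; ifs; rewrite mulrA -K Ek.
have odd2 : odd n.-2 = odd n by rewrite -[in RHS]nE2 /= negbK.
rewrite /sgn odd2; case: odd; clear -c1 c2 c3 t2; nct.
Qed.

Lemma dR4 k : (2 < k)%N -> (k.+1 < n)%N -> - dtau k.+1 * q k = g k.+1 * dtau k.
Proof.
move=> k2 k_n; have [ch cc cn] := chim.
have kE : k.-1.+1 = k by lia.
have := cc k.+1 ltac:(lia).
have -> : p k.+1 = d k.-1 by rewrite -[in LHS]kE pE //; lia.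
rewrite d_mid; try lia.
rewrite kE => K.
have c1 := dP n E Q S k.-1; have c2 := eP n Q S k.-1.
rewrite loB ?kE in c2; last by lia.
have t := (N_seq HN NQ).1 k ltac:(lia).
rewrite /dtau /= !mulrA -K /sgn; case: odd; clear -c1 c2 t; nct.
Qed.

Lemma dR5 : (3 < n)%N -> g n * dtau n.-1 = - sgn n ((sg r * qq1 n + qq2 n) * q n.-1).
Proof.
move=> n4; have [ch cc cn] := chim.
have nE : n.-1.+1 = n by lia.
have nE2 : n.-2.+2 = n by lia.
have nE1 : n.-2.+1 = n.-1 by lia.
have K := cc n ltac:(lia); rewrite cn chi1 in K.
have pn : p n = d n.-2 by rewrite -[in LHS]nE2 pE //; lia.
rewrite pn d_mid ?nE2 ?nE1 in K; try lia.
have c1 := dP n E Q S n.-2; have c2 := eP n Q S n.-2.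
have c3 := dP n E Q S n.-1; have c4 := eP n Q S n.-1.
rewrite loB ?nE1 in c2; last by lia.
rewrite loB ?nE in c4; last by lia.
have t := (N_seq HN NQ).1 n.-1 ltac:(lia); rewrite nE in t.
have [_ c5] := ej2_mid (i := n.-1) ltac:(lia).
have odd2 : odd n.-2 = odd n by rewrite -[in RHS]nE2 /= negbK.

rewrite /dtau nE !mulrA -K /sgn odd2; case: odd => /=; clear -c1 c2 c3 c4 t; nct.
Qed.

Lemma oct_cone : exists a, [/\ a 1%N = r, a 2%N = s, lmor n A f B g a
  & N cX (lconef n A f B g a)].
Proof.
apply: (assemble n3 HN NA NB NE rh sh sr E1 E2 e1 (qj1 := qj1) (qq1 := qq1)
  (qq2 := qq2 n) _ _ _ _ qjq0 _ qE0 qn0 xm x1 _ dpi_hom dtau_hom dR1 dR2 dR3 dR4 dR5).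
- by move=> i i_n; case: (qP' i_n).
- by move=> i i_n; case: (qP' i_n).
- by have [_ _ _ + _ _ _ _ _] := qP' (i := n) ltac:(lia); rewrite rtrivX_n.
- by move=> i i_n; case: (qP' i_n).
- by have [_ _ _ _ _ _ _ + _] := qP' (i := n) ltac:(lia).
- by rewrite x2 c_first.
Qed.

End Comparison.

Lemma oct_cone_ex : exists a, [/\ a 1%N = r, a 2%N = s, lmor n A f B g a
  & N cX (lconef n A f B g a)].
Proof.
have [P' [p' [NP' P'1 p'1 P'E p'E]]] := N_rrot ND.
have [P [p [NP P1 p1 PE pE]]] := N_rrot NP'.
have nE : n.-1.+1 = n by lia.
have nE1 : n.-2.+1 = n.-1 by lia.
have Bh := (N_seq HN NB).1.
have P1' : lso (P 1%N) = D n.-1 by rewrite P1 -P'E ?nE //; lia.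
have P2' : lso (P 2%N) = D n by rewrite PE ?P'1 //; lia.
have c3 := eP n Q S n.-1; have c2 := dP n E Q S n.-1.
rewrite loB ?nE in c3; last by lia.
have c4 := qP' (i := n) ltac:(lia); rewrite rtrivX_n (N_seq HN NA).2 in c4.
(* After two right rotations the first object desuspends D_(n-1) = Q_n, that is, it is A_1 + B_1,
   and the map to B_1 is (r, 1). The factor [sgn n] offsets the sign of the rotation. *)
have [chi1 [chi1h chi1E]] : exists chi1, hom (P 1%N) (B 1%N) chi1 /\
    sg chi1 = sgn n ((sg r * qq1 n + qq2 n) * eq1 n.-1 * dq2 n.-1).
  apply: sg_full; rewrite P1' D_eq //; last by lia.
  by have t := hom_sg rh; ht.
have c5 := sP (i := n) ltac:(lia); rewrite rtrivX_n in c5.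
have [_ [_ _ _ _ DnE]] := d_last0 n3 E Q S (erefl n).
have [chi2 [chi2h chi2E]] : exists chi2, hom (P 2%N) (B 2%N) chi2 /\ sg chi2 = sq2 n.
  apply: sg_full; rewrite P2' DnE; ht.
have [|chi [k1 k2 km]] := N_3 HN NP NB chi1h chi2h.
  apply: sg_inj; rewrite !sgM chi1E chi2E p1 -nE p'E nE; last by lia.
  rewrite d_pen !sgn_mulr !mulrA -sq2_pB; congr sgn.
apply: (oct_cone (P := P) (p := p) (chi := chi)) => //.
- by move=> i i_n; rewrite PE ?P'E //; lia.
- by move=> i i_n; rewrite pE ?p'E //; lia.
- by rewrite pE ?p'1 //; lia.
- by rewrite k1.
- by rewrite k2.
Qed.

End OctahedronToCone.

Lemma LN4star_LN4 (L : lincat) (n : nat) (N : (nat -> lob L) -> (nat -> lring L) -> Prop) :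
  (3 <= n)%N -> lang n N -> LN4star n N -> LN4 n N.
Proof.
move=> n3 HN H4 A f B g r s NA NB rh sh sr.
have cc := coneP n3 A (N_seq HN NB).2.
have c1 := cc 1%N ltac:(lia); have c2 := cc 2%N ltac:(lia).
rewrite extX_le in c1; last by lia.
rewrite extX_le in c2; last by lia.
have t1 := (N_seq HN NA).1 2%N ltac:(lia); have t2 := (N_seq HN NB).1 1%N ltac:(lia).
have [|E [e [NE E1 E2 e1]]] := N_first HN (T := lconeX n A B 1) (T' := lconeX n A B 2)
  (r := J1 n (coneU n A) B 2%N * - f 2%N * Q1 n (coneU n A) B 1%N
     + J2 n (coneU n A) B 2%N * s * Q1 n (coneU n A) B 1%N
     + J2 n (coneU n A) B 2%N * g 1%N * Q2 n (coneU n A) B 1%N).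
  by ht.
have [q1 q2 q3 q4 q5] := q_first n3 A B; have [s1 s2 s3 s4 s5] := s_first n3 A B.
have [r1 r2 r3] := s_second n3 A B.
have [||||x [pA [pB [x1 x2 xm [pBh _] [cpB ND]]]]] :=
  H4 _ _ _ _ _ _ NE (NQ HN B NA) (NS n3 HN A B).
- by rewrite E1.
- by rewrite E2.
- exact: r1.
- rewrite (c_first n3 HN) e1 (qE0 n3); last by lia.
  rewrite q4; have qc := qP' n3 HN B NA (i := 2%N) ltac:(lia).
  clear -c1 c2 t1 t2 sh qc; nct.
exact: (oct_cone_ex n3 HN NA NB rh sh sr NE E1 E2 e1 xm x1 x2 pBh cpB ND).
Qed.

(** * The ring of an additive category *)

Section EndRing.
Variable V : zmodType.

Record addend := Addend { aeval : V -> V; aevalD : forall x y, aeval (x + y) = aeval x + aeval y }.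

Lemma addend_ext (F G : addend) : (forall x, aeval F x = aeval G x) -> F = G.
Proof.
case: F G => [F FD] [G GD] /= E; have E' : F = G by apply/funext.
by subst G; congr Addend; apply: Prop_irrelevance.
Qed.

Lemma add_additive (F G : addend) x y :
  aeval F (x + y) + aeval G (x + y) = (aeval F x + aeval G x) + (aeval F y + aeval G y).
Proof. by rewrite !aevalD addrACA. Qed.
Lemma opp_additive (F : addend) x y : - aeval F (x + y) = - aeval F x + - aeval F y.
Proof. by rewrite aevalD opprD. Qed.
Lemma comp_additive (F G : addend) x y :
  aeval F (aeval G (x + y)) = aeval F (aeval G x) + aeval F (aeval G y).
Proof. by rewrite !aevalD. Qed.
Lemma zero_additive (x y : V) : 0 = 0 + 0 :> V.
Proof. by rewrite addr0. Qed.

Definition addend_add F G := Addend (add_additive F G).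
Definition addend_opp F := Addend (opp_additive F).
Definition addend_mul F G := Addend (comp_additive F G).
Definition addend_zero := @Addend (fun=> 0) zero_additive.
Definition addend_one := @Addend id (fun x y => erefl (x + y)).

HB.instance Definition _ := gen_eqMixin addend.
HB.instance Definition _ := gen_choiceMixin addend.

Lemma addend_addA : associative addend_add.
Proof. by move=> F G H; apply: addend_ext => x /=; rewrite addrA. Qed.
Lemma addend_addC : commutative addend_add.
Proof. by move=> F G; apply: addend_ext => x /=; rewrite addrC. Qed.
Lemma addend_add0 : left_id addend_zero addend_add.
Proof. by move=> F; apply: addend_ext => x /=; rewrite add0r. Qed.
Lemma addend_addN : left_inverse addend_zero addend_opp addend_add.
Proof. by move=> F; apply: addend_ext => x /=; rewrite addNr. Qed.
HB.instance Definition _ := GRing.isZmodule.Build addend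
  addend_addA addend_addC addend_add0 addend_addN.

Lemma addend_mulA : associative addend_mul.
Proof. by move=> F G H; apply: addend_ext. Qed.
Lemma addend_mul1 : left_id addend_one addend_mul.
Proof. by move=> F; apply: addend_ext. Qed.
Lemma addend_mulr1 : right_id addend_one addend_mul.
Proof. by move=> F; apply: addend_ext. Qed.
Lemma addend_mulDl : left_distributive addend_mul addend_add.
Proof. by move=> F G H; apply: addend_ext. Qed.
Lemma addend_mulDr : right_distributive addend_mul addend_add.
Proof. by move=> F G H; apply: addend_ext => x /=; rewrite aevalD. Qed.
HB.instance Definition _ := GRing.Zmodule_isPzRing.Build addend
  addend_mulA addend_mul1 addend_mulr1 addend_mulDl addend_mulDr.

End EndRing.

Section Additive.
Variable C : addcat.
Implicit Types (f g h : Mor C) (X Y Z : Ob C).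

Lemma cadd_inj0 f g : dom f = dom g -> cod f = cod g -> cadd f g = f ->
  g = zm (dom f) (cod f).
Proof.
move=> d c E; rewrite -(cadd0 g) -d -c -(caddN f).
by rewrite -caddA ?dom_copp ?cod_copp // E caddN.
Qed.

Lemma cadd_zm X Y : cadd (zm X Y) (zm X Y) = zm X Y :> Mor C.
Proof. by have := cadd0 (zm X Y : Mor C); rewrite dom_zm cod_zm. Qed.

Lemma cmp_zl X Y f : cod f = X -> cmp (zm X Y) f = zm (dom f) Y.
Proof.
move=> c; have := @cadd_inj0 (cmp (zm X Y) f) _ erefl erefl.
rewrite -cmp_addl ?dom_zm // cadd_zm dom_cmp ?cod_cmp ?dom_zm // cod_zm.
by apply.
Qed.

Record Hom X Y := MkHom { hval : Mor C; hdom : dom hval = X; hcod : cod hval = Y }.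

Lemma Hom_ext X Y (u v : Hom X Y) : hval u = hval v -> u = v.
Proof.
case: u v => [u du cu] [v dv cv] /= E; subst v.
by congr MkHom; apply: Prop_irrelevance.
Qed.

Definition fam := forall X Y, Hom X Y.

Lemma fam_ext (m m' : fam) : (forall X Y, hval (m X Y) = hval (m' X Y)) -> m = m'.
Proof.
move=> E; apply: functional_extensionality_dep => X.
by apply: functional_extensionality_dep => Y; apply: Hom_ext.
Qed.

Lemma hom_add_ok X Y (u v : Hom X Y) :
  dom (cadd (hval u) (hval v)) = X /\ cod (cadd (hval u) (hval v)) = Y.
Proof. by rewrite dom_cadd ?cod_cadd ?hdom ?hcod. Qed.

Definition fam_add (m m' : fam) : fam := fun X Y =>
  MkHom (hom_add_ok (m X Y) (m' X Y)).1 (hom_add_ok (m X Y) (m' X Y)).2.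
Definition fam_opp (m : fam) : fam := fun X Y =>
  MkHom (etrans (dom_copp (hval (m X Y))) (hdom (m X Y)))
        (etrans (cod_copp (hval (m X Y))) (hcod (m X Y))).
Definition fam_zero : fam := fun X Y => MkHom (dom_zm X Y) (cod_zm X Y).

HB.instance Definition _ := gen_eqMixin fam.
HB.instance Definition _ := gen_choiceMixin fam.

Lemma fam_addA : associative fam_add.
Proof. by move=> m m' m''; apply: fam_ext => X Y /=; rewrite caddA ?hdom ?hcod. Qed.
Lemma fam_addC : commutative fam_add.
Proof. by move=> m m'; apply: fam_ext => X Y /=; rewrite caddC ?hdom ?hcod. Qed.
Lemma fam_add0 : left_id fam_zero fam_add.
Proof.
by move=> m; apply: fam_ext => X Y /=; rewrite -{2}(cadd0 (hval (m X Y))) hdom hcod.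
Qed.
Lemma fam_addN : left_inverse fam_zero fam_opp fam_add.
Proof. by move=> m; apply: fam_ext => X Y /=; rewrite caddN hdom hcod. Qed.
HB.instance Definition _ := GRing.isZmodule.Build fam
  fam_addA fam_addC fam_add0 fam_addN.

(** Only the component at the codomain of [f] can be nonzero. Non-composable morphisms therefore
    multiply to 0, and identities of distinct objects become orthogonal idempotents. Equality of
    objects is decided classically. *)
Definition act_raw f (m : fam) X Y : Mor C :=
  if pselect (Y = cod f) then cmp f (hval (m X (dom f))) else zm X Y.

Lemma act_raw_ok f m X Y : dom (act_raw f m X Y) = X /\ cod (act_raw f m X Y) = Y.
Proof.
rewrite /act_raw; case: pselect => [E|_] /=; last by rewrite dom_zm cod_zm.
by rewrite dom_cmp ?cod_cmp ?hdom ?hcod ?E.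
Qed.

Definition act f (m : fam) : fam := fun X Y =>
  MkHom (act_raw_ok f m X Y).1 (act_raw_ok f m X Y).2.

Lemma act_additive f (m m' : fam) : act f (m + m') = act f m + act f m'.
Proof.
apply: fam_ext => X Y /=; rewrite /act_raw; case: pselect => [_|_] /=.
  by rewrite cmp_addr ?hdom ?hcod.
by rewrite cadd_zm.
Qed.

(* Morphisms act by composition on the group of all families [X -> Y]. *)
Definition ev f : addend fam := Addend (act_additive f).

Lemma ev_cmp f g : cod f = dom g -> ev (cmp g f) = ev g * ev f.
Proof.
move=> fg; apply: addend_ext => m; apply: fam_ext => X Y /=.
rewrite /act_raw cod_cmp // dom_cmp //; case: pselect => // _ /=.
rewrite /act_raw; case: pselect => [_|nE] /=; last by case: nE.
by rewrite cmpA ?hcod.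
Qed.

Lemma ev_add f g : dom f = dom g -> cod f = cod g -> ev (cadd f g) = ev f + ev g.
Proof.
move=> d c; apply: addend_ext => m; apply: fam_ext => X Y /=.
rewrite /act_raw cod_cadd // dom_cadd // -c -d; case: pselect => // E /=.
  by rewrite cmp_addl ?hcod.
by rewrite cadd_zm.
Qed.

Lemma ev_zm X Y : ev (zm X Y) = 0.
Proof.
apply: addend_ext => m; apply: fam_ext => X' Y' /=.
rewrite /act_raw cod_zm dom_zm; case: pselect => // E /=.
by rewrite cmp_zl ?hcod // hdom E.
Qed.

Lemma ev_opp f : ev (copp f) = - ev f.
Proof.
apply/eqP; rewrite -addr_eq0 -ev_add ?dom_copp ?cod_copp //.
by rewrite caddN ev_zm.
Qed.

(** A morphism is recovered from its action on the family with identities on the diagonal and zeros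
    elsewhere. Parallelism matters, as all zero morphisms act alike. *)
Lemma ev_inj f g : dom f = dom g -> cod f = cod g -> ev f = ev g -> f = g.
Proof.
move=> d c E.
have ok X Y : dom (if pselect (Y = X) then idm X else zm X Y) = X /\
              cod (if pselect (Y = X) then idm X else zm X Y) = Y.
  by case: pselect => [E'|_] /=; rewrite ?dom_id ?cod_id ?dom_zm ?cod_zm ?E'.
pose m : fam := fun X Y => MkHom (ok X Y).1 (ok X Y).2.
have val h : hval (act h m (dom h) (cod h)) = h.
  rewrite /= /act_raw; case: pselect => // _ /=.
  by case: pselect => // _ /=; rewrite cmp_id.
by rewrite -(val f) -[RHS](val g) -d -c -[act f]/(aeval (ev f)) E.
Qed.

End Additive.

(** * The suspension as a ring map *)

Section Suspension.
Variables (C : addcat) (S : autom C).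
Implicit Types (X Y Z : Ob C).
Local Notation Sg := (so S).
Local Notation Sm := (sm S).

Lemma sm_zm X Y : Sm (zm X Y) = zm (Sg X) (Sg Y).
Proof.
have := @cadd_inj0 _ (Sm (zm X Y)) _ erefl erefl.
by rewrite -sm_add // cadd_zm dom_sm cod_sm dom_zm cod_zm; apply.
Qed.

Lemma so_inv_ex : exists t : Ob C -> Ob C, cancel t Sg /\ cancel Sg t.
Proof. by have [t t1 t2] := so_bij S; exists t. Qed.

Definition so_inv : Ob C -> Ob C := proj1_sig (cid so_inv_ex).
Lemma so_invK X : Sg (so_inv X) = X.
Proof. by rewrite /so_inv; case: cid => t [t1 t2] /=. Qed.
Lemma soK X : so_inv (Sg X) = X.
Proof. by rewrite /so_inv; case: cid => t [t1 t2] /=. Qed.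

Lemma up_ok (m : fam C) X Y :
  dom (Sm (hval (m (so_inv X) (so_inv Y)))) = X /\
  cod (Sm (hval (m (so_inv X) (so_inv Y)))) = Y.
Proof. by rewrite dom_sm cod_sm hdom hcod !so_invK. Qed.
Definition up (m : fam C) : fam C := fun X Y => MkHom (up_ok m X Y).1 (up_ok m X Y).2.

Lemma down_ex (m : fam C) X Y : exists f,
  [/\ dom f = X, cod f = Y & Sm f = hval (m (Sg X) (Sg Y))].
Proof. by apply: (sm_surj (a := S)); rewrite ?hdom ?hcod. Qed.
Definition down_raw (m : fam C) X Y : Mor C := proj1_sig (cid (down_ex m X Y)).
Lemma down_rawE (m : fam C) X Y : Sm (down_raw m X Y) = hval (m (Sg X) (Sg Y)).
Proof. by rewrite /down_raw; case: cid => f [] /=. Qed.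
Lemma down_ok (m : fam C) X Y :
  dom (down_raw m X Y) = X /\ cod (down_raw m X Y) = Y.
Proof. by rewrite /down_raw; case: cid => f [] /=. Qed.
Definition down (m : fam C) : fam C := fun X Y => MkHom (down_ok m X Y).1 (down_ok m X Y).2.

Lemma upK m : down (up m) = m.
Proof.
apply: fam_ext => X Y; apply: (sm_inj (a := S)); rewrite ?hdom ?hcod //.
by rewrite down_rawE /= !soK.
Qed.

Lemma downK m : up (down m) = m.
Proof. by apply: fam_ext => X Y /=; rewrite down_rawE !so_invK. Qed.

Lemma upD m m' : up (m + m') = up m + up m'.
Proof. by apply: fam_ext => X Y /=; rewrite sm_add ?hdom ?hcod. Qed.

Lemma downD m m' : down (m + m') = down m + down m'.
Proof. by rewrite -{1}(downK m) -{1}(downK m') -upD upK. Qed.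

Lemma conj_additive (F : addend (fam C)) m m' :
  up (aeval F (down (m + m'))) = up (aeval F (down m)) + up (aeval F (down m')).
Proof. by rewrite downD aevalD upD. Qed.
(** Conjugating by a bijection of families makes the suspension injective on the entire ring, as
    [sg_inj] demands, and not just on elements coming from morphisms. *)
Definition conj (F : addend (fam C)) : addend (fam C) := Addend (conj_additive F).

Lemma conjD F G : conj (F + G) = conj F + conj G.
Proof. by apply: addend_ext => m /=; rewrite upD. Qed.
Lemma conjM F G : conj (F * G) = conj F * conj G.
Proof. by apply: addend_ext => m /=; rewrite upK. Qed.
Lemma conj_inj : injective conj.
Proof.
move=> F G E; apply: addend_ext => m.
have := congr1 (fun H => down (aeval H (up m))) E.
by rewrite /= !upK.
Qed.

Lemma conj_ev f : conj (ev f) = ev (Sm f).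
Proof.
apply: addend_ext => m; apply: fam_ext => X Y /=; rewrite /act_raw cod_sm dom_sm.
case: (pselect (so_inv Y = cod f)) => [E|E]; case: pselect => [E'|E'] /=.
- by rewrite sm_cmp ?hcod ?(down_ok m _ _).2 // down_rawE so_invK.
- by case: E'; rewrite -E so_invK.
- by case: E; rewrite E' soK.
- by rewrite sm_zm !so_invK.
Qed.

Definition rhom X Y (r : addend (fam C)) : Prop :=
  exists f, [/\ dom f = X, cod f = Y & ev f = r].

Lemma rhom_ev f : rhom (dom f) (cod f) (ev f). Proof. by exists f. Qed.

Lemma rhomI f X Y : dom f = X -> cod f = Y -> rhom X Y (ev f).
Proof. by move=> <- <-; apply: rhom_ev. Qed.

Lemma rhom0 X Y : rhom X Y 0.
Proof. by rewrite -(ev_zm X Y); apply: rhomI; rewrite ?dom_zm ?cod_zm. Qed.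
Lemma rhomD X Y r s : rhom X Y r -> rhom X Y s -> rhom X Y (r + s).
Proof.
move=> [f [df cf <-]] [g [dg cg <-]]; rewrite -ev_add ?df ?cf //.
by apply: rhomI; rewrite ?dom_cadd ?cod_cadd ?df ?cf.
Qed.
Lemma rhomN X Y r : rhom X Y r -> rhom X Y (- r).
Proof.
by move=> [f [df cf <-]]; rewrite -ev_opp; apply: rhomI; rewrite ?dom_copp ?cod_copp.
Qed.
Lemma rhomM X Y Z r s : rhom X Y r -> rhom Y Z s -> rhom X Z (s * r).
Proof.
move=> [f [df cf <-]] [g [dg cg <-]]; rewrite -ev_cmp ?cf ?dg //.
by apply: rhomI; rewrite ?dom_cmp ?cod_cmp ?cf ?dg.
Qed.
Lemma rhom_id X : rhom X X (ev (idm X)).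
Proof. by apply: rhomI; rewrite ?dom_id ?cod_id. Qed.
Lemma rmul_id X Y r : rhom X Y r -> r * ev (idm X) = r.
Proof. by move=> [f [<- cf <-]]; rewrite -ev_cmp ?cod_id // cmp_id. Qed.
Lemma rid_mul X Y r : rhom X Y r -> ev (idm Y) * r = r.
Proof. by move=> [f [df <- <-]]; rewrite -ev_cmp ?dom_id // id_cmp. Qed.
Lemma rid_z : ev (idm (z0 : Ob C)) = 0.
Proof. by rewrite (z0_initial (dom_id z0)) ev_zm. Qed.
Lemma rsg_id X : conj (ev (idm X)) = ev (idm (Sg X)).
Proof. by rewrite conj_ev sm_id. Qed.
Lemma rhom_sg X Y r : rhom X Y r -> rhom (Sg X) (Sg Y) (conj r).
Proof.
by move=> [f [df cf <-]]; rewrite conj_ev; apply: rhomI; rewrite ?dom_sm ?cod_sm ?df ?cf.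
Qed.
Lemma rsg_full X Y r : rhom (Sg X) (Sg Y) r -> exists s, rhom X Y s /\ conj s = r.
Proof.
move=> [g [dg cg <-]]; have [f [df cf E]] := sm_surj dg cg.
by exists (ev f); split; [apply: rhomI|rewrite conj_ev E].
Qed.
Lemma rso_surj Y : exists X, Sg X = Y.
Proof. by exists (so_inv Y); rewrite so_invK. Qed.
Lemma rhom_j1 X Y : rhom X (bp X Y) (ev (bi1 X Y)).
Proof. by apply: rhomI; rewrite ?dom_bi1 ?cod_bi1. Qed.
Lemma rhom_j2 X Y : rhom Y (bp X Y) (ev (bi2 X Y)).
Proof. by apply: rhomI; rewrite ?dom_bi2 ?cod_bi2. Qed.
Lemma rhom_q1 X Y : rhom (bp X Y) X (ev (bq1 X Y)).
Proof. by apply: rhomI; rewrite ?dom_bq1 ?cod_bq1. Qed.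
Lemma rhom_q2 X Y : rhom (bp X Y) Y (ev (bq2 X Y)).
Proof. by apply: rhomI; rewrite ?dom_bq2 ?cod_bq2. Qed.
Lemma rq1j1 X Y : ev (bq1 X Y) * ev (bi1 X Y) = ev (idm X).
Proof. by rewrite -ev_cmp ?cod_bi1 ?dom_bq1 // bq1i1. Qed.
Lemma rq2j2 X Y : ev (bq2 X Y) * ev (bi2 X Y) = ev (idm Y).
Proof. by rewrite -ev_cmp ?cod_bi2 ?dom_bq2 // bq2i2. Qed.
Lemma rq1j2 X Y : ev (bq1 X Y) * ev (bi2 X Y) = 0.
Proof. by rewrite -ev_cmp ?cod_bi2 ?dom_bq1 // bq1i2 ev_zm. Qed.
Lemma rq2j1 X Y : ev (bq2 X Y) * ev (bi1 X Y) = 0.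
Proof. by rewrite -ev_cmp ?cod_bi1 ?dom_bq2 // bq2i1 ev_zm. Qed.
Lemma rjq_id X Y : ev (bi1 X Y) * ev (bq1 X Y) + ev (bi2 X Y) * ev (bq2 X Y)
  = ev (idm (bp X Y)).
Proof.
rewrite -!ev_cmp ?cod_bq1 ?dom_bi1 ?cod_bq2 ?dom_bi2 // -ev_add ?bp_id //.
  by rewrite !dom_cmp ?cod_bq1 ?dom_bi1 ?cod_bq2 ?dom_bi2 ?dom_bq1 ?dom_bq2.
by rewrite !cod_cmp ?cod_bq1 ?dom_bi1 ?cod_bq2 ?dom_bi2 ?cod_bi1 ?cod_bi2.
Qed.

Definition lin : lincat :=
  LinCat rhom0 rhomD rhomN rhomM rhom_id rmul_id rid_mul rid_z conjD conjM rsg_id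
    rhom_sg rsg_full conj_inj rso_surj rhom_j1 rhom_j2 rhom_q1 rhom_q2
    rq1j1 rq2j2 rq1j2 rq2j1 rjq_id.

End Suspension.

(** * Translating morphisms and matrices *)

Section Represent.
Variables (C : addcat) (S : autom C).
Local Notation L := (lin S).
Local Notation Sg := (so S).
Local Notation Sm := (sm S).
Implicit Types (X Y Z : Ob C) (u v : Mor C) (r s : lring L).

Definition rep u X Y r : Prop := [/\ dom u = X, cod u = Y & ev u = r :> lring L].

Lemma rep_hom u X Y r : rep u X Y r -> hom (l := L) X Y r.
Proof. by exists u. Qed.

Lemma rep_inj u v X Y r : rep u X Y r -> rep v X Y r -> u = v.
Proof. by move=> [d c e] [d' c' e']; apply: ev_inj; rewrite ?d ?c ?d' ?c' ?e ?e'. Qed.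

Lemma rep_eq u X Y r s : rep u X Y r -> r = s -> rep u X Y s.
Proof. by move=> H <-. Qed.

Lemma rep_zm X Y : rep (zm X Y) X Y 0.
Proof. by split; [exact: dom_zm|exact: cod_zm|exact: ev_zm]. Qed.

Lemma rep_id X : rep (idm X) X X (lid (l := L) X).
Proof. by split; [exact: dom_id|exact: cod_id|]. Qed.

Lemma rep_cmp u v X Y Z r s : rep u X Y r -> rep v Y Z s -> rep (cmp v u) X Z (s * r).
Proof.
move=> [d c e] [d' c' e'].
by split; rewrite ?dom_cmp ?cod_cmp ?c ?d' // ev_cmp ?c ?d' // e e'.
Qed.

Lemma rep_add u v X Y r s : rep u X Y r -> rep v X Y s -> rep (cadd u v) X Y (r + s).
Proof.
move=> [d c e] [d' c' e'].
by split; rewrite ?dom_cadd ?cod_cadd ?c ?d // ev_add ?c ?d // e e'.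
Qed.

Lemma rep_opp u X Y r : rep u X Y r -> rep (copp u) X Y (- r).
Proof. by move=> [d c e]; split; rewrite ?dom_copp ?cod_copp // ev_opp e. Qed.

Lemma rep_sm u X Y r : rep u X Y r -> rep (Sm u) (Sg X) (Sg Y) (sg r).
Proof. by move=> [d c e]; split; rewrite ?dom_sm ?cod_sm ?d ?c // -conj_ev e. Qed.

Lemma rep_signm k u X Y r : rep u X Y r -> rep (signm k u) X Y (sgn k r).
Proof. by rewrite /signm /sgn; case: odd => // H; apply: rep_opp. Qed.

Lemma rep_j1 X Y : rep (bi1 X Y) X (bp X Y) (lj1 (l := L) X Y).
Proof. by split; rewrite ?dom_bi1 ?cod_bi1. Qed.
Lemma rep_j2 X Y : rep (bi2 X Y) Y (bp X Y) (lj2 (l := L) X Y).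
Proof. by split; rewrite ?dom_bi2 ?cod_bi2. Qed.
Lemma rep_q1 X Y : rep (bq1 X Y) (bp X Y) X (lq1 (l := L) X Y).
Proof. by split; rewrite ?dom_bq1 ?cod_bq1. Qed.
Lemma rep_q2 X Y : rep (bq2 X Y) (bp X Y) Y (lq2 (l := L) X Y).
Proof. by split; rewrite ?dom_bq2 ?cod_bq2. Qed.

Lemma rep_mat2 X1 X2 Y1 Y2 (a b c d : Mor C) (ra rb rc rd : lring L) :
  rep a X1 Y1 ra -> rep b X2 Y1 rb -> rep c X1 Y2 rc -> rep d X2 Y2 rd ->
  rep (mat2 X1 X2 Y1 Y2 a b c d) (bp X1 X2) (bp Y1 Y2)
    (lj1 (l := L) Y1 Y2 * (ra * lq1 (l := L) X1 X2) + lj1 (l := L) Y1 Y2 * (rb * lq2 (l := L) X1 X2)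
     + (lj2 (l := L) Y1 Y2 * (rc * lq1 (l := L) X1 X2) + lj2 (l := L) Y1 Y2 * (rd * lq2 (l := L) X1 X2))).
Proof.
move=> Ha Hb Hc Hd; have j1 := rep_j1 Y1 Y2; have j2 := rep_j2 Y1 Y2.
have q1 := rep_q1 X1 X2; have q2 := rep_q2 X1 X2.
by apply: rep_add; apply: rep_add; (apply: rep_cmp; [apply: rep_cmp|]); eassumption.
Qed.

Lemma rep_sig_bp X Y : rep (sig_bp S X Y) (bp (Sg X) (Sg Y)) (Sg (bp X Y))
  (sg (lj1 (l := L) X Y) * lq1 (l := L) (Sg X) (Sg Y)
   + sg (lj2 (l := L) X Y) * lq2 (l := L) (Sg X) (Sg Y)).
Proof.
apply: rep_add; (apply: rep_cmp; first by [exact: rep_q1|exact: rep_q2]).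
  by apply: rep_sm; apply: rep_j1.
by apply: rep_sm; apply: rep_j2.
Qed.

(** The identification of Sigma Y1 + Sigma Y2 with Sigma (Y1 + Y2) merely replaces the injections by
    the suspended ones, which is the form the charts of [bpX] take at [n.+1]. *)
Lemma rep_sig_mat2 X1 X2 Y1 Y2 (a b c d : Mor C) (ra rb rc rd : lring L) :
  rep a X1 (Sg Y1) ra -> rep b X2 (Sg Y1) rb ->
  rep c X1 (Sg Y2) rc -> rep d X2 (Sg Y2) rd ->
  rep (cmp (sig_bp S Y1 Y2) (mat2 X1 X2 (Sg Y1) (Sg Y2) a b c d))
    (bp X1 X2) (Sg (bp Y1 Y2))
    (sg (lj1 (l := L) Y1 Y2) * (ra * lq1 (l := L) X1 X2) + sg (lj1 (l := L) Y1 Y2) * (rb * lq2 (l := L) X1 X2)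
     + (sg (lj2 (l := L) Y1 Y2) * (rc * lq1 (l := L) X1 X2) + sg (lj2 (l := L) Y1 Y2) * (rd * lq2 (l := L) X1 X2))).
Proof.
move=> Ha Hb Hc Hd.
apply: rep_eq (rep_cmp (rep_mat2 Ha Hb Hc Hd) (rep_sig_bp Y1 Y2)) _.
have c1 := lbpP (L := L) (Sg Y1) (Sg Y2).
have {Ha} ha := rep_hom Ha; have {Hb} hb := rep_hom Hb.
have {Hc} hc := rep_hom Hc; have {Hd} hd := rep_hom Hd.
clear -c1 ha hb hc hd; nct.
Qed.

(** The zero morphism serves as default when [r] represents nothing from [X] to [Y], so that [raw]
    is total. *)
Lemma raw_ex X Y r : exists u, hom (l := L) X Y r -> rep u X Y r.
Proof.
have [[u [d c e]]|H] := pselect (hom (l := L) X Y r); first by exists u.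
by exists (zm X Y).
Qed.
Definition raw X Y r : Mor C := proj1_sig (cid (raw_ex X Y r)).
Lemma rawP X Y r : hom (l := L) X Y r -> rep (raw X Y r) X Y r.
Proof. by rewrite /raw; case: cid. Qed.

Implicit Types o : option (Ob C).

Lemma oobE o : oob o = lo (L := L) o. Proof. by case: o. Qed.
Lemma osumE o o' : osum o o' = losum (L := L) o o'. Proof. by case: o => //; case: o'. Qed.
Lemma osum3E o o' o'' : osum3 o o' o'' = losum (L := L) o (losum (L := L) o' o'').
Proof. by rewrite /osum3 !osumE. Qed.

Lemma rep_oin1 o o' : rep (oin1 o o') (oob o) (oob (osum o o')) (oj1 (L := L) o o').
Proof. by case: o => [X|]; case: o' => [Y|] /=; first [exact: rep_j1|exact: rep_id|exact: rep_zm]. Qed.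
Lemma rep_oin2 o o' : rep (oin2 o o') (oob o') (oob (osum o o')) (oj2 (L := L) o o').
Proof. by case: o => [X|]; case: o' => [Y|] /=; first [exact: rep_j2|exact: rep_id|exact: rep_zm]. Qed.
Lemma rep_opr1 o o' : rep (opr1 o o') (oob (osum o o')) (oob o) (oq1 (L := L) o o').
Proof. by case: o => [X|]; case: o' => [Y|] /=; first [exact: rep_q1|exact: rep_id|exact: rep_zm]. Qed.
Lemma rep_opr2 o o' : rep (opr2 o o') (oob (osum o o')) (oob o') (oq2 (L := L) o o').
Proof. by case: o => [X|]; case: o' => [Y|] /=; first [exact: rep_q2|exact: rep_id|exact: rep_zm]. Qed.

Definition oj3 o o' o'' (k : nat) : lring L :=
  match k with
  | 0 => oj1 (L := L) o (osum o' o'')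
  | 1 => oj2 (L := L) o (osum o' o'') * oj1 (L := L) o' o''
  | _ => oj2 (L := L) o (osum o' o'') * oj2 (L := L) o' o''
  end.
Definition oq3 o o' o'' (k : nat) : lring L :=
  match k with
  | 0 => oq1 (L := L) o (osum o' o'')
  | 1 => oq1 (L := L) o' o'' * oq2 (L := L) o (osum o' o'')
  | _ => oq2 (L := L) o' o'' * oq2 (L := L) o (osum o' o'')
  end.

Lemma rep_oin3 o o' o'' k :
  rep (oin3 o o' o'' k) (oob (nth3 o o' o'' k)) (oob (osum3 o o' o'')) (oj3 o o' o'' k).
Proof.
case: k => [|[|k]] /=; first exact: rep_oin1.
  by apply: rep_cmp; [exact: rep_oin1|exact: rep_oin2].
by apply: rep_cmp; [exact: rep_oin2|exact: rep_oin2].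
Qed.
Lemma rep_opr3 o o' o'' k :
  rep (opr3 o o' o'' k) (oob (osum3 o o' o'')) (oob (nth3 o o' o'' k)) (oq3 o o' o'' k).
Proof.
case: k => [|[|k]] /=; first exact: rep_opr1.
  by apply: rep_cmp; [exact: rep_opr2|exact: rep_opr1].
by apply: rep_cmp; [exact: rep_opr2|exact: rep_opr2].
Qed.

Lemma oj3_None o o' o'' k : opres (nth3 o o' o'' k) = false -> oj3 o o' o'' k = 0.
Proof.
by case: k => [|[|k]] /=; case: o; case: o'; case: o'' => //= *; rewrite ?mulr0 ?mul0r.
Qed.
Lemma oq3_None o o' o'' k : opres (nth3 o o' o'' k) = false -> oq3 o o' o'' k = 0.
Proof.
by case: k => [|[|k]] /=; case: o; case: o'; case: o'' => //= *; rewrite ?mulr0 ?mul0r.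
Qed.

(** Deleted entries are zero morphisms on the left; in the sum of nine terms the injection or
    projection of a missing summand is 0, so the terms agree whatever [m] is there. *)
Lemma rep_mat3 (s0 s1 s2 t0 t1 t2 : option (Ob C)) M (m : nat -> nat -> lring L) :
  (forall i j, (i < 3)%N -> (j < 3)%N ->
    opres (nth3 t0 t1 t2 i) -> opres (nth3 s0 s1 s2 j) ->
    rep (M i j) (oob (nth3 s0 s1 s2 j)) (oob (nth3 t0 t1 t2 i)) (m i j)) ->
  rep (mat3 s0 s1 s2 t0 t1 t2 M) (oob (osum3 s0 s1 s2)) (oob (osum3 t0 t1 t2))
    (\sum_(ij <- [seq (i, j) | i <- iota 0 3, j <- iota 0 3])
       oj3 t0 t1 t2 ij.1 * m ij.1 ij.2 * oq3 s0 s1 s2 ij.2).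
Proof.
move=> H; rewrite /mat3; set l := [seq _ | _ <- _, _ <- _].
have : all (fun ij => (ij.1 < 3)%N && (ij.2 < 3)%N) l by [].
elim: l => [|[i j] l IH] /=; first by rewrite big_nil => _; exact: rep_zm.
move=> /andP[/andP[i3 j3] /IH {}IH]; rewrite big_cons; apply: rep_add IH => /=.
case: ifP => [/andP[ti sj]|/negbT].
  rewrite -mulrA; apply: rep_cmp (rep_oin3 _ _ _ _).
  exact: rep_cmp (rep_opr3 _ _ _ _) (H _ _ i3 j3 ti sj).
rewrite negb_and => /orP[/negbTE ti|/negbTE sj].
  by rewrite (oj3_None ti) !mul0r; exact: rep_zm.
by rewrite (oq3_None sj) mulr0; exact: rep_zm.
Qed.

Lemma sum33 (F : nat -> nat -> lring L) :
  \sum_(ij <- [seq (i, j) | i <- iota 0 3, j <- iota 0 3]) F ij.1 ij.2 =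
  F 0%N 0%N + (F 0%N 1%N + (F 0%N 2%N + (F 1%N 0%N + (F 1%N 1%N + (F 1%N 2%N
   + (F 2%N 0%N + (F 2%N 1%N + F 2%N 2%N))))))).
Proof. by rewrite /= !big_cons big_nil /= addr0. Qed.

End Represent.

(** * Translating sequences and axioms *)

Section Transfer.
Variables (C : addcat) (S : autom C) (n : nat).
Hypothesis n3 : (3 <= n)%N.
Local Notation L := (lin S).
Local Notation Sg := (so S).
Local Notation Sm := (sm S).
Implicit Types (A B : sseq C) (X Y : nat -> Ob C) (f g a : nat -> lring L).

Definition mrep A X f : Prop :=
  [/\ forall i, (0 < i <= n)%N -> sob A i = X i,
      forall i, (0 < i <= n)%N -> rep (smor A i) (X i) (X i.+1) (f i)
    & X n.+1 = Sg (X 1%N)].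

Lemma mrep_seq A X f : mrep A X f -> is_seq S n A.
Proof.
move=> [Ao Am Xn]; split=> [i i_n|].
  have [-> -> _] := Am i ltac:(lia).
  by rewrite !Ao //; lia.
have [-> -> _] := Am n ltac:(lia).
by rewrite Xn !Ao //; lia.
Qed.

Lemma mrep_lseq A X f : mrep A X f -> lseq (L := L) n X f.
Proof. by move=> [_ Am Xn]; split=> // i i_n; apply: rep_hom (Am i i_n). Qed.

Definition seqX A i : Ob C := if (i <= n)%N then sob A i else Sg (sob A 1%N).
Definition seqf A i : lring L := ev (smor A i).

Lemma seq_mrep A : is_seq S n A -> mrep A (seqX A) (seqf A).
Proof.
move=> [Ai [And Anc]]; split=> [i i_n|i i_n|]; rewrite /seqX.
- by ifs.
- have [i_lt|i_ge] := ltnP i n.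
    by have [d c] := Ai i ltac:(lia); ifs; split.
  have -> : i = n by lia.
  by ifs; split.
- by ifs.
Qed.

Definition unlin X f : sseq C := SSeq X (fun i => raw (X i) (X i.+1) (f i)).

Lemma unlin_mrep X f : lseq (L := L) n X f -> mrep (unlin X f) X f.
Proof. by move=> [Xh Xn]; split=> // i i_n; apply: rawP; apply: Xh. Qed.

Definition linm (u : nat -> Mor C) i : lring L :=
  if (i <= n)%N then ev (u i) else sg (ev (u 1%N) : lring L).
Definition rawm X Y a i : Mor C := raw (X i) (Y i) (a i).

Lemma smorph_lmor A B X Y f g u : mrep A X f -> mrep B Y g -> is_smorph S n A B u ->
  lmor (L := L) n X f Y g (linm u) /\
  forall i, (0 < i <= n)%N -> rep (u i) (X i) (Y i) (linm u i).
Proof.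
move=> [Ao Am Xn] [Bo Bm Yn] [ut uc un].
have ur i : (0 < i <= n)%N -> rep (u i) (X i) (Y i) (linm u i).
  move=> i_n; have [d c] := ut i i_n; rewrite Ao // in d; rewrite Bo // in c.
  by split=> //; rewrite /linm; ifs.
have u1 := ur 1%N ltac:(lia).
have uE : linm u n.+1 = sg (linm u 1%N) by rewrite /linm; ifs.
split=> //; split=> // [i i_n|i i_n].
  have [i_le|i_gt] := leqP i n; first by apply: rep_hom (ur i _); lia.
  have -> : i = n.+1 by lia.
  by rewrite uE Xn Yn; apply: rep_hom (rep_sm u1).
have [i_lt|i_ge] := ltnP i n.
  have [_ _ <-] := rep_cmp (Am i i_n) (ur i.+1 ltac:(lia)).
  have [_ _ <-] := rep_cmp (ur i i_n) (Bm i i_n).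
  by rewrite uc //; lia.
have iE : i = n by lia.
subst i; rewrite uE; have An := Am n i_n; have Bn := Bm n i_n.
rewrite Xn in An; rewrite Yn in Bn.
have [_ _ <-] := rep_cmp An (rep_sm u1).
have [_ _ <-] := rep_cmp (ur n i_n) Bn.
by rewrite un.
Qed.

Lemma lmor_rep X Y f g a i : lmor (L := L) n X f Y g a -> (0 < i <= n.+1)%N ->
  rep (rawm X Y a i) (X i) (Y i) (a i).
Proof. by move=> [ah _ _] i_n; apply: rawP; apply: ah. Qed.

Lemma lmor_smorph A B X Y f g a : mrep A X f -> mrep B Y g ->
  lmor (L := L) n X f Y g a -> is_smorph S n A B (rawm X Y a).
Proof.
move=> [Ao Am Xn] [Bo Bm Yn] am; have ar i := lmor_rep (i := i) am.
have [_ ac an] := am; split=> [i i_n|i i_n|].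
- by have [-> -> _] := ar i ltac:(lia); rewrite Ao // Bo.
- apply: (rep_inj (rep_cmp (Am i ltac:(lia)) (ar i.+1 ltac:(lia)))).
  rewrite ac; last by lia.
  exact: rep_cmp (ar i ltac:(lia)) (Bm i ltac:(lia)).
- have An := Am n ltac:(lia); have Bn := Bm n ltac:(lia).
  rewrite Xn in An; rewrite Yn in Bn.
  apply: (rep_inj (rep_cmp An (rep_sm (ar 1%N ltac:(lia))))).
  rewrite -an ac; last by lia.
  exact: rep_cmp (ar n ltac:(lia)) Bn.
Qed.

Lemma mrep_dsum A B X Y f g : mrep A X f -> mrep B Y g ->
  mrep (dsum S n A B) (bpX (L := L) n X Y) (lsum (L := L) n X f Y g).
Proof.
move=> [Ao Am Xn] [Bo Bm Yn].
split=> [i i_n|i i_n|]; last exact: (bpX_last (L := L) _ _ (ltnW (ltnW n3))).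
  by rewrite /bpX; ifs; rewrite /= Ao // Bo.
rewrite [smor _ _]/= /lsum /bpX /J1 /J2 /Q1 /Q2.
have [i_lt|i_ge] := ltnP i n; ifs.
  rewrite !Ao ?Bo; try lia.
  apply: rep_eq (rep_mat2 (Am i i_n) (rep_zm S _ _) (rep_zm S _ _) (Bm i i_n)) _.
  by clear; nc.
have iE : i = n by lia.
subst i; have An := Am n i_n; have Bn := Bm n i_n.
rewrite Xn in An; rewrite Yn in Bn.
rewrite !Ao ?Bo; try lia.
apply: rep_eq (rep_sig_mat2 An (rep_zm S _ _) (rep_zm S _ _) Bn) _.
by clear; nc.
Qed.

Lemma mrep_triv T : mrep (trivseq S n T) (ltrivX (L := L) n T) (ltrivf (L := L) T).
Proof.
split=> [i i_n|i i_n|]; last by rewrite /ltrivX; ifs.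
  by rewrite /ltrivX /=; case: ifP => // _; ifs.
rewrite /ltrivX /ltrivf /=.
have [->|i1] := eqVneq i 1%N; first exact: rep_id.
have [->|i2] := eqVneq i 2%N; first by ifs; exact: rep_zm.
have [iE|i4] := eqVneq i n; first by ifs; exact: rep_zm.
by ifs; exact: rep_zm.
Qed.

Lemma mrep_lrot A X f : mrep A X f ->
  mrep (lrot S n A) (rotX (L := L) n X) (rotf (L := L) n f).
Proof.
move=> H; have [Ao Am Xn] := H.
split=> [i i_n|i i_n|]; last by rewrite /rotX; ifs.
  rewrite /rotX /=; have [i_lt|i_ge] := ltnP i n; ifs; first by rewrite Ao //; lia.
  have -> : i = n by lia.
  by rewrite Xn Ao //; lia.
rewrite /rotX /rotf /=; have [i_lt|i_ge] := ltnP i n; ifs; first by apply: Am; lia.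
have -> : i = n by lia.
by rewrite Xn; apply: rep_signm; apply: rep_sm; apply: Am; lia.
Qed.

Lemma mrep_cone A B X Y f g u a : mrep A X f -> mrep B Y g ->
  (forall i, (0 < i <= n)%N -> rep (u i) (X i) (Y i) (a i)) -> a n.+1 = sg (a 1%N) ->
  mrep (cone S n A B u) (lconeX (L := L) n X Y) (lconef (L := L) n X f Y g a).
Proof.
move=> [Ao Am Xn] [Bo Bm Yn] ur un.
have coneE i : (0 < i <= n)%N -> coneA S n A i = X i.+1.
  rewrite /coneA => i_n; have [i_lt|i_ge] := ltnP i n; first by rewrite Ao //; lia.
  have -> : i = n by lia.
  by rewrite Xn Ao //; lia.
split=> [i i_n|i i_n|]; last exact: (bpX_last (L := L) _ _ (ltnW (ltnW n3))).
  by rewrite /lconeX /bpX /coneU /extX; ifs; rewrite /= coneE // Bo.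
rewrite [smor _ _]/= /lconef /lconeX /bpX /J1 /J2 /Q1 /Q2 /coneU /extX /extf.
have [i_lt|i_ge] := ltnP i n; ifs.
  rewrite !coneE ?Bo; try lia.
  apply: rep_eq (rep_mat2 (rep_opp (Am i.+1 ltac:(lia))) (rep_zm S _ _)
     (ur i.+1 ltac:(lia)) (Bm i i_n)) _.
  by clear; nc.
have iE : i = n by lia.
subst i; have Bn := Bm n i_n; rewrite Yn in Bn.
rewrite !Ao ?Bo; try lia.
rewrite -Xn un.
have A1 := rep_opp (rep_sm (Am 1%N ltac:(lia))).
have U1 := rep_sm (ur 1%N ltac:(lia)); rewrite -Xn in A1 U1.
apply: rep_eq (rep_sig_mat2 A1 (rep_zm S _ _) U1 Bn) _.
by clear; nc.
Qed.

Lemma mrep_Dseq A B D X Y Z f g h u a psi pA pB :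
  mrep A X f -> mrep B Y g -> mrep D Z h -> Z 1%N = X 2%N ->
  (forall i, (0 < i <= n)%N -> rep (u i) (X i) (Y i) (a i)) ->
  (forall i, (1 < i < n)%N -> rep (psi (2 * i - 3)%N) (Y i.+1) (Z i.+1) (pB i)) ->
  (forall i, (1 < i < n.-1)%N -> rep (psi (2 * i - 2)%N) (X i.+2) (Z i.+1) (pA i.+2)) ->
  mrep (Dseq S n A B D u psi) (LDX (L := L) n X Y Z)
    (LDf (L := L) n X Y Z f g h a pA pB).
Proof.
move=> [Ao Am Xn] [Bo Bm Yn] [Do Dm Zn] ZX ur pBr pAr.
have EA i : (0 < i)%N -> DA n A i = dA (L := L) n X i.
  by move=> i0; rewrite /DA /dA; case: ifP => // i_n; rewrite Ao //; lia.
have EB i : (0 < i)%N -> DB n B i = dB (L := L) n Y i.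
  by move=> i0; rewrite /DB /dB; case: ifP => // i_n; rewrite Bo //; lia.
have EC i : (i <= n)%N -> DC D i = dC (L := L) Z i.
  by move=> i0; rewrite /DC /dC; case: ifP => // i_n; rewrite Do //; lia.
have OE i : (0 < i <= n)%N ->
    oob (osum3 (dA (L := L) n X i) (dB (L := L) n Y i) (dC (L := L) Z i)) = dO (L := L) n X Y Z i.
  by move=> _; rewrite (oobE S) (osum3E S).
split=> [i i_n|i i_n|]; last by rewrite /LDX; ifs.
  rewrite /LDX [sob _ _]/=; have [_|i1] := eqVneq i 1%N; first by rewrite Ao //; lia.
  by ifs; rewrite EA ?EB ?EC ?OE //; lia.
rewrite [smor _ _]/=; have [->|i1] := eqVneq i 1%N.
  rewrite EA ?EB ?EC ?Ao; try lia.
  have -> : LDX (L := L) n X Y Z 1%N = X 3%N by [].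
  have -> : LDX (L := L) n X Y Z 2%N = dO (L := L) n X Y Z 2%N by rewrite /LDX; ifs.
  rewrite -OE; last by lia.
  pose m (r c : nat) : lring L :=
    match r with 0 => da n f 1%N | 1 => dphi n a 1%N | _ => 0 end.
  apply: rep_eq (rep_mat3 (S := S) (m := m) _) _; last first.
    rewrite (sum33 (fun i j => oj3 S _ _ _ i * m i j * oq3 S _ _ _ j)).
    have q0 : oq3 S (Some (X 3%N)) None None 0%N = lid (l := L) (X 3%N) by [].
    have q1 : oq3 S (Some (X 3%N)) None None 1%N = 0 by rewrite oq3_None.
    have q2 : oq3 S (Some (X 3%N)) None None 2%N = 0 by rewrite oq3_None.
    rewrite q0 q1 q2.
    have t1 : da n f 1%N * lid (l := L) (X 3%N) = da n f 1%N.
      rewrite /da; case: ifP => i4; last by rewrite mul0r.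
      by apply: mul_id; apply: rep_hom (Am 3%N _); lia.
    have t2 : dphi n a 1%N * lid (l := L) (X 3%N) = dphi n a 1%N.
      rewrite /dphi; case: ifP => i4; last by rewrite mul0r.
      by apply: mul_id; apply: rep_hom (ur 3%N _); lia.
    rewrite /LDf eqxx /m /oj3 (osumE S) -/(dj1 (L := L) n X Y Z 2) -/(dj2 (L := L) n X Y Z 2).
    rewrite -/(ej1 (L := L) n Y Z 2) -/(ej2 (L := L) n Y Z 2).
    clear -t1 t2; nc.
  move=> [|[|[|r]]] [|[|[|c]]] //= _ _; rewrite /dA /dB /dC; case: ifP => // r_n _ _.
    by rewrite /m /da r_n; apply: Am; lia.
  by rewrite /m /dphi n3; apply: ur; lia.
have [i_lt|i_ge] := ltnP i n; last first.
  have -> : i = n by lia.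
  have -> : LDX (L := L) n X Y Z n = Z n.
    by have [_ [_ _ _ _ ->]] := d_last0 (L := L) n3 X Y Z (erefl n).
  rewrite /LDX /LDf; ifs.
  have Dn := Dm n ltac:(lia); rewrite Zn ZX in Dn.
  exact: rep_cmp Dn (rep_sm (Am 2%N ltac:(lia))).
rewrite !EA ?EB ?EC; try lia.
have -> : LDX (L := L) n X Y Z i = dO (L := L) n X Y Z i by rewrite /LDX; ifs.
have -> : LDX (L := L) n X Y Z i.+1 = dO (L := L) n X Y Z i.+1 by rewrite /LDX; ifs.
rewrite -!OE; try lia.
pose m (r c : nat) : lring L :=
  match r, c with
  | 0, 0 => - da n f i
  | 0, _ => 0
  | 1, 0 => sgn i (dphi n a i)
  | 1, 1 => - db n g i
  | 1, _ => 0
  | _, 0 => dphi n pA i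
  | _, 1 => pB i
  | _, _ => dc h i
  end.
apply: rep_eq (rep_mat3 (S := S) (m := m) _) _; last first.
  rewrite (sum33 (fun i j => oj3 S _ _ _ i * m i j * oq3 S _ _ _ j)).
  rewrite /LDf; ifs; rewrite /m /oj3 /oq3 !(osumE S).
  rewrite -/(dj1 (L := L) n X Y Z i.+1) -/(dj2 (L := L) n X Y Z i.+1) -/(ej1 (L := L) n Y Z i.+1) -/(ej2 (L := L) n Y Z i.+1).
  rewrite -/(dq1 (L := L) n X Y Z i) -/(dq2 (L := L) n X Y Z i) -/(eq1 (L := L) n Y Z i) -/(eq2 (L := L) n Y Z i).
  clear; nc.
have dAE : opres (dA (L := L) n X i) -> (i.+2 <= n)%N by rewrite /dA; case: ifP.
have dAE' : opres (dA (L := L) n X i.+1) -> (i.+3 <= n)%N by rewrite /dA; case: ifP.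
have dBE : opres (dB (L := L) n Y i) -> (i.+1 <= n)%N by rewrite /dB; case: ifP.
have dBE' : opres (dB (L := L) n Y i.+1) -> (i.+2 <= n)%N by rewrite /dB; case: ifP.
have dCE : opres (dC (L := L) Z i) -> (3 <= i)%N by rewrite /dC; case: ifP.
have dCE' : opres (dC (L := L) Z i.+1) -> (3 <= i.+1)%N by rewrite /dC; case: ifP.
move=> [|[|[|r]]] [|[|[|c]]] // _ _ /= => [/dAE' k /dAE k'|/dAE' k /dBE k'|/dAE' k /dCE k'
  |/dBE' k /dAE k'|/dBE' k /dBE k'|/dBE' k /dCE k'|/dCE' k /dAE k'|/dCE' k /dBE k'|/dCE' k /dCE k'];
  rewrite /dA /dB /dC; ifs => /=.
- by rewrite /da k; apply: rep_opp; apply: Am; lia.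
- by rewrite Ao ?Bo; try lia; apply: rep_zm.
- by rewrite Ao ?Do; try lia; apply: rep_zm.
- by rewrite /dphi k; apply: rep_signm; apply: ur; lia.
- by rewrite /db k; apply: rep_opp; apply: Bm; lia.
- by rewrite Bo ?Do; try lia; apply: rep_zm.
- by rewrite /dphi k'; apply: pAr; lia.
- by apply: pBr; lia.
- by rewrite /dc k'; apply: Dm; lia.
Qed.

Variable N : sseq C -> Prop.
Hypothesis Nseq : forall A, N A -> is_seq S n A.
Hypotheses (H1 : N1 S n N) (H2 : N2 S n N) (H3 : N3 S n N).

Definition NL X f : Prop := exists A, N A /\ mrep A X f.

(** Two sequences with the same representation may differ as functions at meaningless indices.
    Identities form an isomorphism between them, so closure under isomorphisms makes [NL]
    independent of the chosen representative. *)
Lemma mrep_N A B X f : N A -> mrep A X f -> mrep B X f -> N B.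
Proof.
move=> NA HA HB; have [_ _ Niso _ _] := H1.
apply: (Niso A) => //; first exact: mrep_seq HB.
have [Xh Xn] := mrep_lseq HA.
have im : lmor (L := L) n X f X f (fun i => lid (l := L) (X i)).
  split=> [i i_n|i i_n|]; first exact: hom_id.
    by rewrite (id_mul (Xh i i_n)) (mul_id (Xh i i_n)).
  by rewrite Xn -[LHS]/(lid (lso (X 1%N : lob L))) -sg_id.
exists (rawm X X (fun i => lid (l := L) (X i))); split; first exact: lmor_smorph HA HB im.
move=> i i_n; have -> : rawm X X (fun i => lid (l := L) (X i)) i = idm (X i).
  by apply: rep_inj (lmor_rep im _) (rep_id S _); lia.
have E := cmp_id (idm (X i)); rewrite dom_id in E.
by exists (idm (X i)); rewrite dom_id cod_id E.
Qed.

Lemma NL_seq A : N A -> NL (seqX A) (seqf A).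
Proof. by move=> NA; exists A; split=> //; apply: seq_mrep; apply: Nseq. Qed.

Lemma NL_unlin X f : lseq (L := L) n X f -> N (unlin X f) -> NL X f.
Proof. by move=> Xs NX; exists (unlin X f); split=> //; apply: unlin_mrep. Qed.

Lemma NL_mrep A X f : NL X f -> mrep A X f -> N A.
Proof. by move=> [B [NB HB]]; apply: mrep_N NB HB. Qed.

Lemma NL_lang : lang (L := L) n NL.
Proof.
have [Nsum Nret _ Ntriv Nfirst] := H1; split.
- by move=> X f [A [_ /mrep_lseq]].
- move=> X f Y g a b Xs [B [NB HB]] am bm ba.
  have HA := unlin_mrep Xs; apply: NL_unlin => //.
  apply: (Nret _ B (mrep_seq HA) NB).
  exists (rawm X Y a), (rawm Y X b); split; [exact: lmor_smorph am|exact: lmor_smorph bm|].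
  move=> i i_n; have ra := lmor_rep (i := i) am ltac:(lia).
  have rb := lmor_rep (i := i) bm ltac:(lia).
  apply: rep_inj (rep_cmp ra rb) _; rewrite ba //; exact: rep_id.
- move=> X f Y g [A [NA HA]] [B [NB HB]]; exists (dsum S n A B).
  by split; [exact: Nsum|exact: mrep_dsum].
- by move=> T; exists (trivseq S n T); split; [exact: Ntriv|exact: mrep_triv].
- move=> T T' r [u [du cu eu]]; have [A [NA A1]] := Nfirst u.
  have HA := seq_mrep (Nseq NA); have [Ao Am _] := HA.
  have [d c e] := Am 1%N ltac:(lia); rewrite A1 in d c e.
  exists (seqX A), (seqf A); split; [by exists A|by rewrite -d|by rewrite -c|].
  by rewrite -e eu.
- move=> X f Xs; split=> [[A [NA HA]]|[B [NB HB]]].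
    exists (lrot S n A); split; last exact: mrep_lrot.
    by apply/(H2 (mrep_seq HA)).
  have HA := unlin_mrep Xs; apply: NL_unlin => //; apply/(H2 (mrep_seq HA)).
  exact: mrep_N NB HB (mrep_lrot HA).
- move=> X f Y g r s [A [NA HA]] [B [NB HB]] rh sh E.
  have rr := rawP rh; have rs := rawP sh.
  have [Ao Am _] := HA; have [Bo Bm _] := HB.
  have [d1 c1 _] := rr; have [d2 c2 _] := rs.
  have i1 : (0 < 1 <= n)%N by lia.
  have i2 : (0 < 2 <= n)%N by lia.
  have [|||||u [u1 u2 um]] := H3 NA NB (phi1 := raw (X 1%N) (Y 1%N) r)
    (phi2 := raw (X 2%N) (Y 2%N) s); rewrite ?Ao ?Bo //.
    apply: rep_inj (rep_cmp (Am 1%N i1) rs) _.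
    by rewrite E; apply: rep_cmp rr (Bm 1%N i1).
  have [lm ur] := smorph_lmor HA HB um.
  exists (linm u); split=> //.
    by rewrite /linm; ifs; rewrite u1; case: rr.
  by rewrite /linm; ifs; rewrite u2; case: rs.
Qed.

Lemma N4_LN4 : N4 S n N -> LN4 (L := L) n NL.
Proof.
move=> H4 X f Y g r s [A [NA HA]] [B [NB HB]] rh sh E.
have rr := rawP rh; have rs := rawP sh.
have [Ao Am _] := HA; have [Bo Bm _] := HB.
have [d1 c1 _] := rr; have [d2 c2 _] := rs.
have i1 : (0 < 1 <= n)%N by lia.
have i2 : (0 < 2 <= n)%N by lia.
have [|||||u [u1 u2 um Nc]] := H4 _ _ (raw (X 1%N) (Y 1%N) r)
  (raw (X 2%N) (Y 2%N) s) NA NB; rewrite ?Ao ?Bo //.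
  apply: rep_inj (rep_cmp (Am 1%N i1) rs) _.
  by rewrite E; apply: rep_cmp rr (Bm 1%N i1).
have [lm ur] := smorph_lmor HA HB um.
exists (linm u); split=> //.
- by rewrite /linm; ifs; rewrite u1; case: rr.
- by rewrite /linm; ifs; rewrite u2; case: rs.
- by have [_ _ un] := lm; exists (cone S n A B u); split=> //; apply: mrep_cone.
Qed.

Lemma LN4_N4 : LN4 (L := L) n NL -> N4 S n N.
Proof.
move=> H4 A B p1 p2 NA NB d1 c1 d2 c2 E.
have HA := seq_mrep (Nseq NA); have HB := seq_mrep (Nseq NB).
have [Ao Am _] := HA; have [Bo Bm _] := HB.
have i1 : (0 < 1 <= n)%N by lia.
have i2 : (0 < 2 <= n)%N by lia.
have r1 : rep (S := S) p1 (seqX A 1%N) (seqX B 1%N) (ev p1).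
  by split; rewrite -?Ao -?Bo.
have r2 : rep (S := S) p2 (seqX A 2%N) (seqX B 2%N) (ev p2).
  by split; rewrite -?Ao -?Bo.
have [|a [a1 a2 am Nc]] := H4 _ _ _ _ _ _ (NL_seq NA) (NL_seq NB) (rep_hom r1) (rep_hom r2).
  have [_ _ <-] := rep_cmp (Am 1%N i1) r2.
  by have [_ _ <-] := rep_cmp r1 (Bm 1%N i1); rewrite E.
have um := lmor_smorph HA HB am; have ar i := lmor_rep (i := i) am.
exists (rawm (seqX A) (seqX B) a); split=> //.
- by apply: rep_inj (ar 1%N isT) _; rewrite a1.
- by apply: rep_inj (ar 2%N ltac:(lia)) _; rewrite a2.
have [_ _ an] := am; apply: NL_mrep Nc _; apply: mrep_cone => // i i_n.
by apply: ar; lia.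
Qed.

(** Reconciles two numberings of the psi_j: by the degree i of the map of D, and by k = i-1 as in
    [psi_typed]. *)
Lemma psi_index i : (1 < i)%N ->
  [/\ (2 * i - 3)%N = (2 * i.-1 - 1)%N & (2 * i - 2)%N = (2 * i.-1)%N].
Proof. by move=> i1; split; lia. Qed.

Lemma N4star_LN4star : N4star S n N -> LN4star (L := L) n NL.
Proof.
move=> H4 X f Y g Z h [A [NA HA]] [B [NB HB]] [D [ND HD]] YX ZX ZY E.
have [Ao Am _] := HA; have [Bo Bm _] := HB; have [Do Dm Zn] := HD.
have i1 : (0 < 1 <= n)%N by lia.
have i2 : (0 < 2 <= n)%N by lia.
have in' : (0 < n <= n)%N by lia.
have D1 := Dm 1%N i1; rewrite ZX ZY in D1.
have [||||u [psi [u1 u2 um [pB pA] [ph Nd]]]] := H4 A B D _ NA NB ND _ _ _ erefl; rewrite ?Ao ?Bo ?Do //.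
  apply: rep_inj (rep_cmp (Am 1%N i1) D1) _.
  by rewrite E; have := Bm 1%N i1; rewrite YX.
have [lm ur] := smorph_lmor HA HB um.
pose qB i : lring L := ev (psi (2 * i - 3)%N).
(* [qA] is evaluated at [i.+2], hence the shift back by 2 before the index 2i-2 is formed. *)
pose qA i : lring L := ev (psi (2 * i.-2 - 2)%N).
have rB i : (1 < i < n)%N -> rep (S := S) (psi (2 * i - 3)%N) (Y i.+1) (Z i.+1) (qB i).
  move=> i_n; have [-> _] := psi_index (i := i) ltac:(lia).
  have [d c] := pB i.-1 ltac:(lia).
  have iE : i.-1.+2 = i.+1 by lia.
  rewrite iE Bo in d; last by lia.
  rewrite iE Do in c; last by lia.
  by split=> //; rewrite /qB; have [-> _] := psi_index (i := i) ltac:(lia).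
have rA i : (1 < i < n.-1)%N -> rep (S := S) (psi (2 * i - 2)%N) (X i.+2) (Z i.+1) (qA i.+2).
  move=> i_n; have [_ E2] := psi_index (i := i) ltac:(lia).
  have [d c] := pA i.-1 ltac:(lia); rewrite -E2 in d c.
  have iE : i.-1.+2 = i.+1 by lia.
  have iE' : i.-1.+3 = i.+2 by lia.
  rewrite iE' Ao in d; last by lia.
  rewrite iE Do in c; last by lia.
  by split.
exists (linm u), qA, qB; split=> //.
- by rewrite /linm; ifs; rewrite u1 Ao.
- by rewrite /linm; ifs; rewrite u2; case: D1.
- split=> i i_n; [exact: rep_hom (rB i i_n)|exact: rep_hom (rA i i_n)].
- split; last by exists (Dseq S n A B D u psi); split=> //; apply: mrep_Dseq.
  have nE : n.-1.+1 = n by lia.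
  have rn := rB n.-1 ltac:(lia); rewrite nE in rn.
  have Bn := Bm n in'; have [_ _ Yn] := HB; rewrite Yn YX in Bn.
  have [_ _ <-] := rep_cmp rn (Dm n in').
  have [_ _ <-] := rep_cmp Bn (rep_sm (Am 1%N i1)).
  by rewrite -ph; have -> : (2 * n.-1 - 3)%N = (2 * n - 5)%N by lia.
Qed.

Lemma LN4star_N4star : LN4star (L := L) n NL -> N4star S n N.
Proof.
move=> H4 A B D p2 NA NB ND BA DA DB Dp E.
have HA := seq_mrep (Nseq NA); have HB := seq_mrep (Nseq NB); have HD := seq_mrep (Nseq ND).
have [Ao Am Xn] := HA; have [Bo Bm Yn] := HB; have [Do Dm Zn] := HD.
have i1 : (0 < 1 <= n)%N by lia.
have i2 : (0 < 2 <= n)%N by lia.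
have in' : (0 < n <= n)%N by lia.
have YX : seqX B 1%N = seqX A 1%N by rewrite -Ao ?BA -?Bo.
have ZX : seqX D 1%N = seqX A 2%N by rewrite -Ao -?Do.
have ZY : seqX D 2%N = seqX B 2%N by rewrite -Bo -?Do.
have D1 := Dm 1%N i1; rewrite ZX ZY in D1.
have [|a [pA [pB [a1 a2 am [pBh pAh] [hp Nd]]]]] :=
  H4 _ _ _ _ _ _ (NL_seq NA) (NL_seq NB) (NL_seq ND) YX ZX ZY.
  have [_ _ <-] := rep_cmp (Am 1%N i1) D1.
  by rewrite Dp E.
have um := lmor_smorph HA HB am; have ar i := lmor_rep (i := i) am.
(* Inverts the numbering: odd k = 2i-3 gives i = (k+3)/2, and even k = 2i-2 gives i = k/2 + 1. *)
pose psi k : Mor C :=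
  if odd k then raw (seqX B (k + 3)./2.+1) (seqX D (k + 3)./2.+1) (pB (k + 3)./2)
  else raw (seqX A k./2.+3) (seqX D k./2.+2) (pA k./2.+3).
have psiB i : (1 < i < n)%N ->
    rep (psi (2 * i - 3)%N) (seqX B i.+1) (seqX D i.+1) (pB i).
  move=> i_n; have -> : psi (2 * i - 3)%N = raw (seqX B i.+1) (seqX D i.+1) (pB i).
    rewrite /psi; have -> : odd (2 * i - 3) by lia.
    by have -> : (2 * i - 3 + 3)./2 = i by lia.
  by apply: rawP; apply: pBh.
have psiA i : (1 < i < n.-1)%N ->
    rep (psi (2 * i - 2)%N) (seqX A i.+2) (seqX D i.+1) (pA i.+2).
  move=> i_n; have -> : psi (2 * i - 2)%N = raw (seqX A i.+2) (seqX D i.+1) (pA i.+2).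
    rewrite /psi; have -> : odd (2 * i - 2) = false by lia.
    by have -> : (2 * i - 2)./2 = i.-1 by [lia]; have -> : i.-1.+3 = i.+2 by [lia];
       have -> : i.-1.+2 = i.+1 by [lia].
  by apply: rawP; apply: pAh.
exists (rawm (seqX A) (seqX B) a), psi; split=> //.
- by apply: rep_inj (ar 1%N isT) _; rewrite a1 YX Ao //; exact: rep_id.
- apply: rep_inj (ar 2%N ltac:(lia)) _; rewrite a2 -Dp; exact: D1.
- split=> k k_n.
    have [d c _] := psiB k.+1 ltac:(lia); have [E1 _] := psi_index (i := k.+1) ltac:(lia).
    by rewrite E1 /= in d c; rewrite d c Bo ?Do //; lia.
  have [d c _] := psiA k.+1 ltac:(lia); have [_ E1] := psi_index (i := k.+1) ltac:(lia).
  by rewrite E1 /= in d c; rewrite d c Ao ?Do //; lia.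
- split; last first.
    by apply: NL_mrep Nd _; apply: mrep_Dseq => // i i_n; apply: ar; lia.
  have nE : n.-1.+1 = n by lia.
  have rn := psiB n.-1 ltac:(lia); rewrite nE in rn.
  have nE2 : (2 * n.-1 - 3)%N = (2 * n - 5)%N by lia.
  have Bn := Bm n in'; rewrite Yn YX in Bn.
  have Dn := Dm n in'; rewrite Zn ZX in Dn.
  rewrite nE2 in rn; apply: rep_inj (rep_cmp rn Dn) _.
  by rewrite hp; exact: rep_cmp Bn (rep_sm (Am 1%N i1)).
Qed.

End Transfer.

Local Close Scope ring_scope.

Theorem theorem4p4 (C : addcat) (S : autom C) (n : nat) (N : sseq C -> Prop) :
  3 <= n ->
  (forall A, N A -> is_seq S n A) ->
  N1 S n N -> N2 S n N -> N3 S n N ->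
  (N4 S n N <-> N4star S n N).
Proof.
move=> n3 Nseq H1 H2 H3; have HN := NL_lang n3 Nseq H1 H2 H3.
split=> H4.
  by apply: LN4star_N4star => //; apply: LN4_LN4star => //; apply: N4_LN4.
by apply: LN4_N4 => //; apply: LN4star_LN4 => //; apply: N4star_LN4star.
Qed.
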